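(* Let $X=(X_n)_{n\in\mathbb N}$ be a positive Harris recurrent aperiodic Markov chain with values in $E\subset\mathbb R^d$ (countably generated $\sigma$-field $\mathcal E$), with transition kernel $P$ and initial measure $\nu$. Let $S$ be a $\Psi$-small set with $m=1$ such that $\sup_{x\in S}\mathbb E_x[\tau_S]<\infty$ and $\mathbb E_\nu[\tau_S]<\infty$, and let $A=S\times\{1\}$ be the atom of the associated split chain, with regeneration time $\tau_A$. Assume that the stationary distribution has a bounded density $\pi$ on $\mathbb R^d$. Let $K:\mathbb R^d\to\mathbb R$ satisfy $\int K(x)\,dx=1$, $K(x)\le U$ for all $x\in\mathbb R^d$, and be of one of the two forms $$K(x)=K^{(0)}(|x|)\qquad\text{or}\qquad K(x)=\prod_{k=1}^dK^{(0)}(x_k),$$ where $K^{(0)}$ is a bounded function of bounded variation with support $[-1,1]$. Let $(h_n)_{n\ge1}$ be a positive sequence with $h_n\to0$ and suppose that there exists $\beta>0$ such that $h_n\ge n^{-\beta}$. Let $\hat\pi_n(x)=n^{-1}\sum_{i=1}^nK((x-X_i)/h_n)/h_n^d$. (i) If $\mathbb E_A[\tau_A^p]<\infty$ for some $p>2$ and $0<\beta\,(p/(p-1))<1/d$, then, as $n\to\infty$, $$\mathbb E_\nu\left[\sup_{x\in\mathbb R^d}\big|\hat\pi_n(x)-\mathbb E_\pi[\hat\pi_n(x)]\big|\right]=O\left(\sqrt{\frac{\log(nh_n^{-1})}{nh_n^{dp/(p-1)}}}\right).$$ (ii) If there exists $\lambda>0$ such that $\mathbb E_A[\exp(\lambda\tau_A)]<\infty$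 and $0<\beta<1/d$, then, as $n\to\infty$, $$\mathbb E_\nu\left[\sup_{x\in\mathbb R^d}\big|\hat\pi_n(x)-\mathbb E_\pi[\hat\pi_n(x)]\big|\right]=O\left(\sqrt{\frac{\log(n)^2}{nh_n^{d}}}\right).$$
   Context: Markov chain notions. $X$ is a time-homogeneous Markov chain; $\mathbb P_x,\mathbb E_x$ (resp. $\mathbb P_\nu,\mathbb E_\nu$) refer to the chain started at $X_0=x$ (resp. $X_0\sim\nu$). $\mathbb E_\pi$ is expectation under the stationary distribution, so $\mathbb E_\pi[\hat\pi_n(x)]=h_n^{-d}\int K((x-y)/h_n)\pi(y)\,dy$. The chain is $\psi$-irreducible if there is a $\sigma$-finite measure $\psi$ such that $\psi(B)>0$ implies that for every $x\in E$ there is $n>0$ with $P^n(x,B)>0$. For $B\in\mathcal E$, $\tau_B$ is the time the chain first enters $B$ ($\tau_B=\inf\{n\ge1: X_n\in B\}$). A $\psi$-irreducible chain is positive Harris recurrent if $\mathbb E_x[\tau_B]<\infty$ for all $x\in B$ and all $B\in\mathcal E$ with $\psi(B)>0$. A set $S\in\mathcal E$ is $\Psi$-small (with integer $m\geq 1$) if there are $\delta>0$ and a probability measure $\Psi$ supported by $S$ with $P^m(x,B)\ge\delta\Psi(B)$ for all $x\in S$, $B\in\mathcal E$. Split chain. With $m=1$, the split chain is the Markov chain $Z=(X_n,Y_n)_{n\in\mathbb N}$ on $E\times\{0,1\}$, where $(Y_n)$ are independent Bernoulli($\delta$) variables and: if $X_n\in S$ and $Y_n=1$, then $X_{n+1}\sim\Psi$;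 if $X_n\in S$ and $Y_n=0$, then $X_{n+1}\sim(1-\delta)^{-1}(P(X_n,\cdot)-\delta\Psi(\cdot))$; if $X_n\notin S$, then $X_{n+1}\sim P(X_n,\cdot)$. The set $A=S\times\{1\}$ is an atom of $Z$ and $\tau_A=\inf\{n\ge1: Z_n\in A\}$. $\mathbb P_A,\mathbb E_A$ refer to the split chain started in $A$ ($Z_0\in A$). $|x|$ denotes the Euclidean norm of $x\in\mathbb R^d$. *)

(* Defs.v *)
From HB Require Import structures.
From mathcomp Require Import all_boot all_order all_algebra.
From mathcomp Require Import all_classical all_reals all_analysis.

Set Implicit Arguments.
Unset Strict Implicit.
Unset Printing Implicit Defensive.
Import Order.TTheory GRing.Theory Num.Theory.
Import numFieldNormedType.Exports.

Local Open Scope classical_set_scope.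
Local Open Scope ring_scope.

(* R^d as d-tuples: the library equips tuples with the product (here: Borel)
   sigma-algebra, but defines no Lebesgue measure on them.  The latter is built
   below by recursion on d, from the product of the Lebesgue measure on R with
   the one on R^d. *)
Notation Rd R d := (d.-tuple (measurableTypeR R)).

Section lebesgue_measure_Rd.
Context {R : realType}.

Definition cons_Rd (d : nat) (z : measurableTypeR R * Rd R d) : Rd R d.+1 :=
  [tuple of z.1 :: z.2].

Definition uncons_Rd (d : nat) (x : Rd R d.+1) : measurableTypeR R * Rd R d :=
  (thead x, [tuple of behead x]).

Lemma measurable_cons_Rd (d : nat) :
  measurable_fun setT (@cons_Rd d).
Proof. exact: measurable_cons. Qed.

Lemma measurable_uncons_Rd (d : nat) :
  measurable_fun setT (@uncons_Rd d).
Proof.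
apply/measurable_fun_pairP; split; first exact: measurable_tnth.
exact: measurable_behead.
Qed.

Lemma cons_RdK (d : nat) : cancel (@cons_Rd d) (@uncons_Rd d).
Proof. by case=> a x; congr pair; apply: val_inj. Qed.

Lemma uncons_RdK (d : nat) : cancel (@uncons_Rd d) (@cons_Rd d).
Proof. by move=> x; rewrite [RHS]tuple_eta. Qed.

Section step.
Variables (d : nat) (m : {sigma_finite_measure set (Rd R d) -> \bar R}).
Local Open Scope ereal_scope.

Definition leb_step (A : set (Rd R d.+1)) : \bar R :=
  (lebesgue_measure \x m) (@cons_Rd d @^-1` A).

Let leb_step0 : leb_step set0 = 0.
Proof. by rewrite /leb_step preimage_set0 measure0. Qed.

Let leb_step_ge0 A : 0 <= leb_step A.
Proof. exact: measure_ge0. Qed.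

Let leb_step_sigma_additive : semi_sigma_additive leb_step.
Proof.
have mc A : measurable A -> measurable (@cons_Rd d @^-1` A).
  by move=> mA; rewrite -[X in measurable X]setTI; exact: measurable_cons_Rd.
move=> F mF tF mUF; rewrite /leb_step preimage_bigcup.
apply: measure_semi_sigma_additive => [n||]; first exact: mc.
  apply/trivIsetP => /= i j _ _ ij; rewrite -preimage_setI.
  by move/trivIsetP : tF => /(_ _ _ _ _ ij) ->//; rewrite preimage_set0.
by rewrite -preimage_bigcup; exact: mc.
Qed.

HB.instance Definition _ := isMeasure.Build _ _ _ leb_step
  leb_step0 leb_step_ge0 leb_step_sigma_additive.

Let leb_step_sigma_finite : sigma_finite setT leb_step.
Proof.
have /sigma_finiteP[F [TF ndF Foo]] := sigma_finiteT (@lebesgue_measure R).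
have /sigma_finiteP[G [TG ndG Goo]] := sigma_finiteT m.
exists (fun n => @uncons_Rd d @^-1` (F n `*` G n)).
  rewrite -preimage_bigcup -[LHS](preimage_setT (@uncons_Rd d)); congr preimage.
  rewrite -setXTT TF TG predeqE => -[x y]; split.
    move=> [/= [n _ Fnx] [k _ Gky]]; exists (maxn n k) => //; split.
    - by move: x Fnx; exact/subsetPset/ndF/leq_maxl.
    - by move: y Gky; exact/subsetPset/ndG/leq_maxr.
  by move=> [n _ []/= ? ?]; split; exists n.
move=> n; have [mF Fn] := Foo n; have [mG Gn] := Goo n; split.
  rewrite -[X in measurable X]setTI; apply: measurable_uncons_Rd => //.
  exact: measurableX.
rewrite /leb_step (_ : _ @^-1` _ = F n `*` G n); last first.
  by apply/funext => z; rewrite /preimage /mkset cons_RdK.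
rewrite product_measure1E//.
apply: lte_mul_pinfty => //.
by rewrite ge0_fin_numE//; exact: Fn.
Qed.

HB.instance Definition _ := Measure_isSigmaFinite.Build _ _ _ leb_step
  leb_step_sigma_finite.

End step.

Fixpoint lebesgue_Rd (d : nat) : {sigma_finite_measure set (Rd R d) -> \bar R} :=
  match d with
  | 0 => @dirac _ (Rd R 0) [tuple] R
  | d'.+1 => leb_step (lebesgue_Rd d')
  end.

End lebesgue_measure_Rd.

Section kernel_smoothing.
Context {R : realType} {d : nat}.

Definition enorm (x : Rd R d) : R := Num.sqrt (\sum_(i < d) (tnth x i : R) ^+ 2).

Definition scaled_diff (x y : Rd R d) (h : R) : Rd R d :=
  [tuple ((tnth x i : R) - tnth y i) / h | i < d].

Definition of_bounded_variation (f : R -> R) : Prop :=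
  exists M : R, forall a b : R, a <= b ->
    (total_variation a b f <= M%:E)%E.

Definition kernel_profile (K0 : R -> R) : Prop :=
  [/\ exists M : R, forall t, `|K0 t| <= M,
      of_bounded_variation K0 &
      closure [set t | K0 t != 0] = `[(-1)%R, 1%R]%classic].

Definition kernel_form (K : Rd R d -> R) (K0 : R -> R) : Prop :=
  (forall x, K x = K0 (enorm x)) \/
  (forall x, K x = \prod_(k < d) K0 (tnth x k)).

(* The sample consists of the values of the process at times 1, ..., n. *)
Definition kde (K : Rd R d -> R) (h : R) (n : nat) (y : nat -> Rd R d)
    (x : Rd R d) : R :=
  n%:R^-1 * \sum_(1 <= i < n.+1) K (scaled_diff x (y i) h) / h ^+ d.

End kernel_smoothing.

Definition countably_generated (dT : measure_display) (T : measurableType dT)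
    : Prop :=
  exists G : (set T)^nat, @measurable _ T = <<s range G >>.

Section markov_chains.
Context {R : realType} {dT : measure_display} {T : measurableType dT}.
Local Open Scope ereal_scope.

Section process.
Context {dO : measure_display} {Omega : measurableType dO}.
Variable (Pr : probability Omega R).

Definition past (X : nat -> {mfun Omega >-> T}) (n : nat) : set (set Omega) :=
  <<s [set F | exists i, (i <= n)%N /\
               preimage_set_system setT (X i) measurable F] >>.

(* Q (X_n, B) is a version of the conditional probability of {X_(n+1) \in B}
   given the sigma-algebra generated by X_0, ..., X_n. *)
Definition markov_chain (Q : T -> set T -> \bar R)
    (X : nat -> {mfun Omega >-> T}) : Prop :=
  forall (n : nat) (F : set Omega) (B : set T), past X n F -> measurable B ->
    Pr (F `&` (X n.+1 @^-1` B)) = \int[Pr]_(w in F) Q (X n w) B.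

End process.

Definition hitting_time (Omega : Type) (X : nat -> Omega -> T) (B : set T)
    (w : Omega) : \bar R :=
  ereal_inf [set (n%:R)%:E | n in [set n : nat | (1 <= n)%N /\ B (X n w)]].

(* Under PP mu, X is the Markov chain with transition kernel P and initial
   distribution mu; in particular PP \d_x is the law of the chain started at
   x. *)
Definition markov_family {dO : measure_display} {Omega : measurableType dO}
    (P : R.-pker T ~> T) (PP : probability T R -> probability Omega R)
    (X : nat -> {mfun Omega >-> T}) : Prop :=
  forall mu : probability T R,
    markov_chain (PP mu) (fun x B => P x B) X /\
    (forall B, measurable B -> PP mu (X 0%N @^-1` B) = mu B).

Fixpoint kernel_iter (P : R.-pker T ~> T) (n : nat) (x : T) (B : set T)
    : \bar R :=
  match n with
  | 0 => \d_x B
  | n'.+1 => \int[P x]_y kernel_iter P n' y B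
  end.

(* The null measure, for which the second condition is vacuous, is excluded. *)
Definition psi_irreducible (P : R.-pker T ~> T)
    (psi : {sigma_finite_measure set T -> \bar R}) : Prop :=
  0 < psi setT /\
  forall B, measurable B -> 0 < psi B ->
    forall x, exists n, (0 < n)%N /\ 0 < kernel_iter P n x B.

Definition positive_harris {dO : measure_display} {Omega : measurableType dO}
    (P : R.-pker T ~> T) (PP : probability T R -> probability Omega R)
    (X : nat -> {mfun Omega >-> T})
    (psi : {sigma_finite_measure set T -> \bar R}) : Prop :=
  psi_irreducible P psi /\
  forall B, measurable B -> 0 < psi B ->
    forall x, B x -> \int[PP \d_x]_w hitting_time X B w < +oo.

(* No cyclic decomposition of the state space (up to a psi-null set) of
   length at least 2. *)
Definition aperiodic (P : R.-pker T ~> T)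
    (psi : {sigma_finite_measure set T -> \bar R}) : Prop :=
  ~ exists (k : nat) (D : nat -> set T),
    [/\ (2 <= k)%N,
        forall i, measurable (D i),
        trivIset `I_k D,
        psi (~` \bigcup_(i in `I_k) D i) = 0 &
        forall i x, (i < k)%N -> D i x -> P x (D (i.+1 %% k)%N) = 1].

Definition small_set (P : R.-pker T ~> T) (m : nat) (S : set T) (delta : R)
    (Psi : probability T R) : Prop :=
  [/\ measurable S, (0 < delta)%R, Psi S = 1 &
      forall x B, S x -> measurable B ->
        delta%:E * Psi B <= kernel_iter P m x B].

Definition stationary (P : R.-pker T ~> T) (mu : probability T R) : Prop :=
  forall B, measurable B -> \int[mu]_x P x B = mu B.

End markov_chains.

Section split_chain.
Context {R : realType} {dT : measure_display} {T : measurableType dT}.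
Local Open Scope ereal_scope.
Variables (P : R.-pker T ~> T) (S : set T) (delta : R) (Psi : probability T R).

(* Law of X_(n+1) given (X_n, Y_n) = z.  For delta = 1 the second case is
   meaningless, but the chain started in the atom a.s. does not meet it. *)
Definition split_step (z : T * bool) (B : set T) : \bar R :=
  if z.1 \in S then
    if z.2 then Psi B
    else ((1 - delta)^-1)%:E * (P z.1 B - delta%:E * Psi B)
  else P z.1 B.

(* Y_(n+1) is Bernoulli(delta), independent of X_(n+1) and of the past. *)
Definition split_kernel (z : T * bool) (C : set (T * bool)) : \bar R :=
  delta%:E * split_step z [set x | C (x, true)] +
  (1 - delta)%:E * split_step z [set x | C (x, false)].

Definition atom : set (T * bool) := S `*` [set true].

Definition split_chain_from_atom {dO : measure_display}
    {Omega : measurableType dO} (Pr : probability Omega R)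
    (Z : nat -> {mfun Omega >-> (T * bool)%type}) : Prop :=
  markov_chain Pr split_kernel Z /\ Pr (Z 0%N @^-1` atom) = 1.

End split_chain.

(* Main.v *)
(* Let Q = P - delta 1_S Psi.  Between two visits of its atom A the split chain
   moves with the sub-Markov kernel Q, so P_A(tau_A > i) = Psi Q^i 1; apart from
   this identity, only X, P, Q and Psi are used.

   For a finite family of bounded centered functions f, the expected maximum over
   the family of |f(X_1) + ... + f(X_n)| is bounded by an induction on n carrying
   the exponential moments of these sums: at each regeneration the accumulated
   sum is multiplied by the exponential moment of a block truncated at length M,
   which is controlled by its first two moments through the occupation bound
   sum_i Psi Q^i F <= E_A(tau_A) pi(F).

   The supremum over x is reduced to a finite family, of size polynomial in n and
   1/h, by brackets |K((x - .)/h) - g| <= w with pi(w) = O(h^d n^(-1/2)) on a grid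
   of step h/n; the cells to which pi gives little mass are merged according to
   the quantiles of the coordinates, so that no tail assumption on pi is needed.

   The rates follow by optimizing M, the tails of tau_A being bounded through
   Markov's inequality for the moment at hand. *)

Require Import Defs.
From HB Require Import structures.
From mathcomp Require Import all_boot all_order all_algebra.
From mathcomp Require Import all_classical all_reals all_analysis.
From mathcomp Require Import measurable_realfun ring lra.

Set Implicit Arguments.
Unset Strict Implicit.
Unset Printing Implicit Defensive.
Import Order.TTheory GRing.Theory Num.Theory.
Import numFieldNormedType.Exports.

Local Open Scope classical_set_scope.
Local Open Scope ring_scope.

(** The split chain is known only through its law from the atom, on a space of its own, so that [X]
    and regeneration times are never realized together. The decomposition of [P] is used inside the
    one-step recursion instead: the two parts of each integral are bounded separately, and the age
    since the last regeneration is a parameter of the bound, not a function of the path. No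
    independence of blocks is invoked.

    The maximum is handled through the tangent to the logarithm, z <= ln L / theta + exp (theta z) /
    (theta L). Its right side is linear in the exponential, hence survives integration step after
    step, and L is fixed only at the end.

    Centering enters as an inequality. The occupation bound holds for nonnegative functions, so it
    is applied to B + g and B - g; the truncation of the blocks costs B times the mean number of
    elements cut off.

    The power n^(-1/2) in the brackets, instead of 1/n, comes from radial kernels: a shell of
    thickness 1/n in the squared norm is measured through its one-dimensional sections, which can be
    as long as n^(-1/2). The final rates absorb it. *)

(** * The residual kernel of the minorization *)

Section residual.
Context {R : realType} {dT : measure_display} {T : measurableType dT}.
Variables (P : R.-pker T ~> T) (S : set T) (delta : R) (Psi : probability T R).
Hypotheses (mS : measurable S) (delta_gt0 : 0 < delta).
Hypothesis minor : forall x B, S x -> measurable B ->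
  (delta%:E * Psi B <= P x B)%E.
Local Open Scope ereal_scope.

(** By the minorization the maximum with 0 changes nothing on measurable sets; it is there because a
    measure has to be nonnegative on every set. *)
Let resid0 (x : T) (B : set T) : \bar R := maxe 0 (P x B - (delta * \1_S x)%:E * Psi B).

Let resid0E x B : measurable B -> resid0 x B = P x B - (delta * \1_S x)%:E * Psi B.
Proof.
move=> mB; apply/max_idPr; rewrite sube_ge0; last first.
  by rewrite fin_numM// fin_num_measure.
have [/set_mem Sx|/negP Sx] := boolP (x \in S).
  by rewrite indicE mem_set// mulr1 minor.
by rewrite indicE (negbTE (introN idP Sx)) mulr0 mul0e.
Qed.

Let resid00 x : resid0 x set0 = 0.
Proof. by rewrite resid0E// !measure0 mule0 sube0. Qed.

Let resid0_ge0 x B : 0 <= resid0 x B.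
Proof. by rewrite /resid0 le_max lexx. Qed.

Let resid0_sigma x : semi_sigma_additive (resid0 x).
Proof.
move=> F mF tF mU; rewrite resid0E//.
rewrite (_ : (fun n => _) = (fun n => \sum_(0 <= i < n) P x (F i) -
   (delta * \1_S x)%:E * \sum_(0 <= i < n) Psi (F i))); last first.
  apply/funext => n; elim: n => [|n IH]; first by rewrite !big_geq// mule0 sube0.
  rewrite !big_nat_recr//= IH resid0E// muleDr//; last first.
    by rewrite ge0_adde_def// inE ?sume_ge0.
  rewrite fin_num_oppeD ?fin_numM ?fin_num_measure//.
  by rewrite addeACA.
apply: cvgeB.
- apply: fin_num_adde_defl.
  by rewrite fin_numN fin_numM// fin_num_measure.
- exact: measure_semi_sigma_additive.
- apply: cvgeZl => //; exact: measure_semi_sigma_additive.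
Qed.

HB.instance Definition _ x := isMeasure.Build _ _ _ (resid0 x)
  (resid00 x) (resid0_ge0 x) (@resid0_sigma x).

Let resid : T -> {measure set T -> \bar R} := fun x => resid0 x.

Let measurable_resid B : measurable B -> measurable_fun [set: T] (resid ^~ B).
Proof.
move=> mB; rewrite (_ : (fun _ => _) =
  (fun x => P x B - (delta * \1_S x)%:E * Psi B)); last first.
  by apply/funext => x; exact: resid0E.
apply: emeasurable_funB; first exact: measurable_kernel.
apply: emeasurable_funM => //.
by apply/measurable_EFinP; apply: measurable_funM => //.
Qed.

HB.instance Definition _ := @isKernel.Build _ _ _ _ _ resid measurable_resid.

Let resid_le1 : ereal_sup [set resid x [set: T] | x in [set: T]] <= 1.
Proof.
apply: ge_ereal_sup => _ [x _ <-]; rewrite [leLHS]resid0E// prob_kernel.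
rewrite leeBlDr ?fin_numM ?fin_num_measure//.
rewrite leeDl// mule_ge0// lee_fin mulr_ge0// ltW//.
Qed.

HB.instance Definition _ := @Kernel_isSubProbability.Build _ _ _ _ _ resid resid_le1.

Lemma residual_kernel : exists Q : R.-spker T ~> T, forall x B, measurable B ->
  P x B = Q x B + (delta * \1_S x)%:E * Psi B.
Proof.
exists resid => x B mB; rewrite [in RHS]/= resid0E// subeK//.
by rewrite fin_numM// fin_num_measure.
Qed.

End residual.

(** * Integration tools: monotonicity, image measures, composition and disintegration *)

Section nonneg_integral.
Context d (T : measurableType d) (R : realType).
Local Open Scope ereal_scope.

(* The integral of a nonmeasurable function is a supremum over the simple
   functions below it; this is what gives a meaning to that of [sup_dev]. *)
Lemma ge0_integral_mono (m : {measure set T -> \bar R}) (f g : T -> \bar R) :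
  (forall x, 0 <= f x) -> (forall x, f x <= g x) ->
  \int[m]_x f x <= \int[m]_x g x.
Proof.
move=> f0 fg; have g0 x : 0 <= g x by exact: le_trans (fg x).
rewrite !ge0_integralTE//; apply: le_ereal_sup => _ [h hf <-].
by exists h => // x; exact: le_trans (hf x) (fg x).
Qed.

End nonneg_integral.

Section image_measure.
Context d d' (T1 : measurableType d) (T2 : measurableType d') (R : realType).
Variables (m : {measure set T1 -> \bar R}) (f : T1 -> T2).
Local Open Scope ereal_scope.

Definition image_measure (mf : measurable_fun setT f) :
    {measure set T2 -> \bar R} :=
  measure_function_pushforward__canonical__measure_function_Measure m mf.

Lemma image_measureE mf B : image_measure mf B = m (f @^-1` B).
Proof. by []. Qed.

Lemma ge0_integral_image_measure mf (g : T2 -> \bar R) :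
  (forall y, 0 <= g y) -> measurable_fun setT g ->
  \int[image_measure mf]_y g y = \int[m]_x g (f x).
Proof.
by move=> g0 mg; rewrite ge0_integral_pushforward// preimage_setT.
Qed.

End image_measure.

Section pullback_kernel.
Context d d' d2 (A : measurableType d) (T : measurableType d')
  (U : measurableType d2) (R : realType).
Variables (P : R.-fker T ~> U) (phi : A -> T) (mphi : measurable_fun setT phi).
Local Open Scope ereal_scope.

Let pk : A -> {measure set U -> \bar R} := fun a => P (phi a).

Let measurable_pk B : measurable B -> measurable_fun [set: A] (pk ^~ B).
Proof.
move=> mB; apply: (measurableT_comp (f := P ^~ B)) => //.
exact: measurable_kernel.
Qed.

HB.instance Definition _ := @isKernel.Build _ _ _ _ _ pk measurable_pk.

Let pk_uub : measure_fam_uub pk.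
Proof. by have [r hr] := measure_uub P; exists r => x; exact: hr. Qed.

HB.instance Definition _ := @Kernel_isFinite.Build _ _ _ _ _ pk pk_uub.

Lemma measurable_fun_pullback_integral (k : A * U -> \bar R) :
  (forall z, 0 <= k z) -> measurable_fun setT k ->
  measurable_fun setT (fun a => \int[P (phi a)]_y k (a, y)).
Proof. by move=> k0 mk; exact: (measurable_fun_integral_finite_kernel _ pk). Qed.

Lemma measurable_fun_pullback_xsection (B : set (A * U)) : measurable B ->
  measurable_fun setT (fun a => P (phi a) (xsection B a)).
Proof.
move=> mB; have [r hr] := measure_uub pk.
by apply: (@measurable_fun_xsection_finite_kernel _ _ _ _ _ pk); rewrite inE.
Qed.

End pullback_kernel.

Section kernel_law.
Context d d' (T : measurableType d) (U : measurableType d') (R : realType).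
Variables (Q : R.-fker T ~> U) (m1 : {measure set T -> \bar R}).
Local Open Scope ereal_scope.
Hypothesis m1_fin : m1 setT < +oo.

(** [mkcomp] composes a kernel with one that may also depend on the common source; a one-point
    source makes it produce the image of the measure [m1] under [Q]. *)
Let k : unit * T -> {measure set U -> \bar R} := fun z => Q z.2.

Let measurable_k B : measurable B -> measurable_fun [set: unit * T] (k ^~ B).
Proof.
move=> mB; apply: (measurableT_comp (f := Q ^~ B)) => //.
exact: measurable_kernel.
Qed.

HB.instance Definition _ := @isKernel.Build _ _ _ _ _ k measurable_k.

Let k_uub : measure_fam_uub k.
Proof. by have [r hr] := measure_uub Q; exists r => x; exact: hr. Qed.

HB.instance Definition _ := @Kernel_isFinite.Build _ _ _ _ _ k k_uub.

Let lk : unit -> {measure set T -> \bar R} := fun=> m1.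

Let measurable_lk B : measurable B -> measurable_fun [set: unit] (lk ^~ B).
Proof. by []. Qed.

HB.instance Definition _ := @isKernel.Build _ _ _ _ _ lk measurable_lk.

Let lk_uub : measure_fam_uub lk.
Proof.
exists (fine (m1 setT) + 1)%R => x; rewrite /lk EFinD fineK ?ge0_fin_numE//.
by rewrite lteDl ?ge0_fin_numE// lte01.
Qed.

HB.instance Definition _ := @Kernel_isFinite.Build _ _ _ _ _ lk lk_uub.

Definition kernel_law : {measure set U -> \bar R} := mkcomp lk k tt.

Lemma kernel_lawE B : kernel_law B = \int[m1]_x Q x B.
Proof. by []. Qed.

Lemma ge0_integral_kernel_law (m2 : {measure set U -> \bar R}) F :
  (forall B, measurable B -> m2 B = \int[m1]_x Q x B) ->
  (forall y, 0 <= F y) -> measurable_fun setT F ->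
  \int[m2]_y F y = \int[m1]_x \int[Q x]_y F y.
Proof.
move=> m2E F0 mF; transitivity (\int[kernel_law]_y F y); last first.
  by rewrite (integral_kcomp lk k tt).
by apply: eq_measure_integral => B mB _; rewrite m2E.
Qed.

End kernel_law.

Section disintegration.
Context d d' d2 (A : measurableType d) (T : measurableType d')
  (U : measurableType d2) (R : realType).
Variables (P : R.-fker T ~> U) (phi : A -> T) (mphi : measurable_fun setT phi).
Variable (m : {measure set (A * U) -> \bar R}).
Variable (l : {measure set A -> \bar R}).
Hypothesis lfin : (l setT < +oo)%E.
Local Open Scope ereal_scope.
Hypothesis mE : forall C B, measurable C -> measurable B ->
  m (C `*` B) = \int[l]_(a in C) P (phi a) B.

Let k : A -> {measure set (A * U) -> \bar R} :=
  fun a => image_measure (P (phi a)) (pair1_measurable a).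

Let kE a B : k a B = P (phi a) (xsection B a).
Proof. by rewrite /k image_measureE xsectionE. Qed.

Let measurable_k B : measurable B -> measurable_fun setT (k ^~ B).
Proof.
move=> mB; rewrite (_ : (fun _ => _) = (fun a => P (phi a) (xsection B a))).
  exact: measurable_fun_pullback_xsection.
by apply/funext => a /=; rewrite kE.
Qed.

HB.instance Definition _ := @isKernel.Build _ _ _ _ _ k measurable_k.

Let k_uub : measure_fam_uub k.
Proof.
have [r hr] := measure_uub P; exists r => x.
by rewrite kE xsectionE preimage_setT; exact: hr.
Qed.

HB.instance Definition _ := @Kernel_isFinite.Build _ _ _ _ _ k k_uub.

Let m2 := kernel_law k l.

Let m2E C B : measurable C -> measurable B ->
  m2 (C `*` B) = \int[l]_(a in C) P (phi a) B.
Proof.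
move=> mC mB; rewrite kernel_lawE [RHS]integral_mkcond.
apply: eq_integral => a _; rewrite kE /= patchE; case: ifPn => aC.
  by rewrite in_xsectionX.
by rewrite notin_xsectionX// measure0.
Qed.

(** Rectangles form a pi-system generating the product sigma-field and the measures are finite, so
    the hypothesis on rectangles determines [m]. When a point of [A] is a state together with an
    accumulator, [phi] extracts the part on which the transition depends. *)
Lemma disintegration (H : A * U -> \bar R) :
  (forall z, 0 <= H z) -> measurable_fun setT H ->
  \int[m]_z H z = \int[l]_a \int[P (phi a)]_y H (a, y).
Proof.
move=> H0 mH.
transitivity (\int[m2]_z H z).
  apply: eq_measure_integral => B mB _.
  apply: (@measure_unique _ _ _
    [set C | exists A1, measurable A1 /\ exists A2, measurable A2 /\ C = A1 `*` A2]
    (fun=> setT)) => //.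
  - rewrite measurable_prod_measurableType; congr (<<s _ >>).
    apply/seteqP; split => [C|C].
      move=> [A1 mA1 [A2 mA2 <-]]; exists A1; split => //; by exists A2.
    move=> [A1 [mA1 [A2 [mA2 ->]]]]; exists A1 => //; by exists A2.
  - move=> _ _ [A1 [mA1 [A2 [mA2 ->]]]] [B1 [mB1 [B2 [mB2 ->]]]].
    exists (A1 `&` B1); split; first exact: measurableI.
    exists (A2 `&` B2); split; first exact: measurableI.
    by rewrite setXI.
  - move=> _; exists setT; split => //; exists setT; split => //.
    by rewrite setXTT.
  - by rewrite bigcup_const.
  - move=> _ [A1 [mA1 [A2 [mA2 ->]]]]; rewrite mE// m2E//.
  - move=> _; rewrite -setXTT mE//.
    have [r hr] := measure_uub P.
    apply: (@le_lt_trans _ _ (\int[l]_a r%:E)).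
      apply: ge0_integral_mono => // a; exact/ltW/hr.
    rewrite integral_cst//; have r0 : (0 <= r)%R.
      by rewrite -lee_fin (le_trans _ (ltW (hr point))).
    by rewrite lte_mul_pinfty.
rewrite (@ge0_integral_kernel_law _ _ _ _ _ k l lfin m2 H)//.
apply: eq_integral => a _; exact: ge0_integral_image_measure.
Qed.

End disintegration.

(** * Expectations of functionals of the chain by backward recursion *)

Section past_theory.
Context d (T : measurableType d) dO (Omega : measurableType dO) (R : realType).
Variable X : nat -> {mfun Omega >-> T}.

Lemma past_mono m n (B : set Omega) : (m <= n)%N -> past X m B -> past X n B.
Proof.
move=> mn; apply: sub_sigma_algebra2 => C [i [im iC]]; exists i; split => //.
exact: leq_trans mn.
Qed.

Lemma past_preimage n B : measurable B -> past X n (X n @^-1` B).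
Proof.
move=> mB; apply: sub_sigma_algebra; exists n; split => //; exists B => //.
by rewrite setTI.
Qed.

Lemma past_measurable n (B : set Omega) : past X n B -> measurable B.
Proof.
apply: smallest_sub; first exact: sigma_algebra_measurable.
move=> C [i [_ [D mD <-]]]; exact: measurable_funP.
Qed.

End past_theory.

Section markov_functional.
Context d (T : measurableType d) (R : realType) dA (A : measurableType dA).
Variables (P : R.-pker T ~> T) (upd : A * T -> A).
Hypothesis mupd : measurable_fun setT upd.
Variable F : A -> \bar R.
Hypotheses (F0 : forall a, (0 <= F a)%E) (mF : measurable_fun setT F).
Local Open Scope ereal_scope.

(** The conditional expectation of [F] of the accumulator after [k] more steps, given the present
    state and accumulator. As a function on the state space it can be bounded by induction on [k]
    without any reference to paths. The accumulators in use are the vector of partial sums and the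
    flag that [S] has not been visited. *)
Fixpoint markov_value (k : nat) (z : T * A) : \bar R :=
  if k is k'.+1 then \int[P z.1]_y markov_value k' (y, upd (z.2, y))
  else F z.2.

Lemma markov_value_ge0 k z : 0 <= markov_value k z.
Proof.
by elim: k z => [|k IH] z /=; [exact: F0|apply: integral_ge0].
Qed.

Let H k (w : (T * A) * T) := markov_value k (w.2, upd (w.1.2, w.2)).

Let measurable_H k : measurable_fun setT (markov_value k) ->
  measurable_fun setT (H k).
Proof.
move=> mV; apply: (measurableT_comp mV); apply/measurable_fun_pairP.
split => /=; first exact: measurable_snd.
apply: (measurableT_comp mupd); apply/measurable_fun_pairP; split => /=.
  by apply: (measurableT_comp measurable_snd); exact: measurable_fst.
exact: measurable_snd.
Qed.

Lemma measurable_markov_value k : measurable_fun setT (markov_value k).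
Proof.
elim: k => [|k IH] /=; first exact: (measurableT_comp mF measurable_snd).
apply: (@measurable_fun_pullback_integral _ _ _ _ _ _ _ P _ measurable_fst (H k)).
  by move=> w; exact: markov_value_ge0.
exact: measurable_H.
Qed.

Context dO (Omega : measurableType dO) (Pr : probability Omega R).
Variable X : nat -> {mfun Omega >-> T}.
Hypothesis X_chain : markov_chain Pr (fun x B => P x B) X.
Variable a0 : A.

Fixpoint markov_state (m : nat) (w : Omega) : A :=
  if m is m'.+1 then upd (markov_state m' w, X m w) else a0.

Let past_gen n := [set F | exists i, (i <= n)%N /\
  preimage_set_system setT (X i) measurable F].

(** The past as a measurable space of its own: adaptedness of the accumulator becomes ordinary
    measurability. *)
Let pastT n := g_sigma_algebraType (past_gen n).

Let past_X n : measurable_fun (setT : set (pastT n)) (X n).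
Proof. by move=> _ B mB; rewrite setTI; exact: past_preimage. Qed.

Let past_state n : measurable_fun (setT : set (pastT n)) (markov_state n).
Proof.
elim: n => [|n IH] /=; first exact: measurable_cst.
apply: (measurableT_comp mupd); apply/measurable_fun_pairP; split => /=.
  move=> _ B mB; rewrite setTI; apply: (past_mono (leqnSn n)).
  by have := IH measurableT B mB; rewrite setTI.
exact: past_X.
Qed.

Let Y n w := (X n w, markov_state n w).

Let past_Y n : measurable_fun (setT : set (pastT n)) (Y n).
Proof. by apply/measurable_fun_pairP; split; [exact: past_X|exact: past_state]. Qed.

Let mY n : measurable_fun setT (Y n).
Proof. by move=> _ B mB; apply: (@past_measurable _ _ _ _ X n); exact: past_Y. Qed.

Let mYX n : measurable_fun setT (fun w => (Y n w, X n.+1 w)).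
Proof. by apply/measurable_fun_pairP; split => /=; [exact: mY|exact: measurable_funPT]. Qed.

(** The Markov property is given for events of the past, and preimages under [Y n] are such events.
    So the law of [(Y n, X n.+1)] is known on rectangles and disintegrates along [P]. *)
Let one_step n k : \int[Pr]_w markov_value k.+1 (Y n w) =
  \int[Pr]_w markov_value k (Y n.+1 w).
Proof.
have mV := measurable_markov_value k.
rewrite -(ge0_integral_image_measure Pr (mY n) (markov_value_ge0 k.+1))//; last first.
  exact: measurable_markov_value.
transitivity (\int[image_measure Pr (mYX n)]_w H k w); last first.
  rewrite ge0_integral_image_measure//; last exact: measurable_H.
  by move=> w; exact: markov_value_ge0.
apply/esym.
apply: (@disintegration _ _ _ _ _ _ _ P fst measurable_fst) => //.
- by rewrite [X in X < _](probability_setT Pr : image_measure Pr (mY n) setT = 1) ltry.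
- move=> C B mC mB; rewrite image_measureE.
  have pC : past X n (Y n @^-1` C).
    by have := past_Y (n := n) measurableT mC; rewrite setTI.
  rewrite (_ : _ @^-1` _ = Y n @^-1` C `&` X n.+1 @^-1` B); last first.
    by apply/seteqP; split => w.
  apply: (etrans (X_chain pC mB)).
  rewrite [LHS]integral_mkcond [RHS]integral_mkcond ge0_integral_image_measure//.
  + by move=> y; rewrite patchE; case: ifPn.
  + apply/(measurable_restrictT _ _).1 => //.
    apply: measurable_funTS; apply: (measurableT_comp (f := P ^~ B)) => //.
    exact: measurable_kernel.
- by move=> w; exact: markov_value_ge0.
- exact: measurable_H.
Qed.

Lemma markov_valueE n :
  \int[Pr]_w F (markov_state n w) = \int[Pr]_w markov_value n (X 0%N w, a0).
Proof.
suff main m : (m <= n)%N -> \int[Pr]_w markov_value n (X 0%N w, a0) =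
    \int[Pr]_w markov_value (n - m) (Y m w).
  by rewrite (main n)// subnn.
elim: m => [|m IH] mn; first by rewrite subn0.
by rewrite -one_step subnSK// IH 1?ltnW.
Qed.

End markov_functional.

(** * Integrals against the two parts of the transition kernel, and kernel powers *)

Section residual_integral.
Context d (T : measurableType d) (R : realType).
Variables (P : R.-pker T ~> T) (Q : R.-spker T ~> T) (S : set T) (delta : R)
  (Psi : probability T R).
Hypothesis delta_gt0 : (0 < delta)%R.
Local Open Scope ereal_scope.
Hypothesis PQ : forall x B, measurable B ->
  P x B = Q x B + (delta * \1_S x)%:E * Psi B.

Lemma ge0_integral_residual x f : (forall y, 0 <= f y) -> measurable_fun setT f ->
  \int[P x]_y f y = \int[Q x]_y f y + (delta * \1_S x)%:E * \int[Psi]_y f y.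
Proof.
move=> f0 mf.
have c0 : (0 <= delta * \1_S x)%R by rewrite mulr_ge0// ltW.
pose m2 : {measure set T -> \bar R} := mscale (NngNum c0) Psi.
transitivity (\int[measure_add (Q x) m2]_y f y).
  apply: eq_measure_integral => B mB _; rewrite PQ//.
  by apply/esym; exact: (measure_addE (Q x) m2).
by rewrite ge0_integral_measure_add// ge0_integral_mscale.
Qed.

End residual_integral.

Section null_integral.
Context d (T : measurableType d) (R : realType).
Local Open Scope ereal_scope.

Lemma null_integral (m : {measure set T -> \bar R}) f :
  (forall x, 0 <= f x) -> measurable_fun setT f ->
  \int[m]_x f x = 0 -> m [set x | f x != 0] = 0.
Proof.
move=> f0 mf int0; apply: measure_negligible.
  rewrite (_ : [set _ | _] = ~` (f @^-1` [set 0])); last first.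
    by apply/seteqP; split => x /= /eqP.
  apply: measurableC; rewrite -[X in measurable X]setTI.
  by apply: mf => //; exact: emeasurable_set1.
have : \int[m]_(x in setT) `|f x| = 0.
  by rewrite -int0; apply: eq_integral => x _; rewrite gee0_abs.
move=> /(ae_eq_integral_abs m measurableT mf).1 [N [mN N0 fN]].
exists N; split => // x /= fx0; apply: fN => /= /(_ Logic.I) fx.
by rewrite fx eqxx in fx0.
Qed.

Lemma integral_probability_cst (m : probability T R) (c : R) : \int[m]_x c%:E = c%:E.
Proof. by rewrite integral_cst// [X in _ * X](_ : _ = 1) ?mule1//; exact: probability_setT. Qed.

Lemma integral_probability1 (m : probability T R) : \int[m]_x 1 = 1.
Proof. exact: integral_probability_cst. Qed.

End null_integral.

Section kernel_powers.
Context d (T : measurableType d) (R : realType).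
Variable Q : R.-fker T ~> T.
Local Open Scope ereal_scope.

Fixpoint kpow (n : nat) (F : T -> \bar R) (x : T) : \bar R :=
  if n is n'.+1 then \int[Q x]_y kpow n' F y else F x.

Lemma kpow_ge0 n F : (forall x, 0 <= F x) -> forall x, 0 <= kpow n F x.
Proof. by move=> F0; elim: n => [|n IH] x //=; exact: integral_ge0. Qed.

Lemma measurable_kpow n F : (forall x, 0 <= F x) -> measurable_fun setT F ->
  measurable_fun setT (kpow n F).
Proof.
move=> F0 mF; elim: n => [//|n IH] /=.
apply: measurable_fun_integral_kernel => //; last exact: kpow_ge0.
by move=> U mU; exact: measurable_kernel.
Qed.

Lemma kpow_le n F G : (forall x, 0 <= F x) -> (forall x, F x <= G x) ->
  forall x, kpow n F x <= kpow n G x.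
Proof.
move=> F0 FG; elim: n => [//|n IH] x /=.
by apply: ge0_integral_mono => // y; exact: kpow_ge0.
Qed.

Lemma kpowSr n F x : kpow n.+1 F x = kpow n (fun y => \int[Q y]_z F z) x.
Proof.
elim: n x => [//|n IH] x; transitivity (\int[Q x]_y kpow n.+1 F y) => //.
by apply: eq_integral => y _; exact: IH.
Qed.

Lemma kpowD n F G : (forall x, 0 <= F x) -> measurable_fun setT F ->
  (forall x, 0 <= G x) -> measurable_fun setT G ->
  forall x, kpow n (fun y => F y + G y) x = kpow n F x + kpow n G x.
Proof.
move=> F0 mF G0 mG; elim: n => [//|n IH] x /=.
rewrite -ge0_integralD//; try exact: measurable_kpow;
  try by move=> y _; exact: kpow_ge0.
by apply: eq_integral => y _; rewrite IH.
Qed.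

Lemma kpowZ n (c : R) F : (0 <= c)%R -> (forall x, 0 <= F x) ->
  measurable_fun setT F ->
  forall x, kpow n (fun y => c%:E * F y) x = c%:E * kpow n F x.
Proof.
move=> c0 F0 mF; elim: n => [//|n IH] x /=.
rewrite -ge0_integralZl//; try exact: measurable_kpow;
  try by move=> y _; exact: kpow_ge0.
by apply: eq_integral => y _; rewrite IH.
Qed.

End kernel_powers.

(** * Occupation measure of a block and the stationary distribution *)

Section occupation.
Context d (T : measurableType d) (R : realType).
Variables (P : R.-pker T ~> T) (Q : R.-spker T ~> T) (S : set T) (delta : R)
  (Psi : probability T R).
Hypotheses (delta_gt0 : (0 < delta)%R) (mS : measurable S).
Local Open Scope ereal_scope.
Hypothesis PQ : forall x B, measurable B ->
  P x B = Q x B + (delta * \1_S x)%:E * Psi B.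
Variables (psi : {sigma_finite_measure set T -> \bar R}) (mu : probability T R).
Hypotheses (irr : psi_irreducible P psi) (mu_stat : stationary P mu).
Let age_tail n := \int[Psi]_x kpow Q n (cst 1) x.
Hypothesis age_fin : \sum_(i <oo) age_tail i < +oo.

Let q n x := kpow Q n (cst 1) x.

Let q_ge0 n x : 0 <= q n x. Proof. exact: kpow_ge0. Qed.

Let mq n : measurable_fun setT (q n). Proof. exact: measurable_kpow. Qed.

Let qS n x : q n.+1 x <= q n x.
Proof.
rewrite /q kpowSr; apply: kpow_le => y; first exact: integral_ge0.
by rewrite integral_cst// mul1e; exact: sprob_kernel_le1.
Qed.

Let q_le1 n x : q n x <= 1.
Proof. by elim: n => [//|n IH]; exact: le_trans (qS n x) IH. Qed.

(** The probability, from [x], of never regenerating. It has to vanish [mu]-almost everywhere; the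
    argument is that its zero set [G] is absorbing, has full [Psi]-measure and can be reached from
    every point. *)
Let h x := ereal_inf (range (fun n => q n x)).

Let h_ge0 x : 0 <= h x.
Proof. by apply: le_ereal_inf_tmp => _ [n _ <-]. Qed.

Let h_le n x : h x <= q n x.
Proof. by apply: ereal_inf_lbound; exists n. Qed.

Let cvg_q x : q n x @[n --> \oo] --> h x.
Proof. by apply: ereal_nonincreasing_cvgn; apply/nonincreasing_seqP. Qed.

Let mh : measurable_fun setT h.
Proof. by apply: (emeasurable_fun_cvg q) => // x _; exact: cvg_q. Qed.

Let G := [set x | h x = 0].

Let mG : measurable G.
Proof. by have := mh measurableT (emeasurable_set1 0); rewrite setTI. Qed.

Let Psi_h : \int[Psi]_x h x = 0.
Proof.
apply/eqP; rewrite eq_le integral_ge0// andbT.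
have age_ge0 i : 0 <= age_tail i by apply: integral_ge0 => x _; exact: q_ge0.
apply: (cvge_ge _ (nneseries_tail_cvg age_fin (fun i _ => age_ge0 i))).
apply: nearW => n; apply: (@le_trans _ _ (age_tail n)).
  by apply: ge0_integral_mono => x; [exact: h_ge0|exact: h_le].
apply: le_trans (nneseries_lim_ge n.+1 (fun i _ _ => age_ge0 i)).
by rewrite big_nat1.
Qed.

(** As [h] vanishes [Psi]-almost surely, the regenerating part of [P] contributes nothing. So [h] is
    superharmonic for [P] and not only for [Q], and [P] cannot leave its zero set. *)
Let P_h x : \int[P x]_y h y <= h x.
Proof.
rewrite (ge0_integral_residual delta_gt0 PQ)// Psi_h mule0 adde0.
apply: le_ereal_inf_tmp => _ [n _ <-].
apply: le_trans (qS n x); rewrite /q /=.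
by apply: ge0_integral_mono => // y; exact: h_le.
Qed.

Let P_G x : G x -> P x (~` G) = 0.
Proof.
move=> Gx; have h0 : \int[P x]_y h y = 0.
  apply/eqP; rewrite eq_le integral_ge0// andbT; apply: le_trans (P_h x) _.
  by rewrite Gx.
rewrite -(null_integral h_ge0 mh h0); congr (P x _).
by apply/seteqP; split => y /= /eqP.
Qed.

Let Psi_G : Psi (~` G) = 0.
Proof.
rewrite -(null_integral h_ge0 mh Psi_h); congr (Psi _).
by apply/seteqP; split => y /= /eqP.
Qed.

Let iterE n x B : kernel_iter P n x B = kpow P n (EFin \o \1_B) x.
Proof.
elim: n x => [|n IH] x; first by rewrite /= diracE indicE.
by apply: eq_integral => y _; exact: IH.
Qed.

Let iter_ge0 n x B : 0 <= kernel_iter P n x B.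
Proof. by rewrite iterE; apply: kpow_ge0 => y; rewrite lee_fin. Qed.

Let measurable_iter n B : measurable B ->
  measurable_fun setT (fun x => kernel_iter P n x B).
Proof.
move=> mB; rewrite (_ : (fun _ => _) = kpow P n (EFin \o \1_B)); last first.
  by apply/funext => x; exact: iterE.
apply: measurable_kpow => [y|]; first by rewrite lee_fin.
exact/measurable_EFinP.
Qed.

Let u n x := kernel_iter P n x G.

Let uE n x : u n x = kpow P n (EFin \o \1_G) x.
Proof. exact: iterE. Qed.

Let u_ge0 n x : 0 <= u n x.
Proof. exact: iter_ge0. Qed.

Let mu_ n : measurable_fun setT (u n).
Proof. exact: measurable_iter. Qed.

Let iter_notG n x : G x -> kernel_iter P n x (~` G) = 0.
Proof.
elim: n x => [|n IH] x Gx.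
  by rewrite /= diracE (_ : _ \in _ = false)//; apply/negbTE; rewrite notin_setE.
apply: (@eq_trans _ _ (\int[P x]_y 0)); last by rewrite integral0.
apply: ge0_ae_eq_integral => //; first by apply: measurable_iter; exact: measurableC.
exists (~` G); split => [||y /= Gy]; [exact: measurableC|exact: P_G|].
by apply: contra_not Gy => /IH.
Qed.

Let u_G n x : G x -> u n x = 1.
Proof.
elim: n x => [|n IH] x Gx; first by rewrite /u /= diracE mem_set.
apply: (@eq_trans _ _ (\int[P x]_y 1)); last first.
  by rewrite integral_cst// mul1e; exact: prob_kernel.
apply: ge0_ae_eq_integral => //; first exact: mu_.
exists (~` G); split => [||y /= Gy]; [exact: measurableC|exact: P_G|].
by apply: contra_not Gy => /IH.
Qed.

Let integral_kpow n F : (forall x, 0 <= F x) -> measurable_fun setT F ->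
  \int[mu]_x kpow P n F x = \int[mu]_x F x.
Proof.
move=> F0 mF; elim: n => [//|n <-] /=; apply/esym.
apply: (@ge0_integral_kernel_law _ _ _ _ _ P mu _ mu).
- by rewrite (le_lt_trans (probability_le1 _ _)) ?ltry.
- by move=> B mB; rewrite mu_stat.
- exact: kpow_ge0.
- exact: measurable_kpow.
Qed.

(** By stationarity the mass of [G] after [n] steps from [mu] is still [mu G], and the points of [G]
    alone contribute that much. Nothing is left for the points outside. *)
Let u_notG n : mu (~` G `&` [set x | u n x != 0]) = 0.
Proof.
have m1 : \int[mu]_(x in ~` G) u n x = 0.
  have : \int[mu]_x u n x = mu G.
    transitivity (\int[mu]_x kpow P n (EFin \o \1_G) x).
      by apply: eq_integral => x _; rewrite uE.
    rewrite integral_kpow//; last 2 first.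
    - by move=> y; rewrite /= lee_fin.
    - exact/measurable_EFinP.
    by rewrite integral_indic// setIT.
  rewrite -(setvU G) ge0_integral_setU//; last 3 first.
  - exact: measurableC.
  - by rewrite setvU; exact: mu_.
  - by apply/disj_setPS => x [].
  rewrite (@eq_integral _ _ _ mu G (cst 1)); last first.
    by move=> x /set_mem Gx; rewrite u_G.
  rewrite integral_cst// mul1e => E.
  have Gfin : mu G \is a fin_num by exact: fin_num_measure.
  by rewrite -(addeK (\int[mu]_(x in ~` G) u n x) Gfin) E subee.
have mCG : measurable (~` G) by exact: measurableC.
transitivity (mu [set x | (u n \_ (~` G)) x != 0]); last apply: null_integral.
- congr (mu _); apply/seteqP; split => x /=.
    by move=> [Gx ux]; rewrite patchE mem_set.
  by rewrite patchE; case: ifPn => [/set_mem//|_]; rewrite eqxx.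
- by move=> x; rewrite patchE; case: ifPn.
- apply/(measurable_restrictT _ _).1 => //; exact: measurable_funTS.
- by rewrite -integral_mkcond.
Qed.

Let mu_notG : mu (~` G) = 0.
Proof.
(* Otherwise the complement of [G] would be charged by [psi], hence reached from a point of the
   absorbing set [G]. *)
have psiG : 0 < psi G.
  rewrite lt0e measure_ge0 andbT; apply/negP => /eqP psiG0.
  have psiCG : 0 < psi (~` G).
    have E : psi setT = psi (~` G) + psi G.
      rewrite -(setvU G); apply: measureU => //; first exact: measurableC.
      by apply/seteqP; split => x // [].
    by have := irr.1; rewrite E psiG0 adde0.
  have [x Gx] : exists x, G x.
    apply: contrapT => nG; have CG : ~` G = setT.
      by apply/seteqP; split => x // _ Gx; apply: nG; exists x.
    have /eqP := probability_setT Psi; rewrite -CG.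
    by rewrite [X in X == _](Psi_G) eq_sym onee_eq0.
  have [n [_]] := irr.2 _ (measurableC mG) psiCG x.
  by rewrite iter_notG// ltxx.
apply: measure_negligible; first exact: measurableC.
pose N n := ~` G `&` [set x | u n x != 0].
apply: (@negligibleS _ _ _ _ (\bigcup_n N n)).
  move=> x Gx; have [n [_ ux]] := irr.2 _ mG psiG x.
  by exists n => //; split => //=; rewrite gt_eqF.
apply: negligible_bigcup => n; apply/negligibleP; last exact: u_notG.
apply: measurableI; first exact: measurableC.
rewrite (_ : [set _ | _] = ~` (u n @^-1` [set 0])); last first.
  by apply/seteqP; split => x /= /eqP.
apply: measurableC; have := mu_ n measurableT (emeasurable_set1 0).
by rewrite setTI.
Qed.

Let mu_h : \int[mu]_x h x = 0.
Proof.
transitivity (\int[mu]_x `|h x|).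
  by apply: eq_integral => x _; rewrite gee0_abs.
apply/(ae_eq_integral_abs mu measurableT mh).
exists (~` G); split => [||x /= hx]; [exact: measurableC|exact: mu_notG|].
by apply: contra_not hx => Gx _.
Qed.

Let cvg_mu_q : \int[mu]_x q n x @[n --> \oo] --> 0.
Proof.
rewrite -mu_h; apply: (dominated_cvg measurableT (g := cst 1)) => //.
- exact: finite_measure_integrable_cst.
- by move=> n x _; rewrite gee0_abs.
Qed.

Let integral_P F : (forall x, 0 <= F x) -> measurable_fun setT F ->
  \int[mu]_x F x =
  \int[mu]_x \int[Q x]_y F y + (delta%:E * mu S) * \int[Psi]_y F y.
Proof.
move=> F0 mF; rewrite -[LHS](integral_kpow 1)//=.
transitivity (\int[mu]_x (\int[Q x]_y F y +
    (delta * \1_S x)%:E * \int[Psi]_y F y)).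
  by apply: eq_integral => x _; rewrite (ge0_integral_residual delta_gt0 PQ).
rewrite ge0_integralD//; last 4 first.
- by move=> x _; exact: integral_ge0.
- apply: measurable_fun_integral_kernel => // U mU; exact: measurable_kernel.
- move=> x _; rewrite mule_ge0 ?integral_ge0// lee_fin mulr_ge0// ltW//.
- apply: emeasurable_funM => //; apply/measurable_EFinP; exact: measurable_funM.
congr (_ + _); rewrite ge0_integralZr//; last 3 first.
- apply/measurable_EFinP; exact: measurable_funM.
- by move=> x _; rewrite lee_fin mulr_ge0// ltW.
- exact: integral_ge0.
congr (_ * _); under eq_integral do rewrite EFinM.
rewrite ge0_integralZl//; last 2 first.
- exact/measurable_EFinP.
- by rewrite lee_fin ltW.
by rewrite integral_indic// setIT.
Qed.

(** Decomposition according to the last regeneration among [n] steps, obtained by iterating the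
    stationarity equation along the powers of [Q]. *)
Let renewal n F : (forall x, 0 <= F x) -> measurable_fun setT F ->
  \int[mu]_x F x = \int[mu]_x kpow Q n F x +
  (delta%:E * mu S) * \sum_(0 <= i < n) \int[Psi]_y kpow Q i F y.
Proof.
move=> F0 mF; elim: n => [|n IH]; first by rewrite big_geq// mule0 adde0.
rewrite IH (integral_P (F := kpow Q n F)); last 2 first.
- exact: kpow_ge0.
- exact: measurable_kpow.
pose a i := \int[Psi]_y kpow Q i F y.
have a0 i : 0 <= a i by apply: integral_ge0 => x _; exact: kpow_ge0.
rewrite -/(a n) (_ : \sum_(0 <= i < n.+1) a i = \sum_(0 <= i < n) a i + a n).
  rewrite [X in _ = _ + X]ge0_muleDr ?sume_ge0//.
  by rewrite -addeA [X in _ + X = _]addeC.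
by rewrite big_nat_recr.
Qed.

Lemma occupation_le n F : (forall x, 0 <= F x) -> measurable_fun setT F ->
  \sum_(0 <= i < n) \int[Psi]_y kpow Q i F y <=
  (\sum_(i <oo) age_tail i) * \int[mu]_x F x.
Proof.
move=> F0 mF; set alpha := \sum_(i <oo) _; set c := delta%:E * mu S.
have c0 : 0 <= c by rewrite mule_ge0// lee_fin ltW.
have age_ge0 i : 0 <= age_tail i by apply: integral_ge0 => x _; exact: q_ge0.
have cfin : c \is a fin_num by rewrite fin_numM// fin_num_measure.
(* Kac's formula: the mean block length is 1 / (delta mu(S)). It is the renewal identity for the
   constant 1, whose remainder tends to 0 because [mu_h] holds. *)
have calpha : c * alpha = 1.
  have : \int[mu]_x q n x + c * \sum_(0 <= i < n) age_tail i @[n --> \oo] -->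
      0 + c * alpha.
    apply: cvgeD => //.
    apply: cvgeZl => //; apply: cvg_toP => //.
    by apply: is_cvg_nneseries.
  rewrite add0e => /cvg_lim <-//; apply/esym.
  rewrite (_ : (fun _ => _) = cst 1) ?lim_cst//; apply/funext => k.
  by rewrite /age_tail -renewal// integral_probability1.
rewrite (renewal n F0 mF) -/c ge0_muleDr; last 2 first.
- by apply: integral_ge0 => x _; exact: kpow_ge0.
- rewrite mule_ge0// sume_ge0// => i _; apply: integral_ge0 => x _.
  exact: kpow_ge0.
rewrite muleA [alpha * c]muleC calpha mul1e leeDr// mule_ge0 ?nneseries_ge0//.
by apply: integral_ge0 => x _; exact: kpow_ge0.
Qed.

End occupation.

(** * Exponential moment of a truncated block *)

(** exp u <= 1 / (1 - u), and (1 - u) (1 + u + 2 u^2) = 1 + u^2 (1 - 2 u) >= 1. *)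
Lemma expR_le_quadratic (R : realType) (u : R) : `|u| <= 2^-1 ->
  expR u <= 1 + u + 2 * u ^+ 2.
Proof.
rewrite ler_norml => /andP[lu ul].
have h : 1 - u <= expR (- u) by exact: expR_ge1Dx.
have : expR u * (1 - u) <= 1.
  by rewrite -[leRHS](expRxMexpNx_1 u) ler_wpM2l// ltW.
have u1 : 0 < 1 - u by lra.
move=> h1; rewrite -(ler_pM2r u1); apply: le_trans h1 _.
have : 0 <= u ^+ 2 * (1 - 2 * u) by rewrite mulr_ge0 ?sqr_ge0//; lra.
nra.
Qed.

Section additive_functional.
Context d (T : measurableType d) (R : realType) (Q : R.-spker T ~> T).
Local Open Scope ereal_scope.

(** From age [a], the mean of the sum of the age-dependent weights [phi] over the next [r] elements
    of the current block; [Q] kills the path at regeneration. *)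
Definition additive_value (phi : nat -> T -> \bar R) (r a : nat) (x : T) :=
  \sum_(i < r) kpow Q i.+1 (phi (a + i).+1) x.

Variable phi : nat -> T -> \bar R.
Hypotheses (phi0 : forall i x, 0 <= phi i x)
  (mphi : forall i, measurable_fun setT (phi i)).

Lemma additive_value_ge0 r a x : 0 <= additive_value phi r a x.
Proof. by apply: sume_ge0 => i _; apply: integral_ge0 => y _; exact: kpow_ge0. Qed.

Lemma measurable_additive_value r a :
  measurable_fun setT (additive_value phi r a).
Proof.
apply: emeasurable_sum => i; apply: (measurable_kpow Q i.+1) => //.
Qed.

Lemma integral_additive_value (m : {measure set T -> \bar R}) r a :
  \int[m]_y (phi a.+1 y + additive_value phi r a.+1 y) =
  \sum_(i < r.+1) \int[m]_y kpow Q i (phi (a + i).+1) y.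
Proof.
rewrite ge0_integralD//; last 2 first.
- by move=> y _; exact: additive_value_ge0.
- exact: measurable_additive_value.
rewrite big_ord_recl addn0; congr (_ + _).
rewrite (ge0_integral_sum _ measurableT
  (f := fun (i : 'I_r) y => kpow Q i.+1 (phi (a.+1 + i).+1) y))//; last 2 first.
- by move=> i; apply: (measurable_kpow Q i.+1).
- by move=> i y _; apply: (kpow_ge0 Q i.+1).
by apply: eq_bigr => i _; rewrite lift0 addnS addSn.
Qed.

Lemma additive_valueS r a x : additive_value phi r.+1 a x =
  \int[Q x]_y (phi a.+1 y + additive_value phi r a.+1 y).
Proof. by rewrite (integral_additive_value (Q x)). Qed.

End additive_functional.

Section block_exponential.
Context d (T : measurableType d) (R : realType).
Variables (P : R.-pker T ~> T) (Q : R.-spker T ~> T) (S : set T) (delta : R)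
  (Psi : probability T R).
Hypotheses (delta_gt0 : (0 < delta)%R) (mS : measurable S).
Local Open Scope ereal_scope.
Hypothesis PQ : forall x B, measurable B ->
  P x B = Q x B + (delta * \1_S x)%:E * Psi B.
Variables (theta B : R) (M : nat) (g : T -> R).
Hypotheses (theta_gt0 : (0 < theta)%R) (B_ge0 : (0 <= B)%R)
  (thetaBM : (theta * B * M%:R <= 2^-1)%R).
Hypotheses (mg : measurable_fun setT g) (gB : forall x, (`|g x| <= B)%R).

Lemma residual_mass x : Q x setT + (delta * \1_S x)%:E = 1.
Proof.
by rewrite -[RHS](prob_kernel (s := P) x) PQ// (probability_setT Psi) mule1.
Qed.

Let d0 x : 0 <= (delta * \1_S x)%:E.
Proof. by rewrite lee_fin mulr_ge0// ltW. Qed.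

Let expg y := (expR (theta * g y))%:E.

Let mexpg : measurable_fun setT expg.
Proof.
apply/measurable_EFinP; apply: measurableT_comp => //.
exact: measurable_funM.
Qed.

Let expg_ge0 y : 0 <= expg y. Proof. by rewrite lee_fin expR_ge0. Qed.

(* The exponential moment, from [x] on, of the part of the current block that
   consists of its next [r] elements. *)
Fixpoint block_exp (r : nat) (x : T) : \bar R :=
  if r is r'.+1 then
    \int[Q x]_y (expg y * block_exp r' y) + (delta * \1_S x)%:E
  else 1.

Lemma block_exp_ge0 r x : 0 <= block_exp r x.
Proof.
elim: r x => [//|r IH] x /=; rewrite adde_ge0//.
by apply: integral_ge0 => y _; rewrite mule_ge0.
Qed.

Lemma measurable_block_exp r : measurable_fun setT (block_exp r).
Proof.
elim: r => [|r IH]; first exact: measurable_cst.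
apply: (@emeasurable_funD _ _ _ _ (fun x => \int[Q x]_y (expg y * block_exp r y))
  (fun x => (delta * \1_S x)%:E)); last first.
  by apply/measurable_EFinP; exact: measurable_funM.
apply: measurable_fun_integral_kernel => //.
- by move=> U mU; exact: measurable_kernel.
- by move=> y; rewrite mule_ge0 ?block_exp_ge0.
- exact: emeasurable_funM.
Qed.

(** In the final comparison the last block may be unfinished, and its remaining exponential moment
    may be below 1. This bounds the loss. *)
Lemma block_exp_lb r x : (expR (- (theta * B * r%:R)))%:E <= block_exp r x.
Proof.
elim: r x => [|r IH] x /=; first by rewrite mulr0 oppr0 expR0.
pose e := expR (- (theta * B * r.+1%:R)).
have e0 : (0 <= e)%R by rewrite expR_ge0.
have e1 : (e <= 1)%R.
  by rewrite -expR0 ler_expR oppr_le0 !mulr_ge0// ltW.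
apply: (@le_trans _ _ (e%:E * Q x setT + e%:E * (delta * \1_S x)%:E)).
  by rewrite -ge0_muleDr ?residual_mass ?mule1.
apply: leeD; last first.
  by rewrite -EFinM lee_fin ler_piMl// -lee_fin.
rewrite -integral_cst//; apply: ge0_integral_mono => y.
  by rewrite /= lee_fin.
apply: le_trans (lee_wpmul2l (expg_ge0 y) (IH y)).
rewrite -EFinM lee_fin -expRD ler_expR.
have := gB y; rewrite ler_norml => /andP[gl _].
have : (theta * - B <= theta * g y)%R by rewrite ler_wpM2l// ltW.
by rewrite -natr1; lra.
Qed.

(** The growth of the quadratic majorant of exp when an element of age [i] is added to a sum v with
    |v| <= B (i - 1): the square grows by 2 v g + g^2 <= 2 B i |g|. The shift by [theta * B] keeps
    the integrands nonnegative. *)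
Let phi i y := (theta * (g y + B) + 4 * theta ^+ 2 * B * i%:R * `|g y|)%:E.
Let one (i : nat) (y : T) : \bar R := 1.

Let phi0 i y : 0 <= phi i y.
Proof.
have := gB y; rewrite ler_norml => /andP[gl _].
have t0 := ltW theta_gt0.
by rewrite lee_fin addr_ge0 ?mulr_ge0// -lerBlDr sub0r.
Qed.

Let mphi i : measurable_fun setT (phi i).
Proof.
apply/measurable_EFinP; apply: measurable_funD.
  by apply: measurable_funM => //; exact: measurable_funD.
by apply: measurable_funM => //; exact: measurableT_comp.
Qed.

Let quad (v : R) : R := (1 + theta * v + 2 * (theta * v) ^+ 2)%R.

Let quad_ge0 v : (0 <= quad v)%R.
Proof. by rewrite /quad; nra. Qed.

Let theta_small v a : (a <= M)%N -> (`|v| <= B * a%:R)%R ->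
  (`|theta * v| <= 2^-1)%R.
Proof.
move=> aM va; apply: le_trans thetaBM.
rewrite normrM gtr0_norm// -mulrA ler_wpM2l ?(ltW theta_gt0)//.
by apply: le_trans va _; rewrite ler_wpM2l// ler_nat.
Qed.

(** The exponential of a completed sum is replaced by its quadratic majorant, which is legitimate
    because a sum of at most [M] elements stays below 1/2 after multiplication by [theta]. The mean
    number of elements on the left compensates the shift in [phi]. *)
Lemma block_exp_le r a x v : (a + r = M)%N -> (`|v| <= B * a%:R)%R ->
  (expR (theta * v))%:E * block_exp r x +
    (theta * B)%:E * additive_value Q one r a x <=
  (quad v)%:E + additive_value Q phi r a x.
Proof.
have tB0 : (0 <= theta * B)%R by rewrite mulr_ge0// ltW.
elim: r a x v => [|r IH] a x v arM va.
  rewrite /additive_value !big_ord0 /= mule1 mule0 !adde0 lee_fin.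
  by apply: expR_le_quadratic; apply: theta_small va; rewrite -arM leq_addr.
have Y0 (f : nat -> T -> \bar R) i y : (forall i y, 0 <= f i y) ->
  0 <= additive_value Q f r i y by move=> f0; exact: additive_value_ge0.
have mone i : measurable_fun setT (one i) by exact: measurable_cst.
have mY1 i : measurable_fun setT (additive_value Q one r i).
  by apply: measurable_additive_value.
have mYp i : measurable_fun setT (additive_value Q phi r i).
  by apply: measurable_additive_value.
have mW : measurable_fun setT (fun y => expg y * block_exp r y).
  by apply: emeasurable_funM => //; exact: measurable_block_exp.
have W0 y : 0 <= expg y * block_exp r y by rewrite mule_ge0// block_exp_ge0.
have m1Y : measurable_fun setT (fun y => one a.+1 y + additive_value Q one r a.+1 y).
  exact: emeasurable_funD.
have Y1 y : 0 <= one a.+1 y + additive_value Q one r a.+1 y by rewrite adde_ge0// Y0.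
have mpY : measurable_fun setT (fun y => phi a.+1 y + additive_value Q phi r a.+1 y).
  exact: emeasurable_funD.
have pY y : 0 <= phi a.+1 y + additive_value Q phi r a.+1 y by rewrite adde_ge0// Y0.
rewrite !additive_valueS//.
have -> : block_exp r.+1 x = \int[Q x]_y (expg y * block_exp r y) +
  (delta * \1_S x)%:E by [].
rewrite ge0_muleDr ?integral_ge0// addeAC.
have -> : (expR (theta * v))%:E * (\int[Q x]_y (expg y * block_exp r y)) +
    (theta * B)%:E * (\int[Q x]_y (one a.+1 y + additive_value Q one r a.+1 y)) =
  \int[Q x]_y ((expR (theta * v))%:E * (expg y * block_exp r y) +
    (theta * B)%:E * (one a.+1 y + additive_value Q one r a.+1 y)).
  rewrite [RHS]ge0_integralD//; try by move=> y _; rewrite mule_ge0.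
  all: try exact: emeasurable_funM.
  by congr (_ + _); rewrite ge0_integralZl.
rewrite -[(quad v)%:E]mule1 -(residual_mass x) ge0_muleDr// [leRHS]addeAC.
rewrite -integral_cst// -ge0_integralD//; last first.
  by move=> y _ /=; rewrite lee_fin.
apply: leeD; last first.
  rewrite lee_wpmul2r// lee_fin; apply: expR_le_quadratic.
  by apply: theta_small va; rewrite -arM leq_addr.
apply: ge0_integral_mono => y.
  by rewrite adde_ge0// !mule_ge0 ?block_exp_ge0// ?adde_ge0 ?Y0 ?lee_fin.
have := IH a.+1 y (v + g y)%R.
rewrite addSnnS arM => /(_ erefl).
have vg : (`|v + g y| <= B * a.+1%:R)%R.
  apply: le_trans (ler_normD _ _) _; rewrite -natr1 mulrDr mulr1.
  by rewrite lerD// gB.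
move=> /(_ vg) {}IH.
rewrite muleA /expg -EFinM -expRD -mulrDr.
rewrite [X in _ + X <= _]ge0_muleDr ?Y0// mule1 addeCA.
apply: (le_trans (leeD2l _ IH)); rewrite addeA -EFinD [leRHS]addeA -EFinD.
rewrite leeD2r// lee_fin /quad.
have : (v * g y + `|g y| ^+ 2 / 2 <= B * a.+1%:R * `|g y|)%R.
  have := gB y; have := normr_ge0 (g y); move: va.
  have : (v * g y <= `|v| * `|g y|)%R by rewrite -normrM ler_norm.
  rewrite -[a.+1%:R]natr1; move: (normr_ge0 v); set w := `|g y|%R; set z := `|v|%R.
  move=> z0 vw za w0 wB.
  have : (z * w <= B * a%:R * w)%R by rewrite ler_wpM2r.
  have : (w * w <= B * w)%R by rewrite ler_wpM2r.
  have : (0 <= w * w)%R by rewrite mulr_ge0.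
  by move=> ? ? ?; rewrite expr2; lra.
rewrite real_normK ?num_real// => h.
have : (0 <= theta ^+ 2 * 4 * (B * a.+1%:R * `|g y| - (v * g y + g y ^+ 2 / 2)))%R.
  by rewrite !mulr_ge0 ?exprn_ge0 ?(ltW theta_gt0)// subr_ge0.
by move=> ?; nra.
Qed.

Lemma block_exp_start M' : M = M'.+1 ->
  \int[Psi]_y (expg y * block_exp M' y) +
    (theta * B)%:E * \sum_(i < M) \int[Psi]_y kpow Q i (cst 1) y <=
  1 + \sum_(i < M) \int[Psi]_y kpow Q i (phi i.+1) y.
Proof.
move=> MM'; have tB0 : (0 <= theta * B)%R by rewrite mulr_ge0// ltW.
have one0 i y : 0 <= one i y by [].
have mone i : measurable_fun setT (one i) by exact: measurable_cst.
have mY1 : measurable_fun setT (additive_value Q one M' 1).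
  by apply: measurable_additive_value.
have mYp : measurable_fun setT (additive_value Q phi M' 1).
  by apply: measurable_additive_value.
have Y0 (f : nat -> T -> \bar R) y : (forall i y, 0 <= f i y) ->
  0 <= additive_value Q f M' 1 y by move=> f0; exact: additive_value_ge0.
have := integral_additive_value Q phi0 mphi Psi M' 0.
have := integral_additive_value Q one0 mone Psi M' 0.
rewrite MM' => <- <-.
rewrite -ge0_integralZl//; last 2 first.
- exact: emeasurable_funD.
- by move=> y _; rewrite adde_ge0// Y0.
rewrite -ge0_integralD//; last 4 first.
- by move=> y _; rewrite mule_ge0// block_exp_ge0.
- apply: emeasurable_funM => //; exact: measurable_block_exp.
- by move=> y _; rewrite mule_ge0// adde_ge0// Y0.
- by apply: emeasurable_funM => //; exact: emeasurable_funD.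
rewrite -[X in X + _](integral_probability1 Psi) -ge0_integralD//; last 2 first.
- by move=> y _; rewrite adde_ge0// Y0.
- exact: emeasurable_funD.
apply: ge0_integral_mono => y.
  by rewrite adde_ge0// mule_ge0// ?block_exp_ge0// adde_ge0// Y0.
have := @block_exp_le M' 1 y (g y); rewrite MM' add1n mulr1 => /(_ erefl (gB y)).
rewrite ge0_muleDr ?Y0// mule1 addeCA => h.
apply: (le_trans (leeD2l _ h)); rewrite addeA -EFinD [leRHS]addeA -EFinD.
rewrite leeD2r// lee_fin /quad mulr1.
have : (`|g y| ^+ 2 <= B * `|g y|)%R by rewrite expr2 ler_wpM2r.
rewrite real_normK ?num_real// => h1.
have : (0 <= theta ^+ 2 * (B * `|g y| - g y ^+ 2))%R.
  by rewrite mulr_ge0 ?exprn_ge0 ?(ltW theta_gt0)// subr_ge0.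
have : (0 <= theta ^+ 2 * (B * `|g y|))%R.
  by rewrite !mulr_ge0 ?exprn_ge0 ?(ltW theta_gt0).
by move=> ? ?; nra.
Qed.

(** The term [B * tM] cancels the shift. What survives at first order is [B * r]: a centered
    function has mean 0 over whole blocks only, and [r] stands for the mean number of elements lost
    by truncation. *)
Lemma block_exp_start_le M' (tM r V : R) : M = M'.+1 ->
  \sum_(i < M) \int[Psi]_y kpow Q i (cst 1) y = tM%:E ->
  \sum_(i < M) \int[Psi]_y kpow Q i (fun y => (g y + B)%:E) y <=
    (B * tM + B * r)%:E ->
  \sum_(i < M) i.+1%:R%:E * \int[Psi]_y kpow Q i (fun y => `|g y|%:E) y <= V%:E ->
  \int[Psi]_y (expg y * block_exp M' y) <=
    (1 + theta * B * r + 4 * theta ^+ 2 * B * V)%:E.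
Proof.
move=> MM' tME gr gV; have := block_exp_start MM'.
rewrite tME -EFinM => h; rewrite -(@leeD2rE _ (theta * B * tM)%:E)//.
apply: (le_trans h).
have mgB : measurable_fun setT (fun y => (g y + B)%:E).
  by apply/measurable_EFinP; exact: measurable_funD.
have mga : measurable_fun setT (fun y => `|g y|%:E).
  by apply/measurable_EFinP; exact: measurableT_comp.
have gB0 y : 0 <= (g y + B)%:E.
  by have := gB y; rewrite ler_norml lee_fin => /andP[? _]; lra.
have t0 := ltW theta_gt0.
have k0 i F y : (forall y, 0 <= F y) -> 0 <= kpow Q i F y by move=> F0; exact: kpow_ge0.
have c0 i : (0 <= 4 * theta ^+ 2 * B * i.+1%:R)%R by rewrite !mulr_ge0 ?exprn_ge0.
have -> : \sum_(i < M) \int[Psi]_y kpow Q i (phi i.+1) y =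
    theta%:E * (\sum_(i < M) \int[Psi]_y kpow Q i (fun y => (g y + B)%:E) y) +
    (4 * theta ^+ 2 * B)%:E * (\sum_(i < M) i.+1%:R%:E *
       \int[Psi]_y kpow Q i (fun y => `|g y|%:E) y).
  rewrite !ge0_sume_distrr; last 2 first.
  - by move=> i _; rewrite mule_ge0 ?lee_fin// integral_ge0// => y _; exact: k0.
  - by move=> i _; apply: integral_ge0 => y _; exact: k0.
  rewrite -big_split /=; apply: eq_bigr => i _.
  rewrite muleA -EFinM -!ge0_integralZl//; try exact: measurable_kpow;
    try (by move=> y _; apply: k0).
  rewrite -ge0_integralD//; try (apply: emeasurable_funM => //; exact: measurable_kpow);
    try (by move=> y _; rewrite mule_ge0 ?lee_fin ?k0).
  apply: eq_integral => y _.
  rewrite -!kpowZ// -kpowD//; try (by move=> z; rewrite mule_ge0// lee_fin);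
    try exact: emeasurable_funM.
  by rewrite lee_fin.
apply: (@le_trans _ _ (1 + (theta%:E * (B * tM + B * r)%:E +
   (4 * theta ^+ 2 * B)%:E * V%:E))).
  apply: leeD2l; apply: leeD; apply: lee_wpmul2l => //.
  by rewrite lee_fin !mulr_ge0 ?exprn_ge0.
by rewrite -!EFinM -!EFinD lee_fin; lra.
Qed.

End block_exponential.

(** * Maximal inequality through a potential function *)

Section max_sum.
Context d (T : measurableType d) (R : realType) (N : nat).
Variable f : 'I_N -> T -> R.
Hypothesis mf : forall j, measurable_fun setT (f j).

Definition add_values (z : N.-tuple (measurableTypeR R) * T) :
    N.-tuple (measurableTypeR R) :=
  [tuple (tnth z.1 j : R) + f j z.2 | j < N].

Lemma measurable_add_values : measurable_fun setT add_values.
Proof.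
apply/measurable_fun_tnthP => j.
rewrite (_ : _ \o _ = (fun z => (tnth z.1 j : R) + f j z.2)); last first.
  by apply/funext => z /=; rewrite tnth_mktuple.
apply: measurable_funD.
  exact: (measurableT_comp (measurable_tnth j) measurable_fst).
exact: measurableT_comp.
Qed.

Definition max_abs (s : N.-tuple (measurableTypeR R)) : R :=
  \big[Num.max/0]_(j < N) `|tnth s j : R|.

Lemma measurable_max_abs : measurable_fun setT max_abs.
Proof.
rewrite /max_abs; elim: (index_enum _) => [|j r IH].
  by under eq_fun do rewrite big_nil; exact: measurable_cst.
under eq_fun do rewrite big_cons.
apply: measurable_maxr => //.
apply: (measurableT_comp (@normr_measurable R setT)).
exact: measurable_tnth.
Qed.

Lemma max_abs_ge0 s : 0 <= max_abs s.
Proof. by rewrite /max_abs; apply: bigmax_ge_id. Qed.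

End max_sum.

Section regeneration_bound.
Context d (T : measurableType d) (R : realType).
Variables (P : R.-pker T ~> T) (Q : R.-spker T ~> T) (S : set T) (delta : R)
  (Psi : probability T R).
Hypotheses (delta_gt0 : 0 < delta) (mS : measurable S).
Hypothesis PQ : forall x B, measurable B ->
  P x B = (Q x B + (delta * \1_S x)%:E * Psi B)%E.
Variables (N : nat) (f : 'I_N -> T -> R).
Hypothesis mf : forall j, measurable_fun setT (f j).
Variables (theta B r c L : R) (M : nat) (w : T -> \bar R).
Hypotheses (N_gt0 : (0 < N)%N) (M_gt0 : (0 < M)%N).
Hypotheses (theta_gt0 : 0 < theta) (B_ge0 : 0 <= B) (r_ge0 : 0 <= r)
  (c_ge0 : 0 <= c) (L_ge1 : 1 <= L).
Hypothesis fB : forall j x, `|f j x| <= B.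
Hypotheses (w_ge0 : forall x, (0 <= w x)%E) (mw : measurable_fun setT w).
Hypothesis w_super : forall x, (1 + \int[Q x]_y w y <= w x)%E.

Let L_gt0 : 0 < L := lt_le_trans ltr01 L_ge1.

Let late (i : nat) (y : T) : \bar R := ((M < i)%N%:R)%:E.

Hypothesis late_le : forall k,
  (\int[Psi]_y additive_value Q late k 1 y <= r%:E)%E.

(** A sign for each function: an absolute value is the larger of two linear expressions, each with
    its own exponential. *)
Let I : finType := ('I_N * bool)%type.
Let sgn (v : 'I_N -> R) (i : I) : R := (-1) ^+ i.2 * v i.1.
Let g (i : I) (y : T) : R := sgn (f^~ y) i.

Local Open Scope ereal_scope.

Hypothesis block_le : forall i : I,
  \int[Psi]_y ((expR (theta * g i y))%:E *
     block_exp Q S delta theta (g i) M.-1 y) <= (1 + c)%:E.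

Let late0 i y : 0 <= late i y. Proof. by rewrite lee_fin. Qed.

Let mlate i : measurable_fun setT (late i).
Proof. exact: measurable_cst. Qed.

Let mg i : measurable_fun setT (g i).
Proof. by apply: measurable_funM => //; exact: mf. Qed.

Let gB i y : (`|g i y| <= B)%R.
Proof. by rewrite normrM normrX normrN1 expr1n mul1r. Qed.

(* Age [0] stands for the time before the first regeneration. *)
Let next (a : nat) : nat := if a is a'.+1 then a.+1 else 0.
Let counted (a : nat) : bool := (0 < a <= M)%N.
(** [DD] is the exponential moment still to come from the current block, and [RR] bounds the mean
    number of its terms that will not be counted. Before the first regeneration no term is counted,
    and [w] bounds the mean waiting time. *)
Let DD (i : I) (a : nat) (x : T) : \bar R :=
  if a is a'.+1 then block_exp Q S delta theta (g i) (M - a) x else 1.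
Let RR (k a : nat) (x : T) : \bar R :=
  if a is a'.+1 then additive_value Q late k a x else w x.
Let EE (i : I) (a : nat) (y : T) : \bar R :=
  (if counted a then expR (theta * g i y) else 1)%:E.
(** Each of the [k] steps brings at most one regeneration, worth a factor 1 + c <= exp c. The first
    factor compensates an unfinished block with [DD] below 1. *)
Let KK (k : nat) : R := expR (theta * B * M%:R + c * k%:R).

Let d0 x : 0 <= (delta * \1_S x)%:E.
Proof. by rewrite lee_fin mulr_ge0// ltW. Qed.

Let DD_ge0 i a x : 0 <= DD i a x.
Proof. by case: a => [|a] //=; exact: block_exp_ge0. Qed.

Let mDD i a : measurable_fun setT (DD i a).
Proof.
by case: a => [|a]; [exact: measurable_cst|exact: measurable_block_exp].
Qed.

Let RR_ge0 k a x : 0 <= RR k a x.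
Proof. by case: a => [|a] //=; exact: additive_value_ge0. Qed.

Let mRR k a : measurable_fun setT (RR k a).
Proof. by case: a => [|a] //; exact: measurable_additive_value. Qed.

Let EE_ge0 i a y : 0 <= EE i a y.
Proof. by rewrite lee_fin; case: ifP => //; rewrite expR_ge0. Qed.

Let mEE i a : measurable_fun setT (EE i a).
Proof.
rewrite /EE; case: (counted a); last exact: measurable_cst.
apply/measurable_EFinP; apply: measurableT_comp => //.
exact: measurable_funM.
Qed.

Let DD_step i a x :
  \int[Q x]_y (EE i (next a) y * DD i (next a) y) + (delta * \1_S x)%:E = DD i a x.
Proof.
rewrite /EE; case: a => [|a] /=.
  under eq_integral do rewrite mule1.
  by rewrite integral_cst// mul1e (residual_mass PQ).
rewrite /counted /=; have [aM|Ma] := leqP a.+2 M.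
  by rewrite -[in RHS](subnSK aM).
have -> : (M - a.+1 = 0)%N by apply/eqP; rewrite subn_eq0.
have -> : (M - a.+2 = 0)%N by apply/eqP; rewrite subn_eq0 ltnW.
under eq_integral do rewrite mule1.
by rewrite integral_cst// mul1e (residual_mass PQ).
Qed.

Let RR_step k a x :
  \int[Q x]_y ((~~ counted (next a))%:R%:E + RR k (next a) y) <= RR k.+1 a x.
Proof.
case: a => [|a]; last first.
  rewrite /= additive_valueS//; apply: ge0_integral_mono => y.
    by rewrite adde_ge0 ?lee_fin// additive_value_ge0.
  by rewrite /late /counted /= -ltnNge.
rewrite /= ge0_integralD//.
apply: le_trans (w_super x); apply: leeD2r.
by rewrite integral_cst// mul1e; exact: sprob_kernel_le1.
Qed.

Let Phi (k a : nat) (v : 'I_N -> R) (b : nat) (x : T) : \bar R :=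
  (theta^-1 * ln L + B * b%:R + B * (k%:R * r))%:E +
  (\sum_(i : I) ((theta * L)^-1 * expR (theta * sgn v i) * KK k)%:E * DD i a x +
   B%:E * RR k a x).

(** The tangent to the logarithm at [L], up to an additive constant. It takes the place of Jensen's
    inequality: being linear in the exponential, it can be used at the last step and integrated
    backwards. *)
Let ln_bound (z : R) : (z <= theta^-1 * ln L + (theta * L)^-1 * expR (theta * z))%R.
Proof.
rewrite -(ler_pM2l theta_gt0) mulrDr mulrA divff ?gt_eqF// mul1r.
rewrite invfM !mulrA divff ?gt_eqF// mul1r.
have := expR_ge1Dx (theta * z - ln L).
by rewrite expRD expRN lnK ?posrE// => h; lra.
Qed.

Let DD_lb i a x : 1 <= (KK 0)%:E * DD i a x.
Proof.
have KK0 : (1 <= KK 0)%R.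
  by rewrite /KK mulr0 addr0 -expR0 ler_expR !mulr_ge0// ltW.
case: a => [|a] /=; first by rewrite mule1 lee_fin.
have lb := block_exp_lb delta_gt0 PQ theta_gt0 B_ge0 (gB i) (M - a.+1) x.
have KK00 : 0 <= (KK 0)%:E by rewrite lee_fin expR_ge0.
apply: le_trans (lee_wpmul2l KK00 lb).
rewrite -EFinM lee_fin /KK mulr0 addr0 -expRD -[leLHS]expR0 ler_expR subr_ge0.
by rewrite ler_wpM2l ?mulr_ge0 ?(ltW theta_gt0)// ler_nat leq_subr.
Qed.

Let Phi0 s v a b x : (forall j, (`|(tnth s j : R) - v j| <= B * b%:R)%R) ->
  (max_abs s)%:E <= Phi 0 a v b x.
Proof.
move=> sv; have main j : (`|tnth s j : R|)%:E <= Phi 0 a v b x.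
  pose i0 : I := (j, (v j < 0)%R).
  have gi0 : sgn v i0 = `|v j|%R.
    rewrite /sgn /=; case: ltrP => vj; first by rewrite expr1 mulN1r ltr0_norm.
    by rewrite expr0 mul1r ger0_norm.
  rewrite /Phi mul0r mulr0 addr0.
  apply: (@le_trans _ _ ((theta^-1 * ln L + B * b%:R)%:E +
     ((theta * L)^-1 * expR (theta * `|v j|%R))%:E)).
    rewrite -EFinD lee_fin; have := ln_bound `|v j|%R; have := sv j.
    by have := ler_distD (v j) (tnth s j : R) 0%R; rewrite !subr0; lra.
  apply: leeD2l; rewrite -[leLHS]adde0; apply: leeD; last by rewrite mule_ge0.
  rewrite (bigD1 i0)//= gi0 -[leLHS]adde0; apply: leeD; last first.
    apply: sume_ge0 => i _; rewrite mule_ge0// lee_fin !mulr_ge0 ?expR_ge0//.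
    by rewrite invr_ge0 mulr_ge0// ltW.
  rewrite -[leLHS]mule1 [in leRHS]EFinM -muleA; apply: lee_wpmul2l => //.
  by rewrite lee_fin mulr_ge0 ?expR_ge0// invr_ge0 mulr_ge0 ?(ltW theta_gt0) ?(ltW L_gt0).
apply: (big_ind (fun z => z%:E <= Phi 0 a v b x)) => [|y z|//].
  by apply: le_trans (main (Ordinal N_gt0)); rewrite lee_fin.
by rewrite EFin_max ge_max => -> ->.
Qed.

Let coef_ge0 v i k :
  (0 <= (theta * L)^-1 * expR (theta * sgn v i) * KK k)%R.
Proof. by rewrite !mulr_ge0 ?expR_ge0// invr_ge0 mulr_ge0// ltW. Qed.

(* [Phi k] dominates the conditional expectation of the maximum when [k] steps
   remain, the age is [a], the counted sums are [v] and [b] terms were not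
   counted. *)
Let Phi_step k a v b x :
  \int[Q x]_y Phi k (next a)
    (fun j => v j + (if counted (next a) then f j y else 0))%R
    (~~ counted (next a) + b) y +
  (delta * \1_S x)%:E * \int[Psi]_y Phi k 1 (fun j => (v j + f j y)%R) b y <=
  Phi k.+1 a v b x.
Proof.
pose c1 := (theta^-1 * ln L + B * b%:R + B * (k%:R * r))%R.
pose al i := ((theta * L)^-1 * expR (theta * sgn v i) * KK k)%R.
have al0 i : (0 <= al i)%R by exact: coef_ge0.
have c10 : (0 <= c1)%R.
  by rewrite !addr_ge0 ?mulr_ge0 ?invr_ge0 ?(ltW theta_gt0)// ln_ge0.
have mED a' i : measurable_fun setT (fun y => EE i a' y * DD i a' y).
  exact: emeasurable_funM.
have ED0 a' i y : 0 <= EE i a' y * DD i a' y by rewrite mule_ge0.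
have mRR' (n : nat) a' : measurable_fun setT (fun y => n%:R%:E + RR k a' y).
  exact: emeasurable_funD.
have RR'0 (n : nat) a' y : 0 <= n%:R%:E + RR k a' y by rewrite adde_ge0// lee_fin.
have PhiE n a' y : Phi k a'
      (fun j => v j + (if counted a' then f j y else 0))%R (n + b) y =
    c1%:E + (\sum_i (al i)%:E * (EE i a' y * DD i a' y) +
      B%:E * (n%:R%:E + RR k a' y)).
  rewrite /Phi ge0_muleDr ?lee_fin//.
  rewrite [in RHS](addeCA (\sum_i (al i)%:E * (EE i a' y * DD i a' y))).
  rewrite [RHS]addeA -EFinM -EFinD; congr (_%:E + (_ + _)).
    by rewrite /c1 natrD; lra.
  apply: eq_bigr => i _; rewrite muleA -EFinM; congr (_%:E * _).
  rewrite /al /g /sgn /=; case: (counted a'); last by rewrite addr0 mulr1.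
  by rewrite mulrDr mulrDr expRD; ring.
have lin (m : {measure set T -> \bar R}) n a' : \int[m]_y
    (c1%:E + (\sum_i (al i)%:E * (EE i a' y * DD i a' y) +
      B%:E * (n%:R%:E + RR k a' y))) =
    c1%:E * m setT + (\sum_i (al i)%:E * (\int[m]_y (EE i a' y * DD i a' y)) +
      B%:E * \int[m]_y (n%:R%:E + RR k a' y)).
  rewrite ge0_integralD//; last 2 first.
  - move=> y _; rewrite adde_ge0 ?sume_ge0 ?mule_ge0// => i _.
    by rewrite mule_ge0// lee_fin.
  - apply: emeasurable_funD; last exact: emeasurable_funM.
    by apply: emeasurable_sum => i; exact: emeasurable_funM.
  rewrite integral_cst//; congr (_ + _).
  rewrite ge0_integralD//; last 4 first.
  - by move=> y _; rewrite sume_ge0// => i _; rewrite mule_ge0// lee_fin.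
  - by apply: emeasurable_sum => i; exact: emeasurable_funM.
  - by move=> y _; rewrite mule_ge0.
  - exact: emeasurable_funM.
  rewrite ge0_integral_sum//; last 2 first.
  - by move=> i; exact: emeasurable_funM.
  - by move=> i y _; rewrite mule_ge0// lee_fin.
  congr (_ + _); last by rewrite ge0_integralZl.
  by apply: eq_bigr => i _; rewrite ge0_integralZl// lee_fin.
under eq_integral do rewrite PhiE.
rewrite lin.
have -> : \int[Psi]_y Phi k 1 (fun j => v j + f j y)%R b y =
    c1%:E * Psi setT + (\sum_i (al i)%:E * (\int[Psi]_y (EE i 1 y * DD i 1 y)) +
      B%:E * \int[Psi]_y (0%:R%:E + RR k 1 y)).
  rewrite -lin; apply: eq_integral => y _; rewrite -PhiE.
  by rewrite /counted /= M_gt0.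
rewrite (probability_setT Psi) mule1.
set X := \sum_i _; set J := \int[Q x]_y _; set q1 := Q x setT.
set dx := (delta * \1_S x)%:E.
have dx1 : dx <= 1 by rewrite -(residual_mass PQ x) leeDr.
have dx0 : 0 <= dx by exact: d0.
have IPsi i : 0 <= \int[Psi]_y (EE i 1 y * DD i 1 y) by exact: integral_ge0.
(* The regenerating part of the step opens a block of age 1. Its exponential moment, at most 1 + c,
   will be absorbed by [KK k.+1], and its uncounted terms, at most [r] in the mean, by
   [k.+1%:R * r]. *)
apply: (@le_trans _ _ (c1%:E * q1 + (X + B%:E * J) +
    (dx * c1%:E + (dx * \sum_i ((al i)%:E * (1 + c)%:E) + dx * (B%:E * r%:E))))).
  apply: leeD2l.
  rewrite ge0_muleDr//; last first.
    rewrite adde_ge0 ?sume_ge0 ?mule_ge0//; last exact: integral_ge0.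
    by move=> i _; rewrite mule_ge0// lee_fin.
  apply: leeD2l; rewrite ge0_muleDr//; last 2 first.
  - by rewrite sume_ge0// => i _; rewrite mule_ge0// lee_fin.
  - by rewrite mule_ge0//; exact: integral_ge0.
  apply: leeD; apply: lee_wpmul2l => //.
    apply: lee_sum => i _; apply: lee_wpmul2l; first by rewrite lee_fin.
    have := block_le i; apply: le_trans; apply: ge0_integral_mono => y //.
    by rewrite /EE /counted /= M_gt0 subn1.
  apply: lee_wpmul2l; first by rewrite lee_fin.
  have := late_le k; apply: le_trans; apply: ge0_integral_mono => y.
    by rewrite add0e.
  by rewrite add0e.
rewrite addeACA [X in _ + X <= _]addeACA.
have -> : c1%:E * q1 + dx * c1%:E = c1%:E.
  have q1dx : q1 + dx = 1 by exact: (residual_mass PQ x).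
  rewrite -[RHS]mule1 -q1dx ge0_muleDr//; first by rewrite [dx * _]muleC.
  exact: measure_ge0.
rewrite {1}/Phi.
have -> : (theta^-1 * ln L + B * b%:R + B * (k.+1%:R * r))%:E =
    c1%:E + (B * r)%:E.
  by rewrite -EFinD /c1 -natr1; congr _%:E; ring.
rewrite -[leRHS]addeA; apply: leeD2l; rewrite [leRHS]addeCA.
apply: leeD.
  rewrite ge0_sume_distrr; last first.
    by move=> i _; rewrite mule_ge0 ?lee_fin ?addr_ge0.
  rewrite /X -big_split /=; apply: lee_sum => i _.
  have -> : KK k.+1 = (KK k * expR c)%R.
    by rewrite /KK -expRD -natr1; congr expR; ring.
  pose Ii := \int[Q x]_y (EE i (next a) y * DD i (next a) y).
  have Ii0 : 0 <= Ii by exact: integral_ge0.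
  rewrite mulrA -/(al i) -DD_step -/Ii -/dx.
  rewrite (ge0_muleDr (al i * expR c)%:E Ii0 dx0).
  apply: leeD.
    apply: lee_wpmul2r => //.
    rewrite lee_fin ler_peMr//; apply: le_trans (expR_ge1Dx c).
    by rewrite lerDl.
  rewrite [leLHS]muleC -[X in X * _ <= _]EFinM; apply: lee_wpmul2r => //.
  by rewrite lee_fin ler_wpM2l// expR_ge1Dx.
rewrite [leRHS]addeC; apply: leeD.
  by apply: lee_wpmul2l; [rewrite lee_fin|exact: RR_step].
rewrite EFinM -[leRHS]mul1e; apply: lee_wpmul2r => //.
by rewrite mule_ge0// lee_fin.
Qed.

(** The vector [s] is the sum really accumulated and [v] its counted part, so they differ by at most
    [B] per uncounted term. The age is bookkeeping of the bound: along [Q] it advances, along [Psi]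
    it is reset to 1. *)
Let markov_value_Phi k x s v a b :
  (forall j, (`|(tnth s j : R) - v j| <= B * b%:R)%R) ->
  markov_value P (add_values f) (EFin \o @max_abs R N) k (x, s) <= Phi k a v b x.
Proof.
have F0 s' : 0 <= (EFin \o @max_abs R N) s' by rewrite lee_fin max_abs_ge0.
have mF : measurable_fun setT (EFin \o @max_abs R N).
  by apply/measurable_EFinP; exact: measurable_max_abs.
elim: k x s v a b => [|k IH] x s v a b sv; first exact: Phi0.
rewrite [leLHS]/= (ge0_integral_residual delta_gt0 PQ)/=; last 2 first.
- by move=> y; exact: markov_value_ge0.
- have := measurable_markov_value P (measurable_add_values mf) F0 mF k.
  move=> mV; apply: (measurableT_comp mV); apply/measurable_fun_pairP.
  split; first exact: measurable_id.
  exact: (measurableT_comp (measurable_add_values mf) (pair1_measurable s)).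
apply: le_trans (Phi_step k a v b x); apply: leeD.
  apply: ge0_integral_mono => y; first exact: markov_value_ge0.
  apply: IH => j; rewrite tnth_mktuple /=.
  case: (counted (next a)) => /=.
    by rewrite add0n opprD addrACA subrr addr0.
  rewrite add1n addr0 addrAC -[b.+1%:R]natr1 mulrDr mulr1.
  by apply: le_trans (ler_normD _ _) _; rewrite lerD.
apply: lee_wpmul2l => //; apply: ge0_integral_mono => y.
  exact: markov_value_ge0.
by apply: IH => j; rewrite tnth_mktuple /= opprD addrACA subrr addr0.
Qed.

(** [L] is the initial value of the sum of the [2 * N] exponentials weighted by [KK n]; with this
    choice their whole contribution is 1 / theta. *)
Lemma markov_value_max_le (n : nat) (x : T) :
  L = (2 * N%:R * expR (theta * B * M%:R + c * n%:R))%R ->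
  markov_value P (add_values f) (EFin \o @max_abs R N) n (x, [tuple 0%R | j < N]) <=
  ((ln (2 * N%:R) + 1) / theta + B * M%:R + c * n%:R / theta + B * (n%:R * r))%:E +
  B%:E * w x.
Proof.
move=> LE; apply: (@le_trans _ _ (Phi n 0 (fun=> 0%R) 0 x)).
  by apply: markov_value_Phi => j; rewrite tnth_mktuple subrr normr0 mulr0.
have K0 : (0 < KK n)%R by exact: expR_gt0.
have N0 : (0 < 2 * N%:R :> R)%R by rewrite mulr_gt0// ltr0n.
rewrite /Phi addeA; apply: leeD2r; rewrite mulr0 addr0.
under eq_bigr do rewrite /sgn mulr0 mulr0 expR0 mulr1 mule1.
rewrite sumEFin -EFinD lee_fin big_const iter_addr addr0.
rewrite card_prod card_ord card_bool -[(_ *+ (N * 2)%N)%R]mulr_natl.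
have -> : ((N * 2)%N%:R * ((theta * L)^-1 * KK n) = theta^-1)%R.
  rewrite LE -/(KK n) natrM; field.
  by rewrite !gt_eqF// ltr0n.
have -> : ln L = (ln (2 * N%:R) + (theta * B * M%:R + c * n%:R))%R.
  by rewrite LE lnM ?posrE ?expR_gt0// expRK.
rewrite le_eqVlt; apply/orP; left; apply/eqP; field.
by rewrite gt_eqF.
Qed.

End regeneration_bound.

(** * Hitting times, weighted tail sums and mean return times *)

Section hitting.
Context (Omega T : Type) (R : realType).
Variables (X : nat -> Omega -> T) (B : set T) (w : Omega).

(** The event that the hitting time exceeds [k]. The shift leaves out time 0, as [hitting_time]
    does. *)
Definition avoids (k : nat) : bool := `[< forall j, (j < k)%N -> ~ B (X j.+1 w) >].

Local Open Scope ereal_scope.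

(** Only the indices below the hitting time contribute. The free [Phi] serves first, power and
    exponential moments alike, and its value at infinity covers the paths that never hit [B]. *)
Lemma hitting_time_weight_le (om : nat -> R) (Phi : \bar R -> \bar R) (k : nat) :
  (forall i, (0 <= om i)%R) ->
  (forall n : nat, (\sum_(0 <= i < n) om i)%:E <= Phi n%:R%:E) ->
  Phi +oo = +oo ->
  \sum_(0 <= i < k) (om i * (avoids i)%:R)%:E <=
  Phi (ereal_inf [set (n%:R)%:E | n in [set n : nat | (1 <= n)%N /\ B (X n w)]]).
Proof.
move=> om0 omPhi Phioo.
have [[n0 Bn0]|noB] := pselect (exists n, B (X n.+1 w)); last first.
  rewrite (_ : [set _ | _ in _] = set0) ?ereal_inf0 ?Phioo ?leey//.
  apply/seteqP; split => // y [[|n] [//] _ Bn _]; apply: noB; by exists n.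
have exB : exists n, `[< B (X n.+1 w) >] by exists n0; apply/asboolP.
case: (ex_minnP exB) => n /asboolP Bn nmin {n0 Bn0 exB}.
rewrite (_ : ereal_inf _ = n.+1%:R%:E); last first.
  apply/eqP; rewrite eq_le; apply/andP; split.
    by apply: ereal_inf_lbound; exists n.+1.
  apply: le_ereal_inf_tmp => _ [[|m] [//] _ Bm <-].
  by rewrite lee_fin ler_nat ltnS; apply: nmin; apply/asboolP.
apply: le_trans (omPhi n.+1); rewrite sumEFin lee_fin.
have avoid_lt i : avoids i -> (i <= n)%N.
  move=> /asboolP av; rewrite leqNgt; apply/negP => ni; exact: (av n).
apply: (@le_trans _ _ (\sum_(0 <= i < minn k n.+1) om i)%R); last first.
  by rewrite [leRHS](big_cat_nat (n := minn k n.+1)) ?geq_minr//= lerDl sumr_ge0.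
elim: k => [|k IH]; first by rewrite min0n !big_geq.
rewrite big_nat_recr//=; have [kn|nk] := leqP k n.
  have -> : minn k.+1 n.+1 = (minn k n.+1).+1.
    by rewrite minnSS (minn_idPl kn) (minn_idPl (leqW kn)).
  rewrite big_nat_recr//= lerD// (minn_idPl (leqW kn)) ler_piMr//.
  by case: (avoids k).
have -> : avoids k = false by apply/negP => /avoid_lt; rewrite leqNgt nk.
rewrite mulr0 addr0; apply: le_trans IH _.
by rewrite (minn_idPr nk) (minn_idPr (leqW nk)).
Qed.

End hitting.

Section return_time.
Context d (T : measurableType d) (R : realType).
Variables (P : R.-pker T ~> T) (S : set T).
Hypothesis mS : measurable S.
Local Open Scope ereal_scope.

Let off (F : T -> \bar R) (y : T) := (\1_(~` S) y)%:E * F y.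

Fixpoint avoid_prob (k : nat) (x : T) : \bar R :=
  if k is k'.+1 then \int[P x]_y off (avoid_prob k') y else 1.

Lemma avoid_prob_ge0 k x : 0 <= avoid_prob k x.
Proof.
by case: k => [|k] //=; apply: integral_ge0 => y _; elim: k y => [|k IH] y /=;
  rewrite mule_ge0// ?lee_fin//; apply: integral_ge0 => z _; exact: IH.
Qed.

Let m1 : measurable_fun setT (fun y => (\1_(~` S) y : R)%:E).
Proof. by apply/measurable_EFinP; apply: measurable_indic; exact: measurableC. Qed.

Let off_ge0 F y : (forall y, 0 <= F y) -> 0 <= off F y.
Proof. by move=> F0; rewrite mule_ge0// lee_fin. Qed.

Let moff F : measurable_fun setT F -> measurable_fun setT (off F).
Proof. by move=> mF; exact: emeasurable_funM. Qed.

Lemma measurable_avoid_prob k : measurable_fun setT (avoid_prob k).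
Proof.
elim: k => [|k IH]; first exact: measurable_cst.
apply: measurable_fun_integral_kernel.
- by move=> U mU; exact: measurable_kernel.
- by move=> y; apply: off_ge0; exact: avoid_prob_ge0.
- exact: moff.
Qed.

(** The mean hitting time of [S] as a function of the starting point, built from the kernel and not
    from [PP]: this yields its measurability and the one-step equation [mean_returnE]. *)
Definition mean_return (x : T) : \bar R := \sum_(k <oo) avoid_prob k x.

Lemma mean_return_ge0 x : 0 <= mean_return x.
Proof. by apply: nneseries_ge0 => k _ _; exact: avoid_prob_ge0. Qed.

Lemma measurable_mean_return : measurable_fun setT mean_return.
Proof.
apply: ge0_emeasurable_sum => k *; first exact: avoid_prob_ge0.
exact: measurable_avoid_prob.
Qed.

Lemma mean_returnE x : mean_return x = 1 + \int[P x]_y off mean_return y.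
Proof.
rewrite /mean_return nneseries_recl//; last by move=> k _; exact: avoid_prob_ge0.
congr (_ + _).
under [in RHS]eq_integral => y _.
  rewrite /off -nneseriesZl; last by move=> k _; exact: avoid_prob_ge0.
  over.
rewrite integral_nneseries//; last 2 first.
- by move=> k; apply: moff; exact: measurable_avoid_prob.
- by move=> k y _; apply: off_ge0; exact: avoid_prob_ge0.
rewrite -(@nneseries_addn _ _ 1); last by move=> k; exact: avoid_prob_ge0.
by apply: eq_eseriesr => k _; rewrite addn1.
Qed.

Context dO (Omega : measurableType dO) (Pr : probability Omega R).
Variable X : nat -> {mfun Omega >-> T}.
Hypothesis X_chain : markov_chain Pr (fun x B => P x B) X.

Let upd (z : bool * T) : bool := z.1 && (z.2 \notin S).

Let mupd : measurable_fun setT upd.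
Proof.
apply: (@measurable_fun_bool _ _ _ _ true).
rewrite setTI (_ : _ @^-1` _ = [set true] `*` ~` S); last first.
  apply/seteqP; split => -[b y] /=.
    by rewrite /upd /= => /andP[-> yS]; split => //; move: yS; rewrite notin_setE.
  by rewrite /upd /= => -[-> yS]; apply/negP => /set_mem.
by apply: measurableX => //; exact: measurableC.
Qed.

Let F (b : bool) : \bar R := (b%:R)%:E.

Let value_upd k x b : markov_value P upd F k (x, b) = F b * avoid_prob k x.
Proof.
elim: k x b => [|k IH] x b /=; first by rewrite mule1.
case: b => /=; rewrite /F ?mul1e ?mul0e.
  apply: eq_integral => y _; rewrite IH /upd /off /F indicE /=.
  by rewrite in_setC.
by rewrite integral0_eq// => y _; rewrite IH /upd /F /= mul0e.
Qed.

Let stateE k w : markov_state upd X true k w = avoids X S w k.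
Proof.
elim: k => [|k IH] /=; first by apply/esym/asboolP.
rewrite /upd IH /=; apply/idP/asboolP.
  move=> /andP[/asboolP av XS] j; rewrite ltnS leq_eqVlt => /orP[/eqP ->|/av//].
  by move: XS; rewrite notin_setE.
move=> av; apply/andP; split; last by rewrite notin_setE; exact: av.
by apply/asboolP => j jk; apply: av; exact: ltnW.
Qed.

Lemma mean_return_le :
  \int[Pr]_w mean_return (X 0%N w) <= \int[Pr]_w hitting_time X S w.
Proof.
have mF : measurable_fun setT F by [].
have F0 b : 0 <= F b by rewrite lee_fin.
rewrite integral_nneseries//; last 2 first.
- by move=> k; apply: measurableT_comp => //; exact: measurable_avoid_prob.
- by move=> k w _; exact: avoid_prob_ge0.
apply: lime_le.
  apply: is_cvg_nneseries => k _ _; apply: integral_ge0 => w _.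
  exact: avoid_prob_ge0.
apply: nearW => k.
under eq_bigr => i _.
  rewrite (_ : \int[Pr]_w _ = \int[Pr]_w ((avoids X S w i)%:R)%:E); last first.
    under [RHS]eq_integral do rewrite -stateE.
    apply: etrans (esym (markov_valueE mupd F0 mF X_chain true i)).
    by apply: eq_integral => w _; rewrite value_upd mul1e.
  over.
have mav i : measurable_fun setT (fun w => ((avoids X S w i)%:R : R)%:E).
  under eq_fun do rewrite -stateE.
  apply: (measurableT_comp (f := fun c : bool => (c%:R : R)%:E)) => //.
  elim: i => [|i IH]; first exact: measurable_cst.
  apply: (measurableT_comp mupd); apply/measurable_fun_pairP; split => //=.
rewrite -ge0_integral_sum//.
apply: ge0_integral_mono => w; first by rewrite sume_ge0.
have := @hitting_time_weight_le _ _ R X S w (fun=> 1%R) id k.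
under eq_bigr do rewrite mul1r.
apply => // n.
by rewrite big_const_nat subn0 iter_addr addr0 lee_fin.
Qed.

End return_time.

(** * Waiting time before the first regeneration *)

Section lyapunov.
Context d (T : measurableType d) (R : realType).
Variables (P : R.-pker T ~> T) (Q : R.-spker T ~> T) (S : set T) (delta b : R)
  (Psi : probability T R).
Hypotheses (delta_gt0 : (0 < delta)%R) (mS : measurable S) (b_ge0 : (0 <= b)%R).
Local Open Scope ereal_scope.
Hypothesis PQ : forall x B, measurable B ->
  P x B = Q x B + (delta * \1_S x)%:E * Psi B.
Hypothesis return_le : forall x, S x -> mean_return P S x <= b%:E.

(** The heuristic bound for the mean time to a regeneration: reach [S], then make 1 / delta trials
    on average, separated by excursions of mean length at most [b]. *)
Definition lyapunov (x : T) : \bar R :=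
  (\1_(~` S) x)%:E * mean_return P S x + (b / delta)%:E.

Lemma lyapunov_ge0 x : 0 <= lyapunov x.
Proof.
rewrite adde_ge0 ?mule_ge0 ?lee_fin ?divr_ge0 ?(ltW delta_gt0)//.
exact: mean_return_ge0.
Qed.

Lemma measurable_lyapunov : measurable_fun setT lyapunov.
Proof.
apply: emeasurable_funD => //; apply: emeasurable_funM.
  by apply/measurable_EFinP; apply: measurable_indic; exact: measurableC.
exact: measurable_mean_return.
Qed.

(** Under [P] the left side would equal [mean_return P S x] plus b / delta, which is the right side
    off [S]. On [S] the excess, at most [b], is paid for by the mass removed in passing to [Q],
    since the [Psi]-integral of [lyapunov] is at least b / delta. *)
Lemma lyapunov_super x : 1 + \int[Q x]_y lyapunov y <= lyapunov x.
Proof.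
have bd0 : (0 <= b / delta)%R by rewrite divr_ge0// ltW.
have PE : 1 + \int[P x]_y lyapunov y = mean_return P S x + (b / delta)%:E.
  rewrite ge0_integralD//; last 2 first.
  - by move=> y _; rewrite mule_ge0 ?lee_fin//; exact: mean_return_ge0.
  - apply: emeasurable_funM; last exact: measurable_mean_return.
    by apply/measurable_EFinP; apply: measurable_indic; exact: measurableC.
  rewrite integral_cst// [X in _ * X](prob_kernel (s := P) x) mule1.
  by rewrite addeA -mean_returnE.
rewrite (ge0_integral_residual delta_gt0 PQ) in PE; last 2 first.
- exact: lyapunov_ge0.
- exact: measurable_lyapunov.
have Psi_ge : (b / delta)%:E <= \int[Psi]_y lyapunov y.
  rewrite -[leLHS]mule1 -(integral_probability1 Psi).
  rewrite -ge0_integralZl//; apply: ge0_integral_mono => y.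
    by rewrite mule1 lee_fin.
  by rewrite mule1 leeDr// mule_ge0 ?lee_fin//; exact: mean_return_ge0.
have [xS|xS] := boolP (x \in S); last first.
  rewrite {2}/lyapunov indicE in_setC xS mul1e -PE leeD2l// leeDl//.
  rewrite mule_ge0 ?lee_fin ?mulr_ge0 ?(ltW delta_gt0)//.
  by apply: integral_ge0 => y _; exact: lyapunov_ge0.
rewrite {2}/lyapunov indicE in_setC xS mul0e add0e.
rewrite -(@leeD2rE _ b%:E)// -EFinD.
apply: (@le_trans _ _ (mean_return P S x + (b / delta)%:E)); last first.
  by rewrite [(b / delta + b)%R]addrC EFinD; apply: leeD2r; apply: return_le; exact: set_mem.
rewrite -PE -addeA; apply: leeD2l; apply: leeD2l; rewrite indicE xS mulr1.
rewrite [leLHS](_ : _ = delta%:E * (b / delta)%:E).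
  by apply: lee_wpmul2l => //; rewrite lee_fin ltW.
by rewrite -EFinM mulrC divfK// gt_eqF.
Qed.

End lyapunov.

(** * Law of the split chain before its return to the atom *)

Lemma ge0_integral_mrestr d (T : measurableType d) (R : realType)
    (m : {measure set T -> \bar R}) (D : set T) (mD : measurable D)
    (f : T -> \bar R) :
  (forall x, 0 <= f x)%E -> measurable_fun setT f ->
  (\int[mrestr m mD]_x f x = \int[m]_(x in D) f x)%E.
Proof.
move=> f0 mf; have mCD : measurable (~` D) by exact: measurableC.
rewrite [LHS](ge0_negligible_integral (N := ~` D))//; last first.
  by transitivity (m (~` D `&` D)) => //; rewrite setICl measure0.
rewrite setTD setCK; apply: eq_measure_integral => A mA AD.
by transitivity (m (A `&` D)) => //; rewrite (setIidl AD).
Qed.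

Section split_chain_law.
Context d (T : measurableType d) (R : realType).
Variables (P : R.-pker T ~> T) (Q : R.-spker T ~> T) (S : set T) (delta : R)
  (Psi : probability T R).
Hypotheses (delta_gt0 : (0 < delta)%R) (delta_le1 : (delta <= 1)%R)
  (mS : measurable S).
Local Open Scope ereal_scope.
Hypothesis PQ : forall x B, measurable B ->
  P x B = Q x B + (delta * \1_S x)%:E * Psi B.
Context dO (Omega : measurableType dO) (Pr : probability Omega R).
Variable Z : nat -> {mfun Omega >-> (T * bool)%type}.
Hypothesis Z_chain : split_chain_from_atom P S delta Psi Pr Z.

Let A := atom S.
Let Sf : set (T * bool) := S `*` [set false].
Let Sc : set (T * bool) := (~` S) `*` setT.
Let step (z : T * bool) (B : set T) := split_step P S delta Psi z B.

Let mA : measurable A. Proof. exact: measurableX. Qed.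
Let mSf : measurable Sf. Proof. exact: measurableX. Qed.
Let mSc : measurable Sc. Proof. by apply: measurableX => //; exact: measurableC. Qed.

Let in_A z : (z \in A) = (z.1 \in S) && z.2.
Proof.
case: z => x b; apply/idP/idP; rewrite !inE /A /atom /=.
  by move=> [Sx ->]; rewrite mem_set.
by move=> /andP[/set_mem].
Qed.

Let in_Sf z : (z \in Sf) = (z.1 \in S) && ~~ z.2.
Proof.
case: z => x b; apply/idP/idP; rewrite !inE /Sf /=.
  by move=> [Sx ->]; rewrite mem_set.
by move=> /andP[/set_mem Sx /negbTE ->].
Qed.

Let in_Sc z : (z \in Sc) = (z.1 \notin S).
Proof.
case: z => x b; apply/idP/idP; rewrite !inE /Sc /=.
  by move=> [Sx _]; rewrite notin_setE.
by rewrite notin_setE.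
Qed.

Let stepE z B : measurable B -> step z B =
  (\1_A z)%:E * Psi B + ((\1_Sf z)%:E * ((1 - delta)^-1%:E * Q z.1 B) +
  (\1_Sc z)%:E * Q z.1 B).
Proof.
move=> mB; rewrite /step /split_step !indicE in_A in_Sf in_Sc.
have [xS|xS] := boolP (z.1 \in S); last first.
  by rewrite !mul0e !add0e mul1e PQ// indicE (negbTE xS) mulr0 mul0e adde0.
case: z.2 => /=; first by rewrite !mul0e mul1e !adde0.
rewrite !mul0e adde0 add0e mul1e PQ// indicE xS mulr1 addeK//.
by rewrite fin_numM// fin_num_measure.
Qed.

Let step_ge0 z B : measurable B -> 0 <= step z B.
Proof.
move=> mB; rewrite stepE// !adde_ge0 ?mule_ge0 ?lee_fin//.
by rewrite invr_ge0 subr_ge0.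
Qed.

Let mQ1 B : measurable B -> measurable_fun setT (fun z : T * bool => Q z.1 B).
Proof.
move=> mB; apply: (measurableT_comp (f := Q ^~ B)) => //.
exact: measurable_kernel.
Qed.

Let mind (C : set (T * bool)) : measurable C ->
  measurable_fun setT (fun z => (\1_C z : R)%:E).
Proof. by move=> mC; apply/measurable_EFinP; exact: measurable_indic. Qed.

Let mstep B : measurable B -> measurable_fun setT (step ^~ B).
Proof.
move=> mB; rewrite (_ : step ^~ B = fun z =>
  (\1_A z)%:E * Psi B + ((\1_Sf z)%:E * ((1 - delta)^-1%:E * Q z.1 B) +
  (\1_Sc z)%:E * Q z.1 B)); last by apply/funext => z; exact: stepE.
apply: emeasurable_funD; first by apply: emeasurable_funM => //; exact: mind.
apply: emeasurable_funD; apply: emeasurable_funM; try exact: mind.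
  by apply: emeasurable_funM => //; exact: mQ1.
exact: mQ1.
Qed.

Let kernel_fst z B : measurable B ->
  split_kernel P S delta Psi z (B `*` setT) = step z B.
Proof.
move=> mB; rewrite /split_kernel -/(step z _) -/(step z _).
rewrite (_ : [set x | _] = B); last by apply/seteqP; split => x //= [].
rewrite -ge0_muleDl ?lee_fin ?subr_ge0 ?(ltW delta_gt0)//.
by rewrite -EFinD addrC subrK mul1e.
Qed.

Let kernel_false z B : measurable B ->
  split_kernel P S delta Psi z (B `*` [set false]) = (1 - delta)%:E * step z B.
Proof.
move=> mB; rewrite /split_kernel -/(step z _) -/(step z _).
rewrite (_ : [set x | _] = set0); last by apply/seteqP; split => x //= [].
rewrite (_ : [set x | _] = B); last by apply/seteqP; split => x //= [].
rewrite (stepE z measurable0) !measure0 !mule0 !adde0 mule0.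
by rewrite add0e.
Qed.

Let Av k := [set w | avoids Z A w k].

Let AvS k : Av k.+1 = Av k `&` ~` (Z k.+1 @^-1` A).
Proof.
apply/seteqP; split => w; rewrite /Av /=.
  move=> /asboolP av; split; last exact: av.
  by apply/asboolP => j jk; apply: av; exact: ltnW.
move=> [/asboolP av notA]; apply/asboolP => j.
by rewrite ltnS leq_eqVlt => /orP[/eqP -> //|/av].
Qed.

Let Av0 : Av 0 = setT.
Proof. by apply/seteqP; split => w // _; apply/asboolP. Qed.

Let past_gen n := [set F | exists i, (i <= n)%N /\
  preimage_set_system setT (Z i) measurable F].

Let past_Av k : past Z k (Av k).
Proof.
elim: k => [|k IH].
  by rewrite Av0; apply: (@measurableT _ (g_sigma_algebraType (past_gen 0))).
rewrite AvS; apply: (@measurableI _ (g_sigma_algebraType (past_gen k.+1))).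
  exact: (past_mono (leqnSn k)).
apply: (@measurableC _ (g_sigma_algebraType (past_gen k.+1))).
exact: past_preimage.
Qed.

Let mAv k : measurable (Av k).
Proof. by apply: (@past_measurable _ _ _ _ Z k); exact: past_Av. Qed.

Let mZ1 k : measurable_fun setT (fun w => (Z k w).1).
Proof. by apply: measurableT_comp => //; exact: measurable_funPT. Qed.

(** The law of the first component at time [k.+1] on the event that the atom is avoided at times 1,
    ..., [k]. It starts from [Psi], as the chain leaves the atom, and evolves by [Q]. *)
Let n_ k := image_measure (mrestr Pr (mAv k)) (mZ1 k.+1).

Let Zc n F B : past Z n F -> measurable B ->
  Pr (F `&` Z n.+1 @^-1` B) =
  \int[Pr]_(w in F) split_kernel P S delta Psi (Z n w) B.
Proof. by move=> pF mB; apply: (Z_chain.1 n). Qed.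

Let mstepZ k B : measurable B -> measurable_fun setT (fun w => step (Z k w) B).
Proof.
move=> mB; apply: (measurableT_comp (f := step ^~ B)); first exact: mstep.
exact: measurable_funPT.
Qed.

Let nE k B : measurable B -> n_ k B = \int[Pr]_(w in Av k) step (Z k w) B.
Proof.
move=> mB.
transitivity (Pr ((fun w => (Z k.+1 w).1) @^-1` B `&` Av k)) => //; rewrite setIC.
have := Zc (@past_Av k) (measurableX mB measurableT).
rewrite (_ : Z k.+1 @^-1` _ = (fun w => (Z k.+1 w).1) @^-1` B); last first.
  by apply/seteqP; split => w //= [].
by move=> ->; apply: eq_integral => w _; rewrite kernel_fst.
Qed.

Let n_false k B : measurable B ->
  Pr (Av k `&` Z k.+1 @^-1` (B `*` [set false])) = (1 - delta)%:E * n_ k B.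
Proof.
move=> mB; have mBf : measurable (B `*` [set false]) by exact: measurableX.
rewrite (Zc (@past_Av k) mBf) nE//.
rewrite -ge0_integralZl//; last 3 first.
- by apply: measurable_funTS; exact: mstepZ.
- by move=> w _; exact: step_ge0.
- by rewrite lee_fin subr_ge0.
by apply: eq_integral => w _; rewrite kernel_false.
Qed.

Let n0E B : measurable B -> n_ 0 B = Psi B.
Proof.
move=> mB; rewrite nE// Av0.
rewrite -[RHS]mule1 -(integral_probability1 Pr) -ge0_integralZl//.
apply: ge0_ae_eq_integral => //.
- exact: mstepZ.
- by move=> w _; exact: step_ge0.
- by move=> w _; rewrite mule1.
have mZA : measurable (Z 0%N @^-1` A).
  by rewrite -[X in measurable X]setTI; exact: measurable_funPT.
exists (~` (Z 0%N @^-1` A)); split; first exact: measurableC.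
  have ZA1 : Pr (Z 0%N @^-1` A) = 1 by exact: Z_chain.2.
  by apply: etrans (probability_setC Pr mZA) _; rewrite ZA1 subee.
move=> w /= nw ZA; apply: nw => _; rewrite /step /split_step.
by case: ZA => S1 ->; rewrite mem_set// mule1.
Qed.

Let n_fin k : n_ k setT < +oo.
Proof.
apply: (@le_lt_trans _ _ (Pr (setT `&` Av k))) => //.
apply: le_lt_trans (probability_le1 Pr _) (ltry _).
by rewrite setTI.
Qed.

Let Q_le x B : measurable B -> S x -> Q x B <= (1 - delta)%:E.
Proof.
move=> mB Sx; apply: (@le_trans _ _ (Q x setT)).
  by apply: le_measure => //; rewrite inE.
by rewrite -(@leeD2rE _ (delta * \1_S x)%:E)// (residual_mass PQ) indicE mem_set//
  mulr1 -EFinD subrK.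
Qed.

(** To avoid the atom at time [k.+1] is to be outside [S], or in [S] with label 0. The latter has
    weight 1 - delta, by independence of the label, and this cancels the normalization of the
    residual transition. *)
Let n_next k B : measurable B -> n_ k.+1 B = \int[n_ k]_x Q x B.
Proof.
move=> mB; have mQB : measurable_fun setT (fun x => Q x B) by exact: measurable_kernel.
pose l := image_measure (mrestr Pr (mAv k)) (@measurable_funPT _ _ _ _ (Z k.+1)).
have nk_l F : (forall x, 0 <= F x) -> measurable_fun setT F ->
    \int[n_ k]_x F x = \int[l]_z F z.1.
  move=> F0 mF; rewrite !ge0_integral_image_measure//.
  exact: measurableT_comp.
rewrite nk_l//.
transitivity (\int[l]_z ((\1_(~` A) z)%:E * step z B)).
  rewrite nE// ge0_integral_image_measure//; last 2 first.
  - by move=> z; rewrite mule_ge0 ?lee_fin// step_ge0.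
  - apply: emeasurable_funM; last exact: mstep.
    by apply: mind; exact: measurableC.
  rewrite ge0_integral_mrestr//; last 2 first.
  - by move=> w; rewrite mule_ge0 ?lee_fin// step_ge0.
  - apply: emeasurable_funM; last exact: mstepZ.
    apply: (measurableT_comp (f := fun z => (\1_(~` A) z : R)%:E)).
      by apply: mind; exact: measurableC.
    exact: measurable_funPT.
  rewrite AvS integral_mkcondr; apply: eq_integral => w _.
  rewrite patchE indicE.
  rewrite (_ : (w \in ~` (Z k.+1 @^-1` A)) = (Z k.+1 w \in ~` A)).
    by case: ifPn => _; rewrite ?mul1e ?mul0e.
  by apply/idP/idP; rewrite !inE.
have mSfB : measurable_fun setT (fun z => (\1_Sf z)%:E * ((1 - delta)^-1%:E * Q z.1 B)).
  by apply: emeasurable_funM; [exact: mind|apply: emeasurable_funM => //; exact: mQ1].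
have mScB : measurable_fun setT (fun z => (\1_Sc z)%:E * Q z.1 B).
  by apply: emeasurable_funM; [exact: mind|exact: mQ1].
pose StT : set (T * bool) := S `*` setT.
have mStB : measurable_fun setT (fun z => (\1_StT z)%:E * Q z.1 B).
  apply: emeasurable_funM; [apply: mind; exact: measurableX|exact: mQ1].
transitivity (\int[l]_z ((\1_Sf z)%:E * ((1 - delta)^-1%:E * Q z.1 B) +
    (\1_Sc z)%:E * Q z.1 B)).
  apply: eq_integral => z _; rewrite stepE// !indicE in_setC !in_A in_Sf in_Sc.
  case: (z.1 \in S) => /=; case: z.2 => /=;
    by rewrite ?mul0e ?mul1e ?add0e ?adde0.
transitivity (\int[l]_z ((\1_StT z)%:E * Q z.1 B + (\1_Sc z)%:E * Q z.1 B)); last first.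
  apply: eq_integral => z _; rewrite !indicE in_Sc.
  rewrite (_ : (z \in StT) = (z.1 \in S)); last first.
    by apply/idP/idP; rewrite !inE /StT /= ?inE => // -[].
  by case: (z.1 \in S); rewrite ?mul0e ?mul1e ?add0e ?adde0.
rewrite !ge0_integralD//; try by move=> z _; rewrite !mule_ge0 ?lee_fin// invr_ge0 subr_ge0.
congr (_ + _).
pose F0 : set (T * bool) := setT `*` [set false].
have mF0 : measurable F0 by exact: measurableX.
have c0 : (0 <= 1 - delta)%R by rewrite subr_ge0.
have lF0 (g : T -> \bar R) : (forall x, 0 <= g x) -> measurable_fun setT g ->
    \int[l]_(z in F0) g z.1 = (1 - delta)%:E * \int[n_ k]_x g x.
  move=> g0 mg; have mg1 : measurable_fun setT (fun z : T * bool => g z.1).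
    exact: measurableT_comp.
  rewrite -ge0_integral_mrestr// -(ge0_integral_image_measure _ measurable_fst)//.
  rewrite -(ge0_integral_mscale _ _ (NngNum c0))//.
  apply: eq_measure_integral => C mC _.
  transitivity (Pr (Av k `&` Z k.+1 @^-1` (C `*` [set false]))).
    rewrite image_measureE /mrestr /=.
    transitivity (Pr ((Z k.+1 @^-1` (fst @^-1` C `&` F0)) `&` Av k)) => //.
    rewrite setIC; congr (Pr (_ `&` _)).
    by apply/seteqP; split => w /=; [move=> [? []]|move=> [? ?]].
  by rewrite n_false.
have mS1 : measurable_fun setT (fun x => (\1_S x : R)%:E).
  by apply/measurable_EFinP.
have toF0 (g : T -> \bar R) : \int[l]_z ((\1_Sf z)%:E * g z.1) =
    \int[l]_(z in F0) ((\1_S z.1)%:E * g z.1).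
  rewrite [RHS]integral_mkcond; apply: eq_integral => z _.
  rewrite patchE !indicE in_Sf (_ : (z \in F0) = ~~ z.2); last first.
    by case: z => x b; apply/idP/idP; rewrite !inE /F0 /=; [move=> [_ ->]|move/negbTE].
  by case: z.2; case: (_ \in S); rewrite /= ?mul0e.
rewrite (toF0 (fun x => (1 - delta)^-1%:E * Q x B)).
rewrite (lF0 (fun x => (\1_S x)%:E * ((1 - delta)^-1%:E * Q x B))); last 2 first.
- by move=> x; rewrite !mule_ge0 ?lee_fin// invr_ge0.
- by apply: emeasurable_funM => //; exact: emeasurable_funM.
rewrite -ge0_integralZl//; last 2 first.
- by apply: emeasurable_funM => //; exact: emeasurable_funM.
- by move=> x _; rewrite !mule_ge0 ?lee_fin// invr_ge0.
transitivity (\int[n_ k]_x ((\1_S x)%:E * Q x B)).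
  apply: eq_integral => x _; rewrite indicE.
  have [/set_mem xS|] := boolP (x \in S); last by rewrite !mul0e mule0.
  (* For delta = 1 the normalization is the default value 0, but [Q x] then has no mass for x in
     [S]. *)
  rewrite !mul1e muleA -EFinM; have [d1|d1] := eqVneq (1 - delta)%R 0%R.
    rewrite d1 mul0r mul0e; apply/esym/eqP; rewrite eq_le measure_ge0 andbT.
    by apply: le_trans (Q_le mB xS) _; rewrite d1.
  by rewrite divff// mul1e.
rewrite (nk_l (fun x => (\1_S x)%:E * Q x B)).
- apply: eq_integral => z _; rewrite !indicE.
  rewrite (_ : (z \in StT) = (z.1 \in S))//.
  by apply/idP/idP; rewrite !inE /StT /= ?inE => // -[].
- by move=> x; rewrite mule_ge0 ?lee_fin.
- exact: emeasurable_funM.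
Qed.

Lemma split_chain_avoids k F : (forall x, 0 <= F x) -> measurable_fun setT F ->
  \int[n_ k]_x F x = \int[Psi]_x kpow Q k F x.
Proof.
elim: k F => [|k IH] F F0 mF.
  by apply: eq_measure_integral => B mB _; exact: n0E.
rewrite (@ge0_integral_kernel_law _ _ _ _ _ Q (n_ k))//; last first.
  by move=> B mB; exact: n_next.
rewrite IH; last 2 first.
- by move=> x; exact: integral_ge0.
- by apply: measurable_fun_integral_kernel => // U mU; exact: measurable_kernel.
by apply: eq_integral => x _; rewrite -kpowSr.
Qed.

Lemma split_chain_tail k : Pr [set w | avoids Z (atom S) w k] =
  \int[Psi]_x kpow Q k (cst 1) x.
Proof.
rewrite -split_chain_avoids// integral_cst// mul1e /n_.
by transitivity (Pr (setT `&` Av k)) => //; rewrite setTI.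
Qed.

End split_chain_law.

(** * Tail sums of the return time to the atom *)

Section split_tail_weight.
Context d (T : measurableType d) (R : realType) dO (Omega : measurableType dO).
Variables (Pr : probability Omega R) (Z : nat -> {mfun Omega >-> T}).
Variable A : set T.
Hypothesis mA : measurable A.
Local Open Scope ereal_scope.

Lemma measurable_avoids k : measurable [set w | avoids Z A w k].
Proof.
rewrite (_ : [set _ | _] = \bigcap_(j in `I_k) (Z j.+1 @^-1` (~` A))).
  apply: bigcap_measurableType => j _; rewrite -[X in measurable X]setTI.
  by apply: measurable_funPT => //; exact: measurableC.
apply/seteqP; split => w /=; first by move=> /asboolP av j jk; exact: av.
by move=> av; apply/asboolP => j jk; exact: av.
Qed.

Lemma sum_avoids_le (om : nat -> R) (Phi : \bar R -> \bar R) (k : nat) :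
  (forall i, (0 <= om i)%R) ->
  (forall n : nat, (\sum_(0 <= i < n) om i)%:E <= Phi n%:R%:E) ->
  Phi +oo = +oo ->
  \sum_(0 <= i < k) (om i)%:E * Pr [set w | avoids Z A w i] <=
  \int[Pr]_w Phi (hitting_time Z A w).
Proof.
move=> om0 omPhi Phioo.
apply: (@le_trans _ _
  (\int[Pr]_w \sum_(0 <= i < k) (om i * (avoids Z A w i)%:R)%:E)); last first.
  apply: ge0_integral_mono => w; last exact: hitting_time_weight_le.
  by apply: sume_ge0 => i _; rewrite lee_fin mulr_ge0.
have mav i : measurable_fun setT (fun w => ((avoids Z A w i)%:R : R)%:E).
  rewrite (_ : (fun _ => _) = EFin \o \1_[set w | avoids Z A w i]).
    by apply/measurable_EFinP; apply: measurable_indic; exact: measurable_avoids.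
  apply/funext => w /=; rewrite indicE (_ : (w \in _) = avoids Z A w i)//.
  by apply/idP/idP; rewrite inE.
rewrite ge0_integral_sum//; last 2 first.
- move=> i; under eq_fun do rewrite EFinM; exact: emeasurable_funM.
- by move=> i w _; rewrite lee_fin mulr_ge0.
apply: lee_sum => i _; under eq_integral do rewrite EFinM.
rewrite ge0_integralZl//; last by rewrite lee_fin.
apply: lee_wpmul2l; first by rewrite lee_fin.
have <- : \int[Pr]_w (\1_[set w | avoids Z A w i] w)%:E = Pr [set w | avoids Z A w i].
  by rewrite integral_indic ?setIT//; exact: measurable_avoids.
apply: ge0_integral_mono => w; first by rewrite lee_fin.
rewrite lee_fin indicE (_ : (w \in _) = avoids Z A w i)//.
by apply/idP/idP; rewrite inE.
Qed.

End split_tail_weight.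

(** * Lebesgue measure of sets with small sections *)

Section lebesgue_Rd_bounds.
Context (R : realType).
Local Open Scope ereal_scope.

(** Cavalieri's principle. [leb_step] integrates over the first coordinate last; uniqueness of the
    product measure exchanges the order, so that the sections run along the first coordinate. *)
Lemma lebesgue_Rd_section d (A : set (Rd R d.+1)) (B : set (Rd R d)) (c : R) :
  measurable A -> measurable B -> (0 <= c)%R ->
  (forall a b, A (cons_Rd (a, b)) -> B b) ->
  (forall b, B b -> lebesgue_measure [set a | A (cons_Rd (a, b))] <= c%:E) ->
  lebesgue_Rd d.+1 A <= c%:E * lebesgue_Rd d B.
Proof.
move=> mA mB c0 AB sec.
have mcA : measurable (@cons_Rd R d @^-1` A).
  by rewrite -[X in measurable X]setTI; exact: measurable_cons_Rd.
have -> : lebesgue_Rd d.+1 A =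
    (lebesgue_measure \x^ lebesgue_Rd d) (@cons_Rd R d @^-1` A).
  rewrite [LHS](_ : _ =
    (lebesgue_measure \x lebesgue_Rd d) (@cons_Rd R d @^-1` A))//.
  apply: product_measure_unique => //.
  by move=> A' B' mA' mB'; exact: product_measure2E.
rewrite /product_measure2.
have -> : c%:E * lebesgue_Rd d B = \int[lebesgue_Rd d]_b (c * \1_B b)%:E.
  under eq_integral do rewrite EFinM.
  rewrite ge0_integralZl//; first by rewrite integral_indic// setIT.
  by apply/measurable_EFinP; exact: measurable_indic.
apply: ge0_integral_mono => b /=; first exact: measure_ge0.
rewrite (_ : ysection _ b = [set a | A (cons_Rd (a, b))]); last first.
  by apply/seteqP; split => a; rewrite /ysection /= inE.
have [Bb|nBb] := pselect (B b).
  by rewrite indicE mem_set// mulr1; exact: sec.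
rewrite (_ : [set _ | _] = set0) ?measure0 ?lee_fin ?mulr_ge0//.
by apply/seteqP; split => // a /= /AB.
Qed.

Lemma measurable_box d (a b : 'I_d -> R) :
  measurable [set y : Rd R d | forall i, (a i <= (tnth y i : R) <= b i)%R].
Proof.
rewrite (_ : [set _ | _] = \bigcap_(i in [set: 'I_d])
    ((fun y : Rd R d => tnth y i : measurableTypeR R) @^-1` `[a i, b i]%classic)).
  apply: fin_bigcap_measurable; first exact: finite_finset.
  move=> i _; rewrite -[X in measurable X]setTI.
  exact: measurable_tnth.
apply/seteqP; split => y /= ab i; first by move=> _; rewrite /= in_itv/=; exact: ab.
by have := ab i I; rewrite /= in_itv.
Qed.

Lemma lebesgue_Rd_box d (a b : 'I_d -> R) : (forall i, (a i <= b i)%R) ->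
  lebesgue_Rd d [set y : Rd R d | forall i, (a i <= (tnth y i : R) <= b i)%R] <=
  (\prod_(i < d) (b i - a i))%:E.
Proof.
elim: d a b => [|d IH] a b ab.
  rewrite big_ord0 /=; apply: le_trans (_ : \d_([tuple] : Rd R 0) setT <= _).
    by rewrite le_measure ?inE//; exact: measurable_box.
  by rewrite diracT.
rewrite big_ord_recl EFinM.
set A := [set _ | _].
have := @lebesgue_Rd_section d A
  [set y : Rd R d | forall i, (a (lift ord0 i) <= (tnth y i : R) <= b (lift ord0 i))%R]
  (b ord0 - a ord0)%R.
move=> /(_ _ _ _ _ _)/le_trans; apply => //.
- exact: measurable_box.
- exact: measurable_box.
- by rewrite subr_ge0.
- by move=> x y Axy i; have := Axy (lift ord0 i); rewrite tnthS.
- move=> y _; apply: (@le_trans _ _ (lebesgue_measure `[a ord0, b ord0]%classic)).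
    rewrite le_measure ?inE//.
      rewrite -[X in measurable X]setTI.
      apply: (measurableT_comp (@measurable_cons_Rd R d) (pair2_measurable y)) => //.
      exact: measurable_box.
    by move=> x /(_ ord0); rewrite /= in_itv /= tnth0.
  rewrite lebesgue_measure_itv/= lte_fin; case: ifPn => // _.
  by rewrite lee_fin subr_ge0.
- apply: lee_wpmul2l; first by rewrite lee_fin subr_ge0.
  exact: IH.
Qed.

End lebesgue_Rd_bounds.

(** * Support, variation and measurability of the smoothing kernel *)

Section kernel_regularity.
Context (R : realType).

Lemma measurable_scaled_diff d (x : Rd R d) (h : R) :
  measurable_fun setT (fun y : Rd R d => scaled_diff x y h).
Proof.
apply/measurable_fun_tnthP => j.
rewrite (_ : _ \o _ = (fun y => ((tnth x j : R) - (tnth y j : R)) / h)); last first.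
  by apply/funext => z /=; rewrite tnth_mktuple.
apply: measurable_funM => //; apply: measurable_funB => //.
exact: measurable_tnth.
Qed.

Definition sqnorm d (x : Rd R d) : R := \sum_(i < d) (tnth x i : R) ^+ 2.

Lemma measurable_sqnorm d : measurable_fun setT (@sqnorm d).
Proof.
apply: measurable_sum => i; apply: measurable_funX; exact: measurable_tnth.
Qed.

(** Larger than the support by a margin: a point outside the cube, displaced by at most 1 in each
    coordinate, is still outside the support. *)
Definition cube d (v : Rd R d) : Prop := forall i, -3 <= (tnth v i : R) <= 3.

Lemma measurable_cube d : measurable [set v : Rd R d | cube v].
Proof. exact: (@measurable_box R d (fun=> -3) (fun=> 3)). Qed.

Lemma measurable_cube_slice d (g : Rd R d -> R) (a b : R) :
  measurable_fun setT g -> measurable [set v : Rd R d | cube v /\ a <= g v < b].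
Proof.
move=> mg; rewrite (_ : [set _ | _] = [set v | cube v] `&` g @^-1` `[a, b[%classic).
  apply: measurableI; first exact: measurable_cube.
  by rewrite -[X in measurable X]setTI; exact: mg.
by apply/seteqP; split => v /=; rewrite in_itv.
Qed.

Lemma measurable_scaled_preimage d (x : Rd R d) (h : R) (D : set (Rd R d)) :
  measurable D -> measurable [set y | D (scaled_diff x y h)].
Proof.
by move=> mD; rewrite -[X in measurable X]setTI; exact: measurable_scaled_diff.
Qed.

Lemma scaled_diff_le d (x y : Rd R d) (h a b : R) i : 0 < h ->
  a <= tnth (scaled_diff x y h) i <= b ->
  (tnth x i : R) - b * h <= (tnth y i : R) <= (tnth x i : R) - a * h.
Proof.
move=> h0; rewrite tnth_mktuple ler_pdivlMr// ler_pdivrMr// => /andP[? ?].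
by apply/andP; split; lra.
Qed.

Lemma kernel_profile_support (K0 : R -> R) t : kernel_profile K0 ->
  1 < `|t| -> K0 t = 0.
Proof.
move=> [_ _ cl] t1; apply: contrapT => /eqP Kt.
have : closure [set t | K0 t != 0] t by exact: subset_closure.
rewrite cl /= in_itv/= => h; move: t1; rewrite ltNge => /negP; apply.
by rewrite ler_norml.
Qed.

(** [A] is the variation function counted from -2, left of the support, so that cutting the argument
    at -2 leaves [K0] unchanged. *)
Lemma kernel_profile_monotone (K0 : R -> R) : kernel_profile K0 ->
  exists (A : R -> R) (V : R), [/\ {homo A : s t / s <= t},
    forall t, 0 <= A t <= V &
    forall s t, s <= t -> `|K0 t - K0 s| <= A t - A s].
Proof.
move=> K0p; have [_ [V TV] _] := K0p.
pose top (t : R) := Num.max t (-2).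
have top2 t : -2 <= top t by rewrite /top le_max lexx orbT.
have fin s t : s <= t -> total_variation s t K0 \is a fin_num.
  move=> st; rewrite ge0_fin_numE ?total_variation_ge0//.
  exact: le_lt_trans (TV _ _ st) (ltry _).
have K0top t : K0 t = K0 (top t).
  rewrite /top; have [t2|//] := ltP t (-2).
  rewrite !(kernel_profile_support K0p)// ?normrN; first by rewrite gtr0_norm//; lra.
  by rewrite ltr0_norm; lra.
have mono s t : s <= t -> `|K0 t - K0 s| <=
    fine (total_variation (-2) (top t) K0) - fine (total_variation (-2) (top s) K0).
  move=> st; have tst : top s <= top t by rewrite /top ge_max !le_max st lexx !orbT.
  rewrite (total_variationD K0 (top2 s) tst) fineD ?fin// addrAC subrr add0r.
  by rewrite (K0top t) (K0top s) -lee_fin fineK ?fin// total_variation_ge.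
exists (fun t => fine (total_variation (-2) (top t) K0)), V; split => //.
- by move=> s t st; rewrite -subr_ge0; apply: le_trans (mono _ _ st).
- move=> t; rewrite fine_ge0 ?total_variation_ge0//=.
  by rewrite -lee_fin fineK ?fin//; exact: TV.
Qed.

Lemma measurable_kernel_profile (K0 : R -> R) : kernel_profile K0 ->
  measurable_fun setT K0.
Proof.
move=> /kernel_profile_monotone[A [V [Amono _ K0A]]].
rewrite (_ : K0 = A \- (A \- K0)); last first.
  by apply/funext => t /=; rewrite opprB addrC subrK.
apply: measurable_funB; apply: nondecreasing_measurable => //= s t st.
have := K0A s t st; rewrite ler_norml => /andP[_] /=; lra.
Qed.

(** If t lies in the interval number [j] of length [rho], then t' lies in that interval enlarged by
    [rho] on both sides, and [c j] is the increment of [A] over the enlarged interval. Each point is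
    covered by three of these, whence [3 * V]. *)
Lemma oscillation_bound (f A : R -> R) (V a b rho : R) :
  {homo A : s t / s <= t} -> (forall t, 0 <= A t <= V) ->
  (forall s t, s <= t -> `|f t - f s| <= A t - A s) -> 0 < rho ->
  exists (J : nat) (c : 'I_J -> R), [/\ forall j, 0 <= c j, \sum_j c j <= 3 * V &
    forall t t', a <= t <= b -> `|t - t'| <= rho ->
      `|f t - f t'| <=
      \sum_j c j * (a + j%:R * rho <= t < a + j.+1%:R * rho)%R%:R].
Proof.
move=> Amono A0V fA rho0.
pose p (i : nat) := a + i%:R * rho - rho.
have pmono i j : (i <= j)%N -> p i <= p j.
  by move=> ij; rewrite /p lerD2r lerD2l ler_wpM2r ?(ltW rho0)// ler_nat.
pose c i := A (p i.+3) - A (p i).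
have c0 i : 0 <= c i by rewrite subr_ge0; apply: Amono; apply: pmono; rewrite -addn3 leq_addr.
pose J := (Num.truncn ((b - a) / rho)).+1.
exists J, (fun j : 'I_J => c j); split => //.
  have -> k : \sum_(j < k) c j = A (p k) + A (p k.+1) + A (p k.+2)
      - A (p 0) - A (p 1) - A (p 2).
    elim: k => [|k IH]; first by rewrite big_ord0; ring.
    by rewrite big_ord_recr/= IH /c; ring.
  have := A0V (p J); have := A0V (p J.+1); have := A0V (p J.+2).
  have := A0V (p 0); have := A0V (p 1); have := A0V (p 2); lra.
move=> t t' /andP[at_ tb] tt'.
have ta0 : 0 <= (t - a) / rho by rewrite divr_ge0 ?(ltW rho0)// subr_ge0.
have /andP[jle jlt] := truncn_itv ta0.
set j := Num.truncn _ in jle jlt.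
have jJ : (j < J)%N.
  rewrite ltnS; apply: le_truncn.
  by rewrite ler_wpM2r ?invr_ge0 ?(ltW rho0)// lerD2r.
move: jle jlt; rewrite ler_pdivlMr// ltr_pdivrMr// => jle jlt.
apply: (@le_trans _ _ (c j)); last first.
  rewrite (bigD1 (Ordinal jJ))//= (_ : (_ <= t < _) = true) ?mulr1; last first.
    by apply/andP; split; lra.
  by rewrite lerDl sumr_ge0// => i _; rewrite mulr_ge0.
have p0 : p j <= t /\ p j <= t'.
  by rewrite /p; move: tt'; rewrite ler_norml => /andP[? ?]; split; lra.
have p3 : t <= p j.+3 /\ t' <= p j.+3.
  rewrite /p -[j.+3%:R]natr1 -[j.+2%:R]natr1; move: tt'; rewrite ler_norml => /andP[? ?].
  by split; lra.
rewrite /c; have [tt|tt] := leP t t'.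
  rewrite distrC; apply: le_trans (fA _ _ tt) _.
  by apply: lerB; apply: Amono; [exact: p3.2|exact: p0.1].
apply: le_trans (fA _ _ (ltW tt)) _.
by apply: lerB; apply: Amono; [exact: p3.1|exact: p0.2].
Qed.

Lemma prod_dist_le n (a b : 'I_n -> R) (M : R) : 1 <= M ->
  (forall i, `|a i| <= M) -> (forall i, `|b i| <= M) ->
  `|\prod_i a i - \prod_i b i| <= M ^+ n * \sum_i `|a i - b i|.
Proof.
move=> M1; have M0 : 0 <= M by exact: le_trans M1.
elim: n a b => [|n IH] a b aM bM; first by rewrite !big_ord0 subrr normr0 mulr0.
rewrite !big_ord_recl.
set pa := \prod_(i < n) _; set pb := \prod_(i < n) _.
rewrite (_ : _ - _ = (a ord0 - b ord0) * pa + b ord0 * (pa - pb)); last by ring.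
apply: le_trans (ler_normD _ _) _; rewrite [leRHS]mulrDr; apply: lerD.
  rewrite normrM mulrC; apply: ler_wpM2r => //.
  rewrite normr_prod exprS; apply: (@le_trans _ _ (M ^+ n)); last first.
    by rewrite ler_peMl// exprn_ge0.
  rewrite -[leRHS](_ : \prod_(i < n) M = _); last by rewrite prodr_const card_ord.
  apply: ler_prod => i _.
  by rewrite normr_ge0 /=.
rewrite normrM exprS -mulrA; apply: ler_pM => //.
exact: IH.
Qed.

End kernel_regularity.

(** * Slabs and shells that carry the oscillation of the kernel *)

Section kernel_oscillation.
Context (R : realType).

Lemma lebesgue_Rd_slab d (x : Rd R d) (h s e : R) (i0 : 'I_d) : 0 < h ->
  0 <= e <= 1 ->
  (lebesgue_Rd d [set y | cube (scaled_diff x y h) /\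
      (s <= tnth (scaled_diff x y h) i0 < s + e)%R] <= (6 ^+ d * e * h ^+ d)%:E)%E.
Proof.
move=> h0 /andP[e0 e1].
pose lo (l : 'I_d) := (tnth x l : R) - (if l == i0 then s + e else 3) * h.
pose hi (l : 'I_d) := (tnth x l : R) - (if l == i0 then s else -3) * h.
apply: (@le_trans _ _ (lebesgue_Rd d
    [set y : Rd R d | forall l, lo l <= (tnth y l : R) <= hi l])).
  apply: le_measure; rewrite ?inE.
  - apply: (measurable_scaled_preimage x h (D := [set v | cube v /\ s <= tnth v i0 < s + e])).
    by apply: measurable_cube_slice; exact: measurable_tnth.
  - exact: measurable_box.
  - move=> y /= [yc /andP[ys ye]] l; rewrite /lo /hi; apply: scaled_diff_le => //.
    by case: eqP => [->|_]; [rewrite ys ltW|exact: yc].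
have hE l : hi l - lo l = (if l == i0 then e else 6) * h.
  by rewrite /hi /lo; case: ifP => _; ring.
apply: le_trans (lebesgue_Rd_box _) _ => [l|].
  by rewrite -subr_ge0 hE mulr_ge0 ?(ltW h0)//; case: ifP.
rewrite lee_fin; under eq_bigr do rewrite hE.
rewrite big_split/= prodr_const card_ord ler_wpM2r ?exprn_ge0 ?(ltW h0)//.
rewrite (bigD1 i0)//= eqxx mulrC ler_wpM2r//.
apply: (@le_trans _ _ (\prod_(l < d) (6 : R))); last by rewrite prodr_const card_ord.
rewrite [leRHS](bigD1 i0)//= -[leLHS]mul1r; apply: ler_pM => //.
- by apply: prodr_ge0 => l /negPf ->.
- by rewrite ler1n.
- by apply: ler_prod => l /negPf ->; rewrite lexx andbT.
Qed.

Let measurable_annulus (x h s e : R) :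
  measurable [set t : measurableTypeR R | s <= ((x - t) / h) ^+ 2 < e].
Proof.
rewrite (_ : [set _ | _] = (fun t : R => ((x - t) / h) ^+ 2) @^-1` `[s, e[%classic).
  rewrite -[X in measurable X]setTI.
  have mf : measurable_fun setT (fun t : R => ((x - t) / h) ^+ 2).
    by apply: measurable_funX; apply: measurable_funM => //; exact: measurable_funB.
  exact: mf.
by apply/seteqP; split => y /=; rewrite in_itv.
Qed.

(** sqrt (s + rho) - sqrt s <= sqrt rho, on either side of [x]. For negative [s] the root takes its
    default value 0, as it should, since the set is then contained in an interval about [x]. *)
Lemma lebesgue_measure_annulus (x h s rho : R) : 0 < h -> 0 < rho ->
  (lebesgue_measure [set t : measurableTypeR R |
     (s <= ((x - t) / h) ^+ 2 < s + rho)%R] <= (2 * Num.sqrt rho * h)%:E)%E.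
Proof.
move=> h0 rho0.
pose r := Num.sqrt s.
have r0 : 0 <= r by exact: sqrtr_ge0.
have q0 : 0 <= Num.sqrt rho by exact: sqrtr_ge0.
have q2 : Num.sqrt rho ^+ 2 = rho by rewrite sqr_sqrtr// ltW.
have itv a : (lebesgue_measure (`[(a : R), (a + Num.sqrt rho * h)%R] : set (measurableTypeR R))
    = (Num.sqrt rho * h)%:E)%E.
  rewrite lebesgue_measure_itv/= lte_fin ltrDl mulr_gt0 ?sqrtr_gt0//.
  by rewrite -EFinD addrC addKr.
apply: (@le_trans _ _ (lebesgue_measure
   ((`[(x - (r + Num.sqrt rho) * h)%R, (x - (r + Num.sqrt rho) * h + Num.sqrt rho * h)%R]
      : set (measurableTypeR R)) `|`
    `[(x + r * h)%R, (x + r * h + Num.sqrt rho * h)%R])))%E; last first.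
  apply: le_trans (measureU2 _ _ _) _ => //.
  rewrite -mulrA mulr_natl mulr2n EFinD.
  by apply: leeD; rewrite le_eqVlt; apply/orP; left; apply/eqP; exact: itv.
apply: le_measure; rewrite ?inE.
- exact: measurable_annulus.
- exact: measurableU.
move=> t /= /andP[st ts]; set v := (x - t) / h in st ts.
have rv : r <= `|v| by rewrite /r -sqrtr_sqr ler_wsqrtr.
have vr : `|v| <= r + Num.sqrt rho.
  rewrite -(@ler_pXn2r _ 2)// ?nnegrE ?addr_ge0// real_normK ?num_real//.
  rewrite sqrrD q2; have [s0|s0] := leP 0 s.
    by have := mulr_ge0 r0 q0; rewrite [r ^+ 2]sqr_sqrtr//; lra.
  by have := mulr_ge0 r0 q0; have := sqr_ge0 r; lra.
have tE : t = x - v * h by rewrite /v divfK ?gt_eqF//; ring.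
rewrite tE !in_itv/=; have [v0|v0] := leP 0 v.
  rewrite ger0_norm// in rv vr; left; apply/andP; split.
    by rewrite lerD2l lerN2 ler_wpM2r// ltW.
  by rewrite -addrA lerD2l mulrDl opprD subrK lerN2 ler_wpM2r// ltW.
rewrite ltr0_norm// in rv vr; right; rewrite -mulNr -addrA -mulrDl !lerD2l.
by rewrite !ler_pM2r//; apply/andP; split.
Qed.

Let measurable_shell d (x : Rd R d) (h s e : R) :
  measurable [set y | cube (scaled_diff x y h) /\ s <= sqnorm (scaled_diff x y h) < e].
Proof.
apply: (measurable_scaled_preimage x h (D := [set v | cube v /\ s <= sqnorm v < e])).
by apply: measurable_cube_slice; exact: measurable_sqnorm.
Qed.

(** Once the other coordinates are fixed, the first one is confined to a one-dimensional annulus,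
    whose length bound does not depend on them; they fill a box. *)
Lemma lebesgue_Rd_shell d (x : Rd R d) (h s rho : R) : (0 < d)%N -> 0 < h ->
  0 < rho ->
  (lebesgue_Rd d [set y | cube (scaled_diff x y h) /\
      (s <= sqnorm (scaled_diff x y h) < s + rho)%R] <=
   (6 ^+ d * Num.sqrt rho * h ^+ d)%:E)%E.
Proof.
case: d x => [//|d] x _ h0 rho0.
pose lo (l : 'I_d) := (tnth x (lift ord0 l) : R) - 3 * h.
pose hi (l : 'I_d) := (tnth x (lift ord0 l) : R) - (-3) * h.
apply: le_trans (@lebesgue_Rd_section _ d _
  [set y : Rd R d | forall l, lo l <= (tnth y l : R) <= hi l]
  (2 * Num.sqrt rho * h) _ _ _ _ _) _.
- exact: measurable_shell.
- exact: measurable_box.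
- by rewrite !mulr_ge0// ltW.
- move=> a b /= [cab _] l; have := scaled_diff_le h0 (cab (lift ord0 l)).
  by rewrite tnthS.
- move=> b _.
  pose sig := \sum_(i < d) (((tnth x (lift ord0 i) : R) - tnth b i) / h) ^+ 2.
  have sqE a : sqnorm (scaled_diff x (cons_Rd (a, b)) h) =
      (((tnth x ord0 : R) - a) / h) ^+ 2 + sig.
    rewrite /sqnorm big_ord_recl tnth_mktuple tnth0; congr (_ + _).
    by apply: eq_bigr => i _; rewrite tnth_mktuple tnthS.
  apply: le_trans (lebesgue_measure_annulus (tnth x ord0) (s - sig) h0 rho0).
  apply: le_measure; rewrite ?inE.
  + rewrite -[X in measurable X]setTI.
    apply: (measurableT_comp (@measurable_cons_Rd R d) (pair2_measurable b)) => //.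
    exact: measurable_shell.
  + exact: measurable_annulus.
  move=> a /= [_]; rewrite sqE => /andP[? ?]; apply/andP; split; lra.
apply: (@le_trans _ _ ((2 * Num.sqrt rho * h)%:E * (\prod_(l < d) (hi l - lo l))%:E)%E).
  apply: lee_wpmul2l; first by rewrite lee_fin !mulr_ge0// ltW.
  apply: lebesgue_Rd_box => l; rewrite /lo /hi; lra.
rewrite -EFinM lee_fin.
have hlE l : hi l - lo l = 6 * h by rewrite /hi /lo; ring.
under eq_bigr do rewrite hlE.
rewrite prodr_const card_ord exprMn !exprS.
rewrite -subr_ge0 (_ : _ - _ = 4 * (6 ^+ d * (Num.sqrt rho * (h * h ^+ d)))); last by ring.
by rewrite !mulr_ge0// ?exprn_ge0// ltW.
Qed.

End kernel_oscillation.

Section kernel_bracket.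
Context (R : realType) (d : nat) (K : Rd R d -> R) (K0 : R -> R).
Hypotheses (d_gt0 : (0 < d)%N) (K0_profile : kernel_profile K0).
Hypothesis K_form : kernel_form K K0.

Lemma enormE (v : Rd R d) : enorm v = Num.sqrt (sqnorm v).
Proof. by []. Qed.

Lemma measurable_smoothing_kernel : measurable_fun setT K.
Proof.
have mK0 := measurable_kernel_profile K0_profile.
case: K_form => /funext ->.
  apply: measurableT_comp => //; apply: measurableT_comp (@measurable_sqnorm R d).
  exact: (nondecreasing_measurable measurableT (@ler_wsqrtr R)).
apply: measurable_prod => i _; apply: measurableT_comp => //.
exact: measurable_tnth.
Qed.

Lemma smoothing_kernel_bounded : exists2 M : R, 1 <= M & forall v, `|K v| <= M.
Proof.
have [[M0 M0P] _ _] := K0_profile.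
pose M := Num.max M0 1.
have M1 : 1 <= M by rewrite le_max lexx orbT.
have K0M t : `|K0 t| <= M by rewrite le_max M0P.
exists (M ^+ d) => [|v]; first exact: exprn_ege1.
case: K_form => ->; first by apply: le_trans (K0M _) _; rewrite ler_eXnr.
rewrite normr_prod -[leRHS](_ : \prod_(k < d) M = _).
  by apply: ler_prod => k _; rewrite normr_ge0 /=.
by rewrite prodr_const card_ord.
Qed.

Lemma smoothing_kernel_support v i : 1 < `|tnth v i : R| -> K v = 0.
Proof.
move=> vi; case: K_form => ->; last first.
  by rewrite (bigD1 i)//= (kernel_profile_support K0_profile) ?mul0r.
apply: (kernel_profile_support K0_profile); rewrite ger0_norm ?sqrtr_ge0//.
apply: lt_le_trans vi _; rewrite -sqrtr_sqr ler_wsqrtr//.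
by rewrite (bigD1 i)//= lerDl sumr_ge0// => j _; exact: sqr_ge0.
Qed.

Lemma smoothing_kernel_cube (u v : Rd R d) (eta : R) : eta <= 1 ->
  (forall i, `|(tnth u i : R) - tnth v i| <= eta) -> ~ cube v ->
  K u = 0 /\ K v = 0.
Proof.
move=> eta1 uv /existsNP[i /negP]; rewrite -ler_norml -ltNge => vi.
split; apply: (smoothing_kernel_support (i := i)); last by apply: lt_trans vi; lra.
have := lerB_dist (tnth v i : R) (tnth u i); rewrite distrC => h.
by have := uv i; lra.
Qed.

(* In the radial case the variation is measured along the squared norm, which is
   Lipschitz on the cube and whose shells have small sections. *)
Lemma smoothing_kernel_oscillation : exists2 C : R, 0 <= C &
  forall eta : R, 0 < eta <= 1 ->
  exists (I : finType) (c : I -> R) (D : I -> set (Rd R d)),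
  [/\ forall j, 0 <= c j, \sum_j c j <= C, forall j, measurable (D j),
    forall x h j, 0 < h ->
      (lebesgue_Rd d [set y | D j (scaled_diff x y h)] <=
        (C * Num.sqrt eta * h ^+ d)%:E)%E &
    forall u v, (forall i, `|(tnth u i : R) - tnth v i| <= eta) ->
      `|K u - K v| <= \sum_j c j * \1_(D j) v].
Proof.
have [A [V [Amono AV K0A]]] := kernel_profile_monotone K0_profile.
have V0 : 0 <= V by have /andP[] := AV 0; exact: le_trans.
have cut (b : Rd R d -> bool) v : cube v ->
    \1_[set v | cube v /\ b v] v = (b v)%:R :> R.
  move=> cv; rewrite indicE (_ : (v \in _) = b v)//.
  by apply/idP/idP; rewrite inE/=; [case|split].
have [KE|KE] := K_form.
  (* If v is in the cube and u is within 1 of it, then |u_i + v_i| <= 7, so the squared norm changes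
     by at most 7 d eta. *)
  pose c7 : R := 7 * d%:R.
  have c71 : 1 <= c7.
    by have : 1 <= d%:R :> R; [rewrite ler1n|rewrite /c7; lra].
  have C0 : 0 <= 3 * V + 6 ^+ d * c7.
    by rewrite addr_ge0 ?mulr_ge0 ?exprn_ge0// (le_trans _ c71).
  exists (3 * V + 6 ^+ d * c7) => // eta /andP[eta0 eta1].
  have rho0 : 0 < c7 * eta by rewrite mulr_gt0// (lt_le_trans _ c71).
  have [||||J [c [c0 cV cosc]]] := @oscillation_bound R (K0 \o Num.sqrt) (A \o Num.sqrt)
      V 0 (9 * d%:R) (c7 * eta).
  - by move=> s t st /=; apply: Amono; exact: ler_wsqrtr.
  - by move=> t; exact: AV.
  - by move=> s t st /=; apply: K0A; exact: ler_wsqrtr.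
  - exact: rho0.
  exists 'I_J, c, (fun j : 'I_J => [set v : Rd R d | cube v /\
    (0 + j%:R * (c7 * eta) <= sqnorm v < 0 + j.+1%:R * (c7 * eta))%R]).
  split => //.
  - by rewrite (le_trans cV)// lerDl mulr_ge0 ?exprn_ge0// (le_trans _ c71).
  - move=> j; apply: measurable_cube_slice; exact: measurable_sqnorm.
  - move=> x h j h0; rewrite (_ : 0 + j.+1%:R * (c7 * eta) =
      0 + j%:R * (c7 * eta) + c7 * eta); last by rewrite -[j.+1%:R]natr1; ring.
    apply: le_trans (lebesgue_Rd_shell x _ d_gt0 h0 rho0) _.
    rewrite lee_fin ler_wpM2r ?exprn_ge0 ?(ltW h0)//.
    rewrite sqrtrM ?(le_trans _ c71)// mulrA ler_wpM2r ?sqrtr_ge0//.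
    apply: (@le_trans _ _ (6 ^+ d * c7)); last by rewrite lerDr mulr_ge0.
    rewrite ler_wpM2l ?exprn_ge0// -[leRHS]ger0_norm ?(le_trans _ c71)//.
    by rewrite -sqrtr_sqr ler_wsqrtr// expr2 ler_peMl// (le_trans _ c71).
  move=> u v uv; have [cv|ncv] := pselect (cube v); last first.
    have [-> ->] := smoothing_kernel_cube eta1 uv ncv.
    by rewrite subrr normr0 sumr_ge0// => j _; rewrite mulr_ge0.
  under eq_bigr do rewrite cut//.
  rewrite !KE !enormE distrC; apply: cosc.
    rewrite sumr_ge0 => [|i _]; last exact: sqr_ge0.
    rewrite mulrC mulr_natl -[leRHS](_ : \sum_(i < d) 9 = _); last first.
      by rewrite sumr_const card_ord.
    apply: ler_sum => i _; have /andP[] := cv i; set a := tnth _ _ => a1 a2.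
    have : 0 <= (3 - a) * (a + 3) by rewrite mulr_ge0//; lra.
    lra.
  rewrite -sumrB; apply: le_trans (ler_norm_sum _ _ _) _.
  rewrite (_ : c7 * eta = \sum_(i < d) 7 * eta); last first.
    by rewrite sumr_const card_ord /c7 -mulr_natl; ring.
  apply: ler_sum => i _; have /andP[] := cv i; have := uv i.
  rewrite subr_sqr normrM distrC.
  set a : R := tnth u i; set b : R := tnth v i => ab b1 b2.
  rewrite mulrC; apply: ler_pM => //.
  by move: ab; rewrite !ler_norml => /andP[? ?]; apply/andP; split; lra.
have [[M0 M0P] _ _] := K0_profile.
pose M := Num.max M0 1.
have M1 : 1 <= M by rewrite le_max lexx orbT.
have Md0 : 0 <= M ^+ d by rewrite exprn_ge0// (le_trans _ M1).
have K0M t : `|K0 t| <= M by rewrite le_max M0P.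
have C0 : 0 <= M ^+ d * (d%:R * (3 * V)) by rewrite !mulr_ge0.
exists (M ^+ d * (d%:R * (3 * V)) + 6 ^+ d) => [|eta /andP[eta0 eta1]].
  by rewrite addr_ge0// exprn_ge0.
have [J [c [c0 cV cosc]]] := oscillation_bound (-3) 3 Amono AV K0A eta0.
exists ('I_d * 'I_J)%type, (fun i => M ^+ d * c i.2),
  (fun i : 'I_d * 'I_J => [set v : Rd R d | cube v /\
    (-3 + i.2%:R * eta <= tnth v i.1 < -3 + i.2.+1%:R * eta)%R]).
split => //.
- by move=> j; rewrite mulr_ge0.
- rewrite -mulr_sumr; apply: (@le_trans _ _ (M ^+ d * (d%:R * (3 * V)))).
    rewrite ler_wpM2l// -(pair_bigA _ (fun _ j => c j))/= sumr_const card_ord.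
    by rewrite mulr_natl lerMn2r cV orbT.
  by rewrite lerDl exprn_ge0.
- by move=> j; apply: measurable_cube_slice; exact: measurable_tnth.
- move=> x h j h0; rewrite (_ : -3 + j.2.+1%:R * eta =
    -3 + j.2%:R * eta + eta); last by rewrite -[j.2.+1%:R]natr1; ring.
  apply: le_trans (lebesgue_Rd_slab x _ _ h0 _) _; first by rewrite ltW.
  rewrite lee_fin ler_wpM2r ?exprn_ge0 ?(ltW h0)//; apply: ler_pM => //.
  - exact: ltW.
  - by rewrite lerDr.
  - rewrite -[leLHS]ger0_norm ?(ltW eta0)// -sqrtr_sqr ler_wsqrtr//.
    by rewrite expr2 ler_piMl// ltW.
move=> u v uv; have [cv|ncv] := pselect (cube v); last first.
  have [-> ->] := smoothing_kernel_cube eta1 uv ncv.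
  by rewrite subrr normr0 sumr_ge0// => j _; rewrite !mulr_ge0.
under eq_bigr do rewrite cut// -mulrA.
rewrite -mulr_sumr !KE; apply: le_trans (prod_dist_le M1 _ _) _ => //.
rewrite ler_wpM2l// -(pair_bigA _ (fun i j => c j * (-3 + j%:R * eta <= tnth v i <
  -3 + j.+1%:R * eta)%R%:R))/=; apply: ler_sum => i _.
by rewrite distrC; apply: cosc; [exact: cv|rewrite distrC].
Qed.

End kernel_bracket.

(** * Quantile codes of the grid cells *)

Section cell_codes.
Context d (T : measurableType d) (R : realType) (m : probability T R).
Variable G : T -> R.
Hypothesis mG : measurable_fun setT G.

Let slab (a b : R) : set T := [set e | a < G e <= b].

Let measurable_slab a b : measurable (slab a b).
Proof.
rewrite (_ : slab _ _ = G @^-1` `]a, b]%classic).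
  by rewrite -[X in measurable X]setTI; exact: mG.
by apply/seteqP; split => e /=; rewrite in_itv.
Qed.

Let half (t : R) : set T := [set e | G e <= t].

Let measurable_half t : measurable (half t).
Proof.
rewrite (_ : half _ = G @^-1` `]-oo, t]%classic).
  by rewrite -[X in measurable X]setTI; exact: mG.
by apply/seteqP; split => e /=; rewrite in_itv.
Qed.

Let F (t : R) : R := fine (m (half t)).

Let FE t : (F t)%:E = m (half t).
Proof. by rewrite fineK// fin_num_measure. Qed.

Let F_mono s t : s <= t -> F s <= F t.
Proof.
move=> st; rewrite -lee_fin !FE; apply: le_measure; rewrite ?inE//.
by move=> e /= /le_trans; apply.
Qed.

Let F01 t : 0 <= F t <= 1.
Proof. by rewrite fine_ge0//= -lee_fin FE probability_le1. Qed.

Let slabE a b : a <= b -> m (slab a b) = (F b - F a)%:E.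
Proof.
move=> ab; rewrite EFinB !FE (_ : slab a b = half b `\` half a).
  rewrite measureD// ?setIidr//; last first.
    by rewrite -ge0_fin_numE// fin_num_measure.
  by move=> e /= /le_trans; apply.
rewrite /slab /half; apply/seteqP; split => e /=.
  by move=> /andP[ae eb]; split; [|rewrite leNgt ae].
by move=> [-> /negP]; rewrite -ltNge => ->.
Qed.

(** A finite union lies in a single slab, from the least left end to the greatest right end, and the
    values of [F] at these ends differ by at most [eps]. The finite unions increase to the whole
    one. *)
Lemma slab_union_le (I : countType) (l r : I -> R) (P : I -> Prop) (s eps : R) :
  0 <= eps -> (forall k, P k -> s <= F (l k)) -> (forall k, P k -> F (r k) <= s + eps) ->
  measurable (\bigcup_(k in P) slab (l k) (r k)) /\
  (m (\bigcup_(k in P) slab (l k) (r k)) <= eps%:E)%E.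
Proof.
move=> eps0 sl rs.
pose W (i : nat) : set T := if unpickle i is Some k then
  (if `[< P k >] then slab (l k) (r k) else set0) else set0.
have mW i : measurable (W i).
  by rewrite /W; case: unpickle => // k; case: ifP => //.
have WE : \bigcup_(k in P) slab (l k) (r k) = \bigcup_i W i.
  apply/seteqP; split => e [k]; first move=> Pk ek.
    by exists (pickle k) => //; rewrite /W pickleK asboolT.
  move=> _; rewrite /W; case: unpickle => // k'; case: ifPn => // /asboolP Pk ek.
  by exists k'.
split; first by rewrite WE; exact: bigcup_measurable.
pose D (i : nat) := \big[setU/set0]_(j < i) W j.
have mD i : measurable (D i) by apply: bigsetU_measurable => j _.
have ndD : nondecreasing_seq (fun i => D i.+1).
  apply/nondecreasing_seqP => i; apply/subsetPset.
  by rewrite /D [X in _ `<=` X]big_ord_recr/=; exact: subsetUl.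
have cvgD : m (D i.+1) @[i --> \oo] --> m (\bigcup_i D i.+1).
  apply: (@nondecreasing_cvg_mu _ _ _ m (fun i => D i.+1)) => //.
  exact: bigcup_measurable.
rewrite WE -bigcup_bigsetU_bigcup -(cvg_lim _ cvgD)//.
apply: lime_le; first exact: cvgP cvgD.
apply: nearW => i; move: (i.+1) => {}i.
suff [->|[a [b [sa [bs [ab Dab]]]]]] : D i = set0 \/ exists a b, s <= F a /\
    F b <= s + eps /\ a <= b /\ D i `<=` slab a b.
- by rewrite measure0 lee_fin.
- apply: (@le_trans _ _ (m (slab a b))); first by rewrite le_measure ?inE.
  by rewrite slabE// lee_fin; lra.
elim: i => [|i IH]; first by left; rewrite /D big_ord0.
rewrite (_ : D i.+1 = D i `|` W i); last by rewrite /D big_ord_recr.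
rewrite /W.
case: (unpickle i) => [k|]; last by rewrite setU0.
case: ifPn => [/asboolP Pk|_]; last by rewrite setU0.
have [lr|rl] := leP (l k) (r k); last first.
  rewrite (_ : slab _ _ = set0) ?setU0//.
  apply/seteqP; split => // e /andP[+ /le_lt_trans/(_ rl)/lt_trans h] => /h.
  by rewrite ltxx.
right; case: IH => [->|[a [b [sa [bs [ab Dab]]]]]].
  exists (l k), (r k); rewrite set0U; split; first exact: sl.
  by split; [exact: rs|split].
exists (Num.min a (l k)), (Num.max b (r k)); split; [|split; [|split]].
- by rewrite /Num.min; case: ifP => // _; exact: sl.
- by rewrite /Num.max; case: ifP => // _; exact: rs.
- by rewrite ge_min le_max ab.
- move=> e [/Dab|] /andP[? ?]; rewrite /slab /=; apply/andP; split.
  + by rewrite gt_min; apply/orP; left.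
  + by rewrite le_max; apply/orP; left.
  + by rewrite gt_min; apply/orP; right.
  + by rewrite le_max; apply/orP; right.
Qed.

(* Cell [k] has the window ](k - A) delta, (k - A + L.+1) delta].  Its code
   consists of the quantile index of the left end, of whether the right end has
   the same index (the window is then light), and of [k] modulo [L.+1]: since
   windows with the same residue are disjoint, at most one heavy window in a
   residue class can start in a given quantile slice. *)
Lemma cell_code (delta eps A : R) (L : nat) : 0 < delta -> 0 < eps ->
  exists (code : int -> 'I_(Num.truncn eps^-1).+1 * bool * 'I_L.+1)
    (U : 'I_(Num.truncn eps^-1).+1 -> set T),
  [/\ forall q, measurable (U q), forall q, (m (U q) <= eps%:E)%E,
    forall k e, (code k).1.2 ->
      (k%:~R - A) * delta < G e <= (k%:~R - A + L.+1%:R) * delta -> U (code k).1.1 e &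
    forall k k', code k = code k' -> ~~ (code k).1.2 -> k = k'].
Proof.
move=> delta0 eps0.
pose l (k : int) := (k%:~R - A) * delta.
pose r (k : int) := (k%:~R - A + L.+1%:R) * delta.
pose tq (t : R) := Num.truncn (F t / eps).
have tqmono s t : s <= t -> (tq s <= tq t)%N.
  by move=> st; apply: le_truncn; rewrite ler_pM2r ?invr_gt0// F_mono.
have tq_lt t : (tq t < (Num.truncn eps^-1).+1)%N.
  rewrite ltnS; apply: le_truncn; rewrite ler_pdivrMr// mulVf ?gt_eqF//.
  by have /andP[] := F01 t.
have Feps t : 0 <= F t / eps by rewrite divr_ge0 ?(ltW eps0)//; have /andP[] := F01 t.
have lr k : l k <= r k.
  by rewrite /l /r ler_pM2r// lerDl.
pose light k := tq (r k) == tq (l k).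
pose code k := (Ordinal (tq_lt (l k)), light k, inord `|(k %% L.+1%:Z)%Z|%N : 'I_L.+1).
pose U (q : 'I_(Num.truncn eps^-1).+1) :=
  \bigcup_(k in [set k | light k /\ tq (l k) = q]) slab (l k) (r k).
have HU q : measurable (U q) /\ (m (U q) <= eps%:E)%E.
  apply: (slab_union_le (s := q%:R * eps)) => [|k /= [_ kq]|k /= [/eqP kl kq]].
  - exact: ltW.
  - by rewrite -kq -ler_pdivlMr// truncn_le.
  - have /andP[_ /ltW] := truncn_itv (Feps (r k)).
    rewrite -/(tq (r k)) kl kq ler_pdivrMr// -[q.+1%:R]natr1 mulrDl mul1r.
    exact.
exists code, U; split.
- by move=> q; have [] := HU q.
- by move=> q; have [] := HU q.
- by move=> k e kl le; exists k.
suff wl k k' : code k = code k' -> ~~ (code k).1.2 -> (k <= k')%R -> k = k'.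
  move=> k k' e h; have [kk|/ltW kk] := leP k k'; first exact: wl.
  by apply/esym/wl => //; rewrite -e.
move=> [/= qe _ me] nl; rewrite le_eqVlt => /predU1P[//|kk].
have dv : (L.+1%:Z %| k' - k)%Z.
  have mlt (j : int) : (`|(j %% L.+1%:Z)%Z|%N < L.+1)%N.
    by rewrite -ltz_nat gez0_abs ?modz_ge0// ltz_mod.
  rewrite -eqz_mod_dvd eq_sym; apply/eqP.
  rewrite -[LHS]gez0_abs ?modz_ge0// -[RHS]gez0_abs ?modz_ge0//; congr Posz.
  by have := congr1 val me; rewrite /= !inordK.
have kL : k%:~R + L.+1%:R <= k'%:~R :> R.
  have : L.+1%:Z <= k' - k.
    rewrite -[k' - k]gez0_abs ?subr_ge0 ?(ltW kk)// lez_nat dvdn_leq//.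
    by rewrite absz_gt0 subr_eq0 gt_eqF.
  by rewrite -(ler_int R) rmorphB/= -pmulrn => ?; lra.
have : (tq (r k) <= tq (l k'))%N.
  by apply: tqmono; rewrite /l /r ler_pM2r//; lra.
rewrite -qe leq_eqVlt -/(light k) (negbTE nl)/= => h.
by have := tqmono _ _ (lr k); rewrite leqNgt h.
Qed.

End cell_codes.

(** * Brackets for the translates of the kernel *)

Section brackets.
Context (R : realType) (d : nat) (dE : measure_display) (E : measurableType dE).
Variables (emb : E -> Rd R d) (mu : probability E R) (f : Rd R d -> R).
Variables (K : Rd R d -> R) (K0 : R -> R).
Hypotheses (d_gt0 : (0 < d)%N) (emb_meas : measurable_fun setT emb).
Hypotheses (f_meas : measurable_fun setT f) (f_ge0 : forall x, 0 <= f x).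
Hypothesis f_bounded : exists M : R, forall x, f x <= M.
Hypothesis f_density : forall B : set (Rd R d), measurable B ->
  mu (emb @^-1` B) = (\int[lebesgue_Rd d]_(x in B) (f x)%:E)%E.
Hypotheses (K0_profile : kernel_profile K0) (K_form : kernel_form K K0).

Lemma density_bound : exists2 M : R, 0 <= M & forall B : set (Rd R d), measurable B ->
  (mu (emb @^-1` B) <= M%:E * lebesgue_Rd d B)%E.
Proof.
have [M fM] := f_bounded.
have M0 : 0 <= M by rewrite (le_trans (f_ge0 [tuple 0 | i < d])).
exists M => // B mB; rewrite f_density// -integral_cst//.
apply: ge0_le_integral => //.
- by move=> x _; rewrite lee_fin.
- by apply/measurable_EFinP; exact: measurable_funTS.
- by move=> x _; rewrite lee_fin.
Qed.

Lemma lebesgue_Rd_cube (x : Rd R d) (h : R) : 0 < h ->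
  (lebesgue_Rd d [set y | cube (scaled_diff x y h)] <= (6 ^+ d * h ^+ d)%:E)%E.
Proof.
move=> h0.
pose lo (l : 'I_d) := (tnth x l : R) - 3 * h.
pose hi (l : 'I_d) := (tnth x l : R) - -3 * h.
apply: (@le_trans _ _ (lebesgue_Rd d
    [set y : Rd R d | forall l, lo l <= (tnth y l : R) <= hi l])).
  apply: le_measure; rewrite ?inE.
  - by apply: measurable_scaled_preimage; exact: measurable_cube.
  - exact: measurable_box.
  - by move=> y /= yc l; exact: scaled_diff_le.
have hlE l : hi l - lo l = 6 * h by rewrite /hi /lo; ring.
apply: le_trans (lebesgue_Rd_box _) _ => [l|].
  by rewrite -subr_ge0 hlE mulr_ge0// ltW.
by under eq_bigr do rewrite hlE; rewrite prodr_const card_ord exprMn.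
Qed.

(* If some coordinate of [x] lies in a light cell, the bracket is [0] with the
   indicator of the union of the light windows with that code as error; otherwise
   the code determines the grid cell of [x], and the bracket is the kernel at its
   corner. *)
Lemma kernel_brackets : exists2 C : R, 0 < C & forall (n : nat) (h : R),
  (0 < n)%N -> 0 < h <= 1 ->
  exists (N : nat) (g w : 'I_N -> E -> R),
  [/\ (0 < N)%N /\ N%:R <= (16 * n%:R ^+ 2 / h ^+ d) ^+ d,
    forall j, measurable_fun setT (g j) /\ measurable_fun setT (w j),
    forall j e, `|g j e| <= C /\ 0 <= w j e <= C,
    forall j, (\int[mu]_e `|g j e|%:E <= (C * h ^+ d)%:E)%E /\
      (\int[mu]_e (w j e)%:E <= (C * (h ^+ d * Num.sqrt n%:R^-1))%:E)%E &
    forall x, exists j, forall e,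
      `|K (scaled_diff x (emb e) h) - g j e| <= w j e].
Proof.
have [Mf Mf0 muE] := density_bound.
have [M M1 KM] := smoothing_kernel_bounded d_gt0 K0_profile K_form.
have M0 : 0 <= M by exact: le_trans M1.
have [C0 C00 osc] := smoothing_kernel_oscillation d_gt0 K0_profile K_form.
have mK := measurable_smoothing_kernel K0_profile K_form.
pose C := M + M * Mf * 6 ^+ d + C0 + C0 * (Mf * C0).
have C1 : 0 <= M * Mf * 6 ^+ d by rewrite !mulr_ge0// exprn_ge0.
have C2 : 0 <= C0 * (Mf * C0) by rewrite !mulr_ge0.
have CM : M <= C by rewrite /C; lra.
have CC0 : C0 <= C by rewrite /C; lra.
have CC2 : C0 * (Mf * C0) <= C by rewrite /C; lra.
exists C => [|n h n0 /andP[h0 h1]]; first by rewrite (lt_le_trans _ CM)// (lt_le_trans _ M1).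
have n1 : 1 <= n%:R :> R by rewrite ler1n.
have np : 0 < n%:R :> R by rewrite (lt_le_trans _ n1).
have hd0 : 0 < h ^+ d by rewrite exprn_gt0.
(* The mass allowed for the bracket errors. The quantile slices get the same mass, so that light
   codes meet the requirement too. *)
pose eps := h ^+ d * Num.sqrt n%:R^-1.
have eps0 : 0 < eps by rewrite mulr_gt0// sqrtr_gt0 invr_gt0.
have Cpos : 0 <= C by exact: le_trans CM.
have Chd : 0 <= C * h ^+ d by rewrite mulr_ge0// ltW.
have Ceps : 0 <= C * eps by rewrite mulr_ge0// ltW.
pose delta := h / n%:R.
have delta0 : 0 < delta by rewrite divr_gt0.
have deltah : delta <= h by rewrite ler_pdivrMr// ler_peMr// ltW.
(* The window of a cell extends by 2 h, that is [2 * n] grid steps, on both sides of its corner: a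
   point of the cell is within h of the corner, and the kernel reaches h further. *)
pose L := (4 * n).-1.
have L4 : L.+1 = (4 * n)%N by rewrite prednK// muln_gt0.
pose G i e : R := tnth (emb e) i.
have mG i : measurable_fun setT (G i) by exact: (measurableT_comp (measurable_tnth i)).
have /choice[code /choice[U HU]] := fun i => cell_code mu (mG i) (2 * n%:R) L delta0 eps0.
set Q := (Num.truncn eps^-1).+1 in code U HU.
pose I := ('I_Q * bool * 'I_L.+1)%type.
pose cell (x : Rd R d) (i : 'I_d) : int := Num.floor ((tnth x i : R) / delta).
have cellP x i : (cell x i)%:~R * delta <= (tnth x i : R) < ((cell x i)%:~R + 1) * delta.
  rewrite -ler_pdivlMr// -ltr_pdivrMr//; exact: mem_rg1_floor.
pose codes (x : Rd R d) : {ffun 'I_d -> I} := [ffun i => code i (cell x i)].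
have bracket (c : {ffun 'I_d -> I}) : exists gw : (E -> R) * (E -> R),
  [/\ measurable_fun setT gw.1 /\ measurable_fun setT gw.2,
    forall e, `|gw.1 e| <= C /\ 0 <= gw.2 e <= C,
    (\int[mu]_e `|gw.1 e|%:E <= (C * h ^+ d)%:E)%E /\
      (\int[mu]_e (gw.2 e)%:E <= (C * eps)%:E)%E &
    forall x, codes x = c -> forall e,
      `|K (scaled_diff x (emb e) h) - gw.1 e| <= gw.2 e].
  have codesE x i : codes x = c -> code i (cell x i) = c i by move=> <-; rewrite ffunE.
  have [[i ci]|nl] := pselect (exists i, (c i).1.2).
    have [mU muU cover _] := HU i.
    exists (fun=> 0, fun e => M * \1_(U i (c i).1.1) e); split => /=.
    - by split=> //; apply: measurable_funM => //; exact: measurable_indic.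
    - move=> e; split; first by rewrite normr0 (le_trans _ CM).
      rewrite mulr_ge0//=.
      by apply: le_trans CM; rewrite ler_piMr// indicE; case: (_ \in _).
    - split.
        by rewrite normr0 integral0 lee_fin.
      under eq_integral do rewrite EFinM.
      rewrite ge0_integralZl//; last first.
        by apply/measurable_EFinP; exact: measurable_indic.
      rewrite integral_indic// setIT EFinM; apply: lee_pmul => //.
      exact: muU.
    - move=> x xc e; rewrite subr0.
      have [Ue|nUe] := pselect (U i (c i).1.1 e).
        by rewrite indicE mem_set// mulr1.
      rewrite (smoothing_kernel_support K0_profile K_form (i := i)) ?normr0 ?mulr_ge0//.
      rewrite ltNge; apply/negP; rewrite ler_norml => xy; apply: nUe.
      have := scaled_diff_le h0 xy; have := cellP x i.
      rewrite -(codesE x i xc); have : delta * n%:R = h by rewrite divfK// gt_eqF.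
      set k := (cell x i)%:~R : R => dn /andP[k1 k2] /andP[y1 y2].
      apply: cover; first by rewrite (codesE x i xc).
      rewrite L4 natrM -/k /G; apply/andP; split.
        rewrite (_ : (k - 2 * n%:R) * delta = k * delta - 2 * (delta * n%:R)); last by ring.
        by rewrite dn; lra.
      rewrite (_ : _ * delta = k * delta + 2 * (delta * n%:R)); last by ring.
      by rewrite dn; lra.
  have [[x0 x0c]|nx0] := pselect (exists x0, codes x0 = c); last first.
    exists (fun=> 0, fun=> 0); split => //=.
    - by move=> e; rewrite normr0 lexx (le_trans _ CM).
    - by rewrite normr0 integral0 !lee_fin.
    - by move=> x xc; case: nx0; exists x.
  (* Moving [x] to the corner of its cell changes the scaled difference by at most delta / h = 1 / n
     in each coordinate. *)
  have eta1 : 0 < (n%:R^-1 : R) <= 1 by rewrite invr_gt0 np invf_le1.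
  have [J [cc [D [cc0 ccC mD DL Dosc]]]] := osc _ eta1.
  pose xk : Rd R d := [tuple (cell x0 i)%:~R * delta | i < d].
  pose v e := scaled_diff xk (emb e) h.
  have mv : measurable_fun setT v.
    exact: (measurableT_comp (@measurable_scaled_diff R d xk h) emb_meas).
  have mvD B : measurable B -> measurable (v @^-1` B).
    by move=> mB; rewrite -[X in measurable X]setTI; exact: mv.
  exists (K \o v, fun e => \sum_j cc j * \1_(D j) (v e)); split => /=.
  - split; first exact: measurableT_comp.
    apply: measurable_sum => j; apply: measurable_funM => //.
    by apply: measurableT_comp => //; exact: measurable_indic.
  - move=> e; split; first exact: le_trans (KM _) CM.
    apply/andP; split; first by apply: sumr_ge0 => j _; rewrite mulr_ge0.
    apply: le_trans CC0; apply: le_trans ccC; apply: ler_sum => j _.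
    by rewrite ler_piMr// indicE; case: (_ \in _).
  - split.
      apply: (@le_trans _ _ (\int[mu]_e (M%:E * (\1_(v @^-1` [set u | cube u]) e)%:E))%E).
        apply: ge0_integral_mono => e; rewrite ?lee_fin//.
        rewrite indicE.
        have [cu|ncu] := pselect (cube (v e)).
          by rewrite mem_set// mulr1.
        have v0 i : `|(tnth (v e) i : R) - tnth (v e) i| <= 0 by rewrite subrr normr0.
        have [-> _] := smoothing_kernel_cube K0_profile K_form ler01 v0 ncu.
        by rewrite normr0 mulr_ge0.
      have mcube : measurable (v @^-1` [set u | cube u]).
        by apply: mvD; exact: measurable_cube.
      rewrite ge0_integralZl//; last first.
        by apply/measurable_EFinP; exact: measurable_indic.
      rewrite integral_indic// setIT.
      apply: (@le_trans _ _ (M%:E * (Mf%:E * (6 ^+ d * h ^+ d)%:E))%E).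
        apply: lee_wpmul2l; first by rewrite lee_fin.
        apply: le_trans (muE ((fun y => scaled_diff xk y h) @^-1` [set u | cube u]) _) _.
          by apply: measurable_scaled_preimage; exact: measurable_cube.
        apply: lee_wpmul2l; first by rewrite lee_fin.
        exact: lebesgue_Rd_cube.
      rewrite -!EFinM lee_fin !mulrA ler_wpM2r ?(ltW hd0)// /C; lra.
    under eq_integral do rewrite -sumEFin.
    rewrite ge0_integral_sum//; last 2 first.
    - move=> j; apply/measurable_EFinP; apply: measurable_funM => //.
      by apply: measurableT_comp => //; exact: measurable_indic.
    - by move=> j e _; rewrite lee_fin mulr_ge0.
    apply: (@le_trans _ _ (\sum_j (cc j * (Mf * (C0 * eps)))%:E)%E).
      apply: lee_sum => j _; under eq_integral do rewrite EFinM.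
      rewrite ge0_integralZl//; last 2 first.
      - apply/measurable_EFinP.
        by apply: measurableT_comp => //; exact: measurable_indic.
      - by rewrite lee_fin.
      rewrite EFinM; apply: lee_wpmul2l; first by rewrite lee_fin.
      have -> : (\int[mu]_e (\1_(D j) (v e))%:E)%E = mu (v @^-1` D j).
        transitivity (\int[mu]_e (\1_(v @^-1` D j) e)%:E)%E; first by [].
        by rewrite integral_indic ?setIT//; exact: mvD.
      apply: le_trans (muE ((fun y => scaled_diff xk y h) @^-1` D j) _) _.
        exact: measurable_scaled_preimage.
      rewrite EFinM; apply: lee_wpmul2l; first by rewrite lee_fin.
      by apply: le_trans (DL xk h j h0) _; rewrite lee_fin /eps -mulrA [_ * h ^+ d]mulrC.
    rewrite sumEFin lee_fin -mulr_suml.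
    apply: (@le_trans _ _ (C0 * (Mf * (C0 * eps)))).
      by rewrite ler_wpM2r// !mulr_ge0// ltW.
    rewrite (_ : C0 * (Mf * (C0 * eps)) = C0 * (Mf * C0) * eps); last by ring.
    by rewrite ler_wpM2r// ltW.
  - move=> x xc e.
    have cE i : cell x i = cell x0 i.
      have [_ _ _ uniq] := HU i; apply: uniq; first by rewrite !codesE.
      by rewrite codesE//; apply/negP => ci; apply: nl; exists i.
    apply: Dosc => i; rewrite !tnth_mktuple -cE -mulrBl.
    rewrite (_ : _ - _ = (tnth x i : R) - (cell x i)%:~R * delta); last by ring.
    have /andP[x1 x2] := cellP x i.
    rewrite normrM (gtr0_norm (_ : 0 < h^-1)) ?invr_gt0// ler_pdivrMr//.
    rewrite [n%:R^-1 * h]mulrC -/delta ger0_norm ?subr_ge0// lerBlDl.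
    by rewrite -[X in _ + X]mul1r -mulrDl ltW.
have [gw gwP] := choice bracket.
exists #|{ffun 'I_d -> I}|, (fun j => (gw (enum_val j)).1), (fun j => (gw (enum_val j)).2).
split.
(* Per coordinate a code has [Q] slices, 2 flags and [4 * n] residues. *)
- have Q1 : Q%:R <= 2 * (n%:R / h ^+ d).
    have epsV : eps^-1 = Num.sqrt n%:R / h ^+ d.
      by rewrite /eps invfM mulrC sqrtrV ?invrK ?ltW.
    have sn : Num.sqrt n%:R <= n%:R :> R.
      rewrite -[leRHS]ger0_norm ?(ltW np)// -sqrtr_sqr ler_wsqrtr//.
      by rewrite expr2 ler_peMl// ltW.
    have e1 : eps^-1 <= n%:R / h ^+ d by rewrite epsV ler_wpM2r// invr_ge0 ltW.
    have n1h : 1 <= n%:R / h ^+ d.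
      by rewrite ler_pdivlMr// mul1r (le_trans _ n1)// exprn_ile1// ltW.
    have : (Num.truncn eps^-1)%:R <= eps^-1 by rewrite truncn_le invr_ge0 ltW.
    by rewrite /Q -natr1; lra.
  rewrite card_ffun !card_prod !card_ord card_bool L4; split.
    by rewrite expn_gt0 !muln_gt0 n0.
  rewrite natrX; apply: lerXn2r; rewrite ?nnegrE ?mulr_ge0 ?invr_ge0 ?exprn_ge0 ?(ltW h0)//.
  rewrite !natrM (_ : 16 * n%:R ^+ 2 / h ^+ d = 2 * (n%:R / h ^+ d) * 2 * (4 * n%:R)).
    by rewrite !ler_wpM2r// mulr_ge0.
  by field; rewrite gt_eqF.
- by move=> j; have [] := gwP (enum_val j).
- by move=> j; have [] := gwP (enum_val j).
- by move=> j; have [] := gwP (enum_val j).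
- move=> x; exists (enum_rank (codes x)); rewrite enum_rankK.
  by have [_ _ _] := gwP (codes x); apply.
Qed.

End brackets.

(** * Centering and expectations under the stationary law *)

Section bounded_integrals.
Context d (T : measurableType d) (R : realType) (m : probability T R).

Lemma bounded_integrable (g : T -> R) (C : R) : measurable_fun setT g ->
  (forall x, `|g x| <= C) -> m.-integrable setT (EFin \o g).
Proof.
move=> mg gC; apply/integrableP; split; first exact/measurable_EFinP.
apply: (@le_lt_trans _ _ (\int[m]_x C%:E)%E).
  by apply: ge0_integral_mono => x //=; rewrite lee_fin.
by rewrite integral_probability_cst ltry.
Qed.

Lemma integral_bounded (g : T -> R) (C : R) : measurable_fun setT g ->
  (forall x, `|g x| <= C) -> (\int[m]_x (g x)%:E)%E = (\int[m]_x g x)%:E.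
Proof.
move=> mg gC; rewrite fineK//; apply: integrable_fin_num => //.
exact: bounded_integrable gC.
Qed.

Lemma Rintegral_probability_cst (c : R) : \int[m]_(x in setT) c = c.
Proof. by rewrite /Rintegral integral_probability_cst. Qed.

Lemma normr_Rintegral_le (g : T -> R) (C : R) : measurable_fun setT g ->
  (forall x, `|g x| <= C) -> `|\int[m]_x g x| <= C.
Proof.
move=> mg gC; apply: le_trans (le_normr_Rintegral _ (bounded_integrable mg gC)) _ => //.
rewrite -[leRHS]Rintegral_probability_cst; apply: le_Rintegral => //.
  by apply: bounded_integrable => [|x]; [exact: measurableT_comp|rewrite normr_id].
by apply: (@bounded_integrable (fun=> C) `|C|).
Qed.

Definition center (g : T -> R) (x : T) : R := g x - \int[m]_y g y.

Variables (g : T -> R) (C : R).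
Hypotheses (mg : measurable_fun setT g) (gC : forall x, `|g x| <= C).

Lemma measurable_center : measurable_fun setT (center g).
Proof. exact: measurable_funB. Qed.

Lemma center_le x : `|center g x| <= 2 * C.
Proof.
apply: le_trans (ler_normB _ _) _; have := gC x; have := normr_Rintegral_le mg gC; lra.
Qed.

Lemma Rintegral_center : \int[m]_x center g x = 0.
Proof.
rewrite RintegralB//; last 2 first.
- exact: bounded_integrable gC.
- by apply: (@bounded_integrable (fun=> \int[m]_y g y) `|\int[m]_y g y|).
by rewrite Rintegral_probability_cst subrr.
Qed.

(** Centering in the form that the occupation bound can use: shifted to a nonnegative function, and
    for both signs. *)
Lemma integral_center_shift (s : bool) :
  (\int[m]_x ((-1) ^+ s * center g x + 2 * C)%:E)%E = (2 * C)%:E.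
Proof.
have mc : measurable_fun setT (fun x => (-1) ^+ s * center g x).
  by apply: measurable_funM => //; exact: measurable_center.
have cC x : `|(-1) ^+ s * center g x| <= 2 * C.
  by rewrite normrM normr_sign mul1r center_le.
rewrite (@integral_bounded _ (2 * C + 2 * C)); last 2 first.
- exact: measurable_funD.
- move=> x; apply: le_trans (ler_normD _ _) _; apply: lerD => //.
  by rewrite ger0_norm// (le_trans _ (center_le x)).
congr EFin; rewrite RintegralD//; last 2 first.
- exact: bounded_integrable cC.
- by apply: (@bounded_integrable (fun=> 2 * C) `|2 * C|).
rewrite Rintegral_probability_cst RintegralZl//; last first.
  by apply: bounded_integrable center_le; exact: measurable_center.
by rewrite Rintegral_center mulr0 add0r.
Qed.

Lemma integral_abs_center_le (a : R) : (\int[m]_x `|g x|%:E <= a%:E)%E ->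
  (\int[m]_x `|center g x|%:E <= (2 * a)%:E)%E.
Proof.
move=> ga; have mag : measurable_fun setT (fun x => `|g x|) by exact: measurableT_comp.
have ag x : `| `|g x| | <= C by rewrite normr_id.
rewrite (integral_bounded mag ag) lee_fin in ga.
rewrite (@integral_bounded _ (2 * C)); last 2 first.
- by apply: measurableT_comp => //; exact: measurable_center.
- by move=> x; rewrite normr_id center_le.
rewrite lee_fin.
apply: (@le_trans _ _ (\int[m]_x (`|g x| + `|\int[m]_y g y|))).
  apply: le_Rintegral => //.
  - apply: (@bounded_integrable _ (2 * C)) => [|x].
      by apply: measurableT_comp => //; exact: measurable_center.
    by rewrite normr_id center_le.
  - apply: (@bounded_integrable _ (C + `|\int[m]_y g y|)) => [|x].
      exact: measurable_funD.
    by rewrite [leLHS]ger0_norm ?addr_ge0// lerD2r.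
  - by move=> x _; exact: ler_normB.
rewrite RintegralD//; last 2 first.
- exact: bounded_integrable ag.
- apply: (@bounded_integrable (fun=> `|\int[m]_y g y|) `|\int[m]_y g y|) => // x.
  by rewrite normr_id.
rewrite Rintegral_probability_cst.
have := le_normr_Rintegral measurableT (bounded_integrable mg gC); lra.
Qed.

End bounded_integrals.

Section stationary_expectation.
Context (R : realType) d (E : measurableType d) dO (Omega : measurableType dO).
Variables (P : R.-pker E ~> E) (X : nat -> {mfun Omega >-> E}).
Variable PP : probability E R -> probability Omega R.
Hypothesis X_chain : markov_family P PP X.
Variable mu : probability E R.
Hypothesis mu_stat : stationary P mu.

Lemma stationary_law n B : measurable B -> PP mu (X n @^-1` B) = mu B.
Proof.
elim: n B => [|n IH] B mB; first by rewrite (X_chain mu).2.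
have pT : past X n setT by rewrite -(preimage_setT (X n)); exact: past_preimage.
rewrite -(setTI (X n.+1 @^-1` B)) ((X_chain mu).1 n setT B pT mB) -mu_stat//.
have mXn : measurable_fun setT (X n) by exact: measurable_funPT.
rewrite -(ge0_integral_image_measure (PP mu) mXn (g := fun x => P x B))//; last first.
  exact: measurable_kernel.
by apply: eq_measure_integral => A mA _; exact: IH.
Qed.

Lemma integral_stationary n (g : E -> R) (C : R) : measurable_fun setT g ->
  (forall x, `|g x| <= C) ->
  (\int[PP mu]_w (g (X n w))%:E = \int[mu]_x (g x)%:E)%E.
Proof.
move=> mg gC; have mXn : measurable_fun setT (X n) by exact: measurable_funPT.
have -> : (\int[mu]_x (g x)%:E = \int[pushforward (PP mu) (X n)]_x (g x)%:E)%E.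
  by apply: eq_measure_integral => A mA _; rewrite [RHS]stationary_law.
rewrite integral_pushforward//; first exact/measurable_EFinP.
rewrite preimage_setT.
apply: (@bounded_integrable _ _ _ (PP mu) (g \o X n) C) => [|w]; last exact: gC.
exact: (measurableT_comp mg mXn).
Qed.

Lemma integral_stationary_sum n (g : E -> R) (C : R) : measurable_fun setT g ->
  (forall x, `|g x| <= C) ->
  (\int[PP mu]_w (\sum_(1 <= i < n.+1) g (X i w))%:E =
   (n%:R * \int[mu]_x g x)%:E)%E.
Proof.
move=> mg gC; under eq_integral do rewrite -sumEFin.
have int i : (PP mu).-integrable setT (fun w => (g (X i w))%:E).
  apply: (@bounded_integrable _ _ _ (PP mu) (g \o X i) C) => [|w]; last exact: gC.
  by apply: (measurableT_comp mg); exact: measurable_funPT.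
rewrite integral_sum//.
rewrite (eq_bigr (fun=> (\int[mu]_x g x)%:E)); last first.
  by move=> i _; rewrite (integral_stationary i mg gC) (integral_bounded mu mg gC).
rewrite sumEFin big_const_nat iter_addr addr0 subn1/= mulr_natl.
by [].
Qed.

End stationary_expectation.

(** * Expected deviation for given truncation levels *)

Lemma weighted_sum_le (R : realType)
    (c q A1 A2 A3 A4 D1 D2 D3 D4 D5 T1 T2 T3 : R) : 0 <= c -> 0 <= q ->
  0 <= D1 -> 0 <= D2 -> 0 <= D3 -> 0 <= D4 -> 0 <= D5 ->
  0 <= T1 -> 0 <= T2 -> 0 <= T3 ->
  2 * A1 <= D1 * T1 -> 2 * A2 <= D2 * T2 -> 2 * A3 <= D3 * T3 -> 2 * A4 <= D4 ->
  2 * c * (A1 + A2 + A3 + A4) + D5 * q <=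
  (D1 + D2 + D3 + D4 + D5) * (c * (T1 + T2 + T3 + 1) + q).
Proof.
move=> c0 q0 D10 D20 D30 D40 D50 T10 T20 T30 e1 e2 e3 e4.
set DD := D1 + D2 + D3 + D4 + D5.
have f1 : D1 * T1 <= DD * T1 by apply: ler_wpM2r => //; rewrite /DD; lra.
have f2 : D2 * T2 <= DD * T2 by apply: ler_wpM2r => //; rewrite /DD; lra.
have f3 : D3 * T3 <= DD * T3 by apply: ler_wpM2r => //; rewrite /DD; lra.
have f4 : D4 <= DD by rewrite /DD; lra.
rewrite [leRHS]mulrDr; apply: lerD; last by apply: ler_wpM2r => //; rewrite /DD; lra.
rewrite (_ : 2 * c * _ = c * (2 * A1 + 2 * A2 + 2 * A3 + 2 * A4)); last by ring.
rewrite mulrCA; apply: ler_wpM2l => //; rewrite !mulrDr mulr1.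
by apply: lerD (le_trans e4 f4); apply: lerD (le_trans e3 f3);
  apply: lerD; [exact: le_trans f1|exact: le_trans f2].
Qed.

Section expected_deviation.
Context (R : realType) (d : nat) (dE : measure_display) (E : measurableType dE).
Context (dO : measure_display) (Omega : measurableType dO).
Variables (P : R.-pker E ~> E) (X : nat -> {mfun Omega >-> E}).
Variable PP : probability E R -> probability Omega R.
Hypothesis X_chain : markov_family P PP X.
Variables (nu : probability E R) (psi : {sigma_finite_measure set E -> \bar R}).
Hypothesis X_irr : psi_irreducible P psi.
Variables (S : set E) (delta : R) (Psi : probability E R).
Hypothesis S_small : small_set P 1 S delta Psi.
Hypothesis S_sup : (ereal_sup
  [set (\int[PP \d_x]_w hitting_time X S w)%E | x in S] < +oo)%E.
Hypothesis S_nu : (\int[PP nu]_w hitting_time X S w < +oo)%E.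
Context (dA : measure_display) (OmegaA : measurableType dA).
Variables (PA : probability OmegaA R) (Z : nat -> {mfun OmegaA >-> (E * bool)%type}).
Hypothesis Z_chain : split_chain_from_atom P S delta Psi PA Z.
Variable mu : probability E R.
Hypothesis mu_stat : stationary P mu.

Definition block_tail (i : nat) : \bar R := PA [set w | avoids Z (atom S) w i].

Hypothesis block_fin : (\sum_(i <oo) block_tail i < +oo)%E.

Section expected_max.
Local Open Scope ereal_scope.

Let mS : measurable S. Proof. by case: S_small. Qed.

Let delta_gt0 : (0 < delta)%R. Proof. by case: S_small. Qed.

Let minor x B : S x -> measurable B -> delta%:E * Psi B <= P x B.
Proof.
move=> Sx mB; case: S_small => _ _ _ /(_ x B Sx mB) /=.
rewrite (eq_integral (EFin \o \1_B)); last first.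
  by move=> y _; rewrite /= diracE indicE.
by rewrite integral_indic// setIT.
Qed.

Lemma integral_initial (m : probability E R) F : (forall x, 0 <= F x) ->
  measurable_fun setT F -> \int[PP m]_w F (X 0%N w) = \int[m]_x F x.
Proof.
move=> F0 mF; have mX0 : measurable_fun setT (X 0%N) by exact: measurable_funPT.
rewrite -(ge0_integral_image_measure (PP m) mX0)//.
by apply: eq_measure_integral => B mB _; exact: (X_chain m).2.
Qed.

Lemma integral_mean_return_le (m : probability E R) :
  \int[m]_x mean_return P S x <= \int[PP m]_w hitting_time X S w.
Proof.
rewrite -(integral_initial m); last 2 first.
- exact: mean_return_ge0.
- exact: measurable_mean_return.
exact: (mean_return_le mS (X_chain m).1).
Qed.

(* [M] is the length at which the blocks are truncated.  The second moment of a
   truncated block is bounded by [m * eta + B * s] up to a constant: the visits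
   of age at most [m] are charged to the occupation measure, the later ones to
   the tail of the block length. *)
Lemma expected_max_bound : exists C : R, (0 <= C)%R /\
  forall (n N M m : nat) (B eta r s : R) (f : 'I_N -> E -> R),
  (0 < N)%N -> (0 < M)%N -> (0 < B)%R -> (0 <= r)%R -> (0 <= s)%R -> (0 <= eta)%R ->
  (forall j, measurable_fun setT (f j)) ->
  (forall j x, (`|f j x| <= B)%R) ->
  (forall j, \int[mu]_x (f j x + B)%:E = B%:E) ->
  (forall j, \int[mu]_x (- f j x + B)%:E = B%:E) ->
  (forall j, \int[mu]_x `|f j x|%:E <= eta%:E) ->
  (forall k, \sum_(M <= i < k) block_tail i <= r%:E) ->
  (forall k, \sum_(m <= i < k) i.+1%:R%:E * block_tail i <= s%:E) ->
  \int[PP nu]_w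
    (max_abs (markov_state (add_values f) X [tuple 0%R | j < N] n w))%:E <=
  (2 * B * M%:R * (ln (2 * N%:R) + 2) + 2 * B * n%:R * r +
   C * n%:R * (m%:R * eta + B * s) / M%:R + B * C)%:E.
Proof.
have [Q PQ] := residual_kernel mS delta_gt0 minor.
have delta_le1 : (delta <= 1)%R.
  have [x Sx] : exists x, S x.
    apply: contrapT => nS; case: S_small => _ _ S1 _.
    have S0 : S = set0 by apply/seteqP; split => // x Sx; apply: nS; exists x.
    by move: S1; rewrite S0 measure0 => /eqP; rewrite eq_sym onee_eq0.
  have := residual_mass PQ x; rewrite indicE mem_set// mulr1 => h.
  by rewrite -lee_fin -h leeDr.
have tailE i : \int[Psi]_x kpow Q i (cst 1) x = block_tail i.
  by rewrite -(split_chain_tail delta_gt0 delta_le1 mS PQ Z_chain).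
pose alpha := \sum_(i <oo) block_tail i.
have afin : alpha \is a fin_num by rewrite ge0_fin_numE// nneseries_ge0.
have alpha0 : (0 <= fine alpha)%R by rewrite fine_ge0// nneseries_ge0.
have occ n F : (forall x, 0 <= F x) -> measurable_fun setT F ->
    \sum_(0 <= i < n) \int[Psi]_y kpow Q i F y <= alpha * \int[mu]_x F x.
  move=> F0 mF; have := occupation_le delta_gt0 mS PQ X_irr mu_stat _ n F0 mF.
  by under eq_eseriesr do rewrite tailE; apply.
pose sup := ereal_sup [set \int[PP \d_x]_w hitting_time X S w | x in S].
have [b b0 ret] : exists2 b : R, (0 <= b)%R & forall x, S x -> mean_return P S x <= b%:E.
  exists (fine (maxe 0 sup)); first by rewrite fine_ge0// le_max lexx.
  move=> x Sx; rewrite fineK; last first.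
    by rewrite ge0_fin_numE ?le_max ?lexx// gt_max ltry.
  rewrite le_max; apply/orP; right.
  have : \int[\d_x]_y mean_return P S y <= sup.
    apply: le_trans (integral_mean_return_le \d_x) _.
    by apply: ereal_sup_ubound; exists x.
  rewrite integral_dirac//; last exact: measurable_mean_return.
  by rewrite diracT mul1e.
pose w := lyapunov P S delta b.
have w0 x : 0 <= w x by exact: lyapunov_ge0.
have mw : measurable_fun setT w by exact: measurable_lyapunov.
have wsup x : 1 + \int[Q x]_y w y <= w x by exact: (lyapunov_super delta_gt0 mS b0 PQ).
have wnu : \int[nu]_x w x \is a fin_num.
  rewrite ge0_fin_numE ?integral_ge0//.
  apply: (@le_lt_trans _ _ (\int[nu]_x (mean_return P S x + (b / delta)%:E))).
    apply: ge0_integral_mono => // x; apply: leeD2r.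
    rewrite -[leRHS]mul1e; apply: lee_wpmul2r; first exact: mean_return_ge0.
    by rewrite lee_fin indicE; case: (_ \in _).
  rewrite ge0_integralD//; last 3 first.
  - by move=> x _; exact: mean_return_ge0.
  - exact: measurable_mean_return.
  - by move=> x _; rewrite lee_fin divr_ge0// ltW.
  rewrite lte_add_pinfty//; last by rewrite integral_probability_cst ltry.
  exact: le_lt_trans (integral_mean_return_le nu) S_nu.
have wnu0 : (0 <= fine (\int[nu]_x w x))%R by rewrite fine_ge0// integral_ge0.
(* With the choices below, c n / theta = B n r + 2 n V / M, so twice the two coefficients in [V] are
   needed. The integral of [w] bounds the mean time before the first regeneration, each step of
   which may cost [B]. *)
exists (2 * (fine alpha + 1) + fine (\int[nu]_x w x))%R.
split; first by rewrite !addr_ge0 ?mulr_ge0 ?addr_ge0.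
move=> n N M m B eta r s f N0 M0 B0 r0 s0 eta0 mf fB fp fm fabs hr hs.
have M0' : (0 < M%:R :> R)%R by rewrite ltr0n.
pose theta := ((2 * B * M%:R)^-1)%R.
have theta0 : (0 < theta)%R by rewrite invr_gt0 !mulr_gt0.
have thetaBM : (theta * B * M%:R <= 2^-1)%R.
  rewrite le_eqVlt; apply/orP; left; apply/eqP; rewrite /theta; field.
  by rewrite !gt_eqF.
pose V := (m%:R * (fine alpha * eta) + B * s)%R.
have V0 : (0 <= V)%R by rewrite !addr_ge0 ?mulr_ge0// ltW.
pose c := (theta * B * r + 4 * theta ^+ 2 * B * V)%R.
have c0 : (0 <= c)%R by rewrite addr_ge0 ?mulr_ge0 ?exprn_ge0 ?(ltW theta0) ?(ltW B0).
have tail1 i : block_tail i <= 1.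
  by apply: probability_le1; apply: measurable_avoids; exact: measurableX.
have tailfin k : \sum_(0 <= i < k) block_tail i \is a fin_num.
  by apply/sum_fin_numP => i _ _; rewrite ge0_fin_numE// (le_lt_trans (tail1 i)) ?ltry.
(* The mean block length exceeds its truncation by at most [r]: this is the whole centering error of
   a truncated block. *)
have alphaE : alpha <= \sum_(0 <= i < M) block_tail i + r%:E.
  apply: lime_le; first by apply: is_cvg_nneseries => i _ _.
  apply: nearW => k; have [kM|Mk] := leqP k M.
    rewrite -[leLHS]adde0; apply: leeD; last by rewrite lee_fin.
    by rewrite [leRHS](big_cat_nat (n := k))//= leeDl// sume_ge0.
  by rewrite (big_cat_nat (n := M)) ?(ltnW Mk)//= leeD2l.
have tail_kpow a i : (0 <= a)%R ->
    \int[Psi]_y kpow Q i (fun=> a%:E) y = a%:E * block_tail i.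
  move=> a0; rewrite -tailE -ge0_integralZl//; last 2 first.
  - by apply: measurable_kpow => //; exact: measurable_cst.
  - by move=> x _; exact: kpow_ge0.
  - by apply: eq_integral => y _; rewrite -kpowZ//; under [in RHS]eq_fun do rewrite /cst mule1.
have late_le k : \int[Psi]_y additive_value Q
    (fun i _ => ((M < i)%N%:R)%:E) k 1 y <= r%:E.
  apply: le_trans (hr k.+1); rewrite (big_nat_widenl _ 0)//= big_mkcond/= big_mkord.
  pose late i (y : E) : \bar R := ((M < i)%N%:R)%:E.
  have late0 i y : 0 <= late i y by rewrite lee_fin.
  have mlate i : measurable_fun setT (late i) by exact: measurable_cst.
  apply: (@le_trans _ _ (\int[Psi]_y (late 1%N y + additive_value Q late k 1 y))).
    apply: ge0_integral_mono => y; first exact: additive_value_ge0.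
    exact: leeDr.
  rewrite (integral_additive_value Q late0 mlate); apply: lee_sum => i _.
  by rewrite tail_kpow// add0n ltnS; case: ifP => _; rewrite ?mul1e ?mul0e.
have block_le (i : 'I_N * bool) :
    \int[Psi]_y ((expR (theta * ((-1) ^+ i.2 * f i.1 y)))%:E *
      block_exp Q S delta theta (fun y => (-1) ^+ i.2 * f i.1 y)%R M.-1 y) <=
    (1 + c)%:E.
  pose g y := ((-1) ^+ i.2 * f i.1 y)%R.
  have mg : measurable_fun setT g by exact: measurable_funM.
  have gE y : (`|g y| = `|f i.1 y|)%R by rewrite normrM normr_sign mul1r.
  have gB y : (`|g y| <= B)%R by rewrite gE.
  have gB0 y : (0 <= g y + B)%R.
    by rewrite -lerBlDr sub0r; move: (gB y); rewrite ler_norml => /andP[].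
  pose a j := \int[Psi]_y kpow Q j (fun y => `|g y|%:E) y.
  have mag : measurable_fun setT (fun y => `|g y|%:E).
    by apply/measurable_EFinP; exact: measurableT_comp.
  have a0 j : 0 <= a j by apply: integral_ge0 => y _; apply: kpow_ge0.
  have aB j : a j <= B%:E * block_tail j.
    rewrite -tail_kpow ?(ltW B0)//; apply: ge0_integral_mono => y.
      exact: kpow_ge0.
    by apply: kpow_le => // z; rewrite lee_fin.
  rewrite addrA; apply: (@block_exp_start_le _ _ _ P Q S delta Psi delta_gt0 mS PQ
    theta B M g theta0 (ltW B0) thetaBM mg gB M.-1
    (fine (\sum_(0 <= i < M) block_tail i)) r V).
  - by rewrite prednK.
  - by rewrite fineK// big_mkord; apply: eq_bigr => j _; rewrite tailE.
  - rewrite -(big_mkord xpredT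
      (fun j => \int[Psi]_y kpow Q j (fun y => (g y + B)%:E) y)).
    apply: le_trans (occ _ _ _ _) _ => //.
      by apply/measurable_EFinP; exact: measurable_funD.
    rewrite (_ : \int[mu]_y (g y + B)%:E = B%:E); last first.
      rewrite /g; case: i.2; rewrite ?expr1 ?expr0; last by under eq_integral do rewrite mul1r.
      by under eq_integral do rewrite mulN1r.
    rewrite -mulrDr mulrC EFinM EFinD fineK//.
    by apply: lee_wpmul2r => //; rewrite lee_fin ltW.
  - rewrite -(big_mkord xpredT (fun j => j.+1%:R%:E * a j)).
    apply: (@le_trans _ _ (\sum_(0 <= j < M) (m%:R%:E * a j +
      B%:E * (if (m <= j)%N then j.+1%:R%:E * block_tail j else 0)))).
      apply: lee_sum => j _; have [mj|jm] := leqP m j.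
        rewrite muleCA; apply: le_trans (leeDr _ _); last first.
          by rewrite mule_ge0// lee_fin.
        by apply: lee_wpmul2l; rewrite ?lee_fin.
      rewrite mule0 adde0; apply: lee_wpmul2r => //.
      by rewrite lee_fin ler_nat.
    have u0 j : 0 <= (if (m <= j)%N then j.+1%:R%:E * block_tail j else 0).
      by case: ifP => // _; rewrite mule_ge0// lee_fin.
    rewrite big_split/= -ge0_sume_distrr// -ge0_sume_distrr//.
    rewrite /V EFinD; apply: leeD.
      rewrite EFinM; apply: lee_wpmul2l; first by rewrite lee_fin.
      apply: le_trans (occ _ _ _ _) _ => //.
      rewrite EFinM fineK//; apply: lee_wpmul2l; first exact: nneseries_ge0.
      by under eq_integral do rewrite gE.
    rewrite EFinM; apply: lee_wpmul2l; first by rewrite lee_fin ltW.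
    by rewrite -big_mkcond/=; apply: le_trans (hs M); rewrite (big_nat_widenl m 0).
pose L := (2 * N%:R * expR (theta * B * M%:R + c * n%:R))%R.
have L1 : (1 <= L)%R.
  rewrite /L mulr_ege1//; first by rewrite mulr_ege1// ler1n.
  by rewrite -[leLHS]expR0 ler_expR !addr_ge0 ?mulr_ge0 ?(ltW theta0) ?(ltW B0).
have main x := markov_value_max_le delta_gt0 mS PQ mf N0 M0 theta0 (ltW B0) r0 c0 L1
  fB w0 mw wsup late_le block_le x (erefl L).
have F0 s' : 0 <= (EFin \o @max_abs R N) s' by rewrite lee_fin max_abs_ge0.
have mF : measurable_fun setT (EFin \o @max_abs R N).
  by apply/measurable_EFinP; exact: measurable_max_abs.
have := markov_valueE (measurable_add_values mf) F0 mF (X_chain nu).1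
  [tuple 0%R | j < N] n.
move=> ->.
set K0 := (((ln (2 * N%:R) + 1) / theta + B * M%:R + c * n%:R / theta +
  B * (n%:R * r))%R) in main.
have K00 : (0 <= K0)%R.
  rewrite !addr_ge0 ?divr_ge0 ?mulr_ge0 ?(ltW theta0) ?(ltW B0)// addr_ge0//.
  by rewrite ln_ge0// mulr_ege1// ler1n.
apply: (@le_trans _ _ (\int[PP nu]_w' (K0%:E + B%:E * w (X 0%N w')))).
  apply: ge0_integral_mono => w'; last exact: main.
  by apply: markov_value_ge0.
rewrite (integral_initial nu (F := fun x => K0%:E + B%:E * w x)); last 2 first.
- by move=> x; rewrite adde_ge0 ?mule_ge0 ?lee_fin ?(ltW B0).
- by apply: emeasurable_funD => //; exact: emeasurable_funM.
rewrite ge0_integralD//; last 2 first.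
- by move=> x _; rewrite mule_ge0 ?lee_fin ?(ltW B0).
- exact: emeasurable_funM.
rewrite ge0_integralZl//; last by rewrite lee_fin ltW.
rewrite integral_probability_cst.
rewrite -(fineK wnu) -EFinM -EFinD lee_fin /K0 /c /V.
set W := fine (\int[nu]_x w x) in wnu0 *.
rewrite -subr_ge0 (_ : (_ - _)%R = (B * M%:R + B * (2 * (fine alpha + 1)) +
  n%:R / M%:R * ((2 + W) * (m%:R * eta) + (2 * fine alpha + W) * (B * s)))%R).
  by repeat (apply: addr_ge0 || apply: mulr_ge0); rewrite ?invr_ge0 ?(ltW B0).
rewrite /theta /=; field.
by rewrite !gt_eqF.
Qed.

End expected_max.

Variables (emb : E -> Rd R d) (K : Rd R d -> R).

Lemma tnth_markov_state N (f : 'I_N -> E -> R) n w j :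
  tnth (markov_state (add_values f) X [tuple 0 | _ < N] n w) j =
  \sum_(1 <= i < n.+1) f j (X i w).
Proof.
elim: n => [|n IH]; first by rewrite tnth_mktuple big_nil.
by rewrite big_nat_recr//= tnth_mktuple /= IH.
Qed.

Lemma le_max_abs N (s : N.-tuple (measurableTypeR R)) j : `|tnth s j : R| <= max_abs s.
Proof. exact: le_bigmax. Qed.

(** One maximum has to control the empirical means of the bracket centers and of the bracket
    errors. *)
Definition centered_family N (g w : 'I_N -> E -> R) (j : 'I_(N + N)) : E -> R :=
  match fintype.split j with inl k => center mu (g k) | inr k => center mu (w k) end.

(** The bracket error enters twice, as an empirical sum and as a mean under [mu]. The former is at
    most the latter plus one more maximum, whence both factors 2. *)
Lemma kde_deviation_le (n N : nat) (h C v : R) (g w : 'I_N -> E -> R) (x : Rd R d)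
    (j : 'I_N) (om : Omega) : (0 < n)%N -> 0 < h ->
  measurable_fun setT (fun e => K (scaled_diff x (emb e) h)) ->
  measurable_fun setT (g j) -> measurable_fun setT (w j) ->
  (forall e, `|g j e| <= C) -> (forall e, 0 <= w j e <= C) ->
  (\int[mu]_e (w j e)%:E <= v%:E)%E ->
  (forall e, `|K (scaled_diff x (emb e) h) - g j e| <= w j e) ->
  (`|(kde K h n (fun i => emb (X i om)) x)%:E -
     'E_(PP mu)[fun om => kde K h n (fun i => emb (X i om)) x]| <=
   ((n%:R * h ^+ d)^-1 * (2 * max_abs (markov_state (add_values (centered_family g w)) X
      [tuple 0 | _ < N + N] n om) + 2 * n%:R * v))%:E)%E.
Proof.
move=> n0 h0 mk mg mw gC w0C wv kgw.
pose k e := K (scaled_diff x (emb e) h).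
have wC e : `|w j e| <= C by have /andP[? ?] := w0C e; rewrite ger0_norm.
have k2C e : `|k e| <= 2 * C.
  have -> : k e = (k e - g j e) + g j e by rewrite subrK.
  apply: le_trans (ler_normD _ _) _; have := kgw e; have := gC e; have := wC e.
  by rewrite -/(k e) => ? ? ?; have := ler_norm (w j e); lra.
have n1 : 0 < n%:R :> R by rewrite ltr0n.
have hd0 : 0 < h ^+ d by rewrite exprn_gt0.
set c := (n%:R * h ^+ d)^-1.
have c0 : 0 < c by rewrite invr_gt0 mulr_gt0.
have kdeE w' : kde K h n (fun i => emb (X i w')) x = c * \sum_(1 <= i < n.+1) k (X i w').
  rewrite /kde -mulr_suml mulrCA mulrC /c invfM.
  by rewrite -mulrA mulrC.
set kbar := \int[mu]_e k e.
have -> : ('E_(PP mu)[fun w' => kde K h n (fun i => emb (X i w')) x] =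
    (c * (n%:R * kbar))%:E)%E.
  rewrite unlock; under eq_integral do rewrite kdeE EFinM.
  rewrite integralZl//.
    by rewrite (integral_stationary_sum X_chain mu_stat n mk k2C).
  under eq_fun do rewrite -sumEFin.
  apply: integrable_sum => // i _.
  apply: (@bounded_integrable _ _ _ (PP mu) (k \o X i) (2 * C)) => [|w']; last exact: k2C.
  by apply: (measurableT_comp mk); exact: measurable_funPT.
rewrite kdeE -EFinB abse_EFin lee_fin -mulrBr normrM (gtr0_norm c0) ler_pM2l//.
set s := markov_state _ _ _ _ _.
set gbar := \int[mu]_e g j e; set wbar := \int[mu]_e w j e.
have wbarv : wbar <= v by rewrite (integral_bounded mu mw wC) lee_fin in wv.
have Sg : `|\sum_(1 <= i < n.+1) g j (X i om) - n%:R * gbar| <= max_abs s.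
  have := le_max_abs s (lshift N j); rewrite tnth_markov_state /centered_family.
  case: split_ordP => [k'|k'] /eqP; last by rewrite eq_lrshift.
  rewrite eq_lshift => /eqP <-; rewrite /center sumrB big_const_nat iter_addr addr0.
  by rewrite subn1/= mulr_natl.
have Sw : `|\sum_(1 <= i < n.+1) w j (X i om) - n%:R * wbar| <= max_abs s.
  have := le_max_abs s (rshift N j); rewrite tnth_markov_state /centered_family.
  case: split_ordP => [k'|k'] /eqP; first by rewrite eq_rlshift.
  rewrite eq_rshift => /eqP <-; rewrite /center sumrB big_const_nat iter_addr addr0.
  by rewrite subn1/= mulr_natl.
have kg : `|\sum_(1 <= i < n.+1) k (X i om) - \sum_(1 <= i < n.+1) g j (X i om)| <=
    \sum_(1 <= i < n.+1) w j (X i om).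
  rewrite -sumrB; apply: le_trans (ler_norm_sum _ _ _) _.
  by apply: ler_sum => i _; exact: kgw.
have kgbar : `|kbar - gbar| <= wbar.
  rewrite -RintegralB//; last 2 first.
  - exact: bounded_integrable k2C.
  - exact: bounded_integrable gC.
  have mkg : measurable_fun setT (fun e => k e - g j e) by exact: measurable_funB.
  have kgC e : `|k e - g j e| <= C.
    by apply: le_trans (kgw e) _; have /andP[] := w0C e.
  apply: le_trans (le_normr_Rintegral _ (bounded_integrable mu mkg kgC)) _ => //.
  apply: le_Rintegral => //.
  - apply: (@bounded_integrable _ _ _ mu _ C) => [|e]; first exact: measurableT_comp.
    by rewrite normr_id.
  - exact: bounded_integrable wC.
  - by move=> e _; exact: kgw.
move: Sg Sw kg kgbar; rewrite !ler_norml.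
set sk := \sum_(1 <= i < n.+1) k _; set sg := \sum_(1 <= i < n.+1) g _ _.
set sw := \sum_(1 <= i < n.+1) w _ _.
move=> /andP[g1 g2] /andP[w1 w2] /andP[k1 k2] /andP[b1 b2].
have nb1 : n%:R * kbar <= n%:R * gbar + n%:R * wbar by rewrite -mulrDr ler_pM2l//; lra.
have nb2 : n%:R * gbar - n%:R * wbar <= n%:R * kbar by rewrite -mulrBr ler_pM2l//; lra.
have nv : n%:R * wbar <= n%:R * v by rewrite ler_pM2l.
by apply/andP; split; lra.
Qed.

Hypotheses (d_gt0 : (0 < d)%N) (emb_meas : measurable_fun setT emb).
Variables (f : Rd R d -> R) (K0 : R -> R).
Hypotheses (f_meas : measurable_fun setT f) (f_ge0 : forall x, 0 <= f x).
Hypothesis f_bounded : exists M : R, forall x, f x <= M.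
Hypothesis f_density : forall B : set (Rd R d), measurable B ->
  mu (emb @^-1` B) = (\int[lebesgue_Rd d]_(x in B) (f x)%:E)%E.
Hypotheses (K0_profile : kernel_profile K0) (K_form : kernel_form K K0).

Lemma expected_deviation_le : exists2 C : R, 0 < C &
  forall (n M m : nat) (h r s : R),
  (0 < n)%N -> 0 < h <= 1 -> (0 < M)%N -> 0 <= r -> 0 <= s ->
  (forall k, \sum_(M <= i < k) block_tail i <= r%:E)%E ->
  (forall k, \sum_(m <= i < k) i.+1%:R%:E * block_tail i <= s%:E)%E ->
  (\int[PP nu]_om ereal_sup
     [set `|(kde K h n (fun i => emb (X i om)) x)%:E -
       'E_(PP mu)[fun om => kde K h n (fun i => emb (X i om)) x]| | x in setT] <=
   (C * ((n%:R * h ^+ d)^-1 * (M%:R * (1 + ln (n%:R / h)) + n%:R * r +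
      n%:R * (m%:R * h ^+ d + s) / M%:R + 1) + Num.sqrt n%:R^-1))%:E)%E.
Proof.
have [C1 [C10 maxb]] := expected_max_bound.
have [Cb Cb0 brk] := kernel_brackets d_gt0 emb_meas f_meas f_ge0 f_bounded f_density
  K0_profile K_form.
pose B := 2 * Cb.
have B0 : 0 < B by rewrite /B; lra.
(* From ln (4 N) with N <= (16 n^2 / h^d)^d: [a] collects the constants, [b] the coefficients of ln
   n and of - ln h. *)
pose a : R := ln 4 + d%:R * ln 16.
pose b : R := 2 * d%:R + d%:R * d%:R.
have a0 : 0 <= a by rewrite addr_ge0 ?mulr_ge0 ?ln_ge0//; lra.
have b0 : 0 <= b by rewrite addr_ge0 ?mulr_ge0.
pose D1 := 4 * B * (a + b + 2).
pose D2 := 4 * B.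
pose D3 := 2 * C1 * (2 * Cb + B).
pose D4 := 2 * B * C1.
have ab0 : 0 <= a + b + 2 by apply: addr_ge0 => //; exact: addr_ge0.
have D10 : 0 <= D1 by rewrite /D1 !mulr_ge0// ltW.
have D20 : 0 < D2 by rewrite /D2; lra.
have D30 : 0 <= D3 by rewrite /D3 !mulr_ge0 ?addr_ge0 ?(ltW B0) ?mulr_ge0 ?(ltW Cb0).
have D40 : 0 <= D4 by rewrite /D4 !mulr_ge0 ?(ltW Cb0).
exists (D1 + D2 + D3 + D4 + 2 * Cb) => [|n M m h r s n0 /andP[h0 h1] M0 r0 s0 hr hs].
  by rewrite ltr_wpDr ?mulr_ge0 ?(ltW Cb0)// ltr_wpDr// ltr_wpDr// ltr_wpDl.
have h01 : 0 < h <= 1 by rewrite h0.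
have [N [g [w [[N0 NN] mgw gwC gwi cover]]]] := brk n h n0 h01.
have hd0 : 0 < h ^+ d by rewrite exprn_gt0.
have n1 : 1 <= n%:R :> R by rewrite ler1n.
have np : 0 < n%:R :> R by rewrite ltr0n.
have mK := measurable_smoothing_kernel K0_profile K_form.
have mk x : measurable_fun setT (fun e => K (scaled_diff x (emb e) h)).
  apply: (measurableT_comp mK).
  exact: (measurableT_comp (@measurable_scaled_diff R d x h) emb_meas).
pose F := centered_family g w.
pose S_ om := max_abs (markov_state (add_values F) X [tuple 0 | _ < N + N] n om).
pose c := (n%:R * h ^+ d)^-1.
have c0 : 0 < c by rewrite invr_gt0 mulr_gt0.
pose q := Num.sqrt (n%:R^-1 : R).
have q0 : 0 <= q by exact: sqrtr_ge0.
pose v := Cb * (h ^+ d * q).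
have v0 : 0 <= v by rewrite !mulr_ge0 ?(ltW Cb0) ?(ltW hd0).
have wC j e : `|w j e| <= Cb by have [_ /andP[? ?]] := gwC j e; rewrite ger0_norm.
have gC j e : `|g j e| <= Cb by have [] := gwC j e.
have mg j : measurable_fun setT (g j) by have [] := mgw j.
have mw j : measurable_fun setT (w j) by have [] := mgw j.
have mF j : measurable_fun setT (F j).
  by rewrite /F /centered_family; case: fintype.split => k; exact: measurable_center.
have FB j e : `|F j e| <= B.
  by rewrite /F /centered_family /B; case: fintype.split => k; exact: center_le.
have Fs j (b' : bool) : (\int[mu]_x ((-1) ^+ b' * F j x + B)%:E)%E = B%:E.
  rewrite /F /centered_family; case: fintype.split => k.
    exact: (integral_center_shift mu (mg k) (gC k)).
  exact: (integral_center_shift mu (mw k) (wC k)).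
have q1 : q <= 1.
  by rewrite -[leRHS]sqrtr1 ler_wsqrtr// invf_le1.
have Fabs j : (\int[mu]_x `|F j x|%:E <= (2 * (Cb * h ^+ d))%:E)%E.
  rewrite /F /centered_family; case: fintype.split => k.
    by apply: (integral_abs_center_le _ (gC k)) => //; have [] := gwi k.
  apply: (integral_abs_center_le _ (wC k)) => //.
  have wa e : `|w k e| = w k e by have [_ /andP[? _]] := gwC k e; rewrite ger0_norm.
  under eq_integral do rewrite wa.
  have [_ /le_trans] := gwi k; apply; rewrite lee_fin ler_pM2l//.
  by rewrite ler_piMr// ltW.
have maxS : (\int[PP nu]_om (S_ om)%:E <= (2 * B * M%:R * (ln (2 * (N + N)%:R) + 2) +
    2 * B * n%:R * r + C1 * n%:R * (m%:R * (2 * (Cb * h ^+ d)) + B * s) / M%:R + B * C1)%:E)%E.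
  apply: maxb => //.
  - by rewrite addn_gt0 N0.
  - by rewrite !mulr_ge0// ltW.
  - by move=> j; have := Fs j false; under eq_integral do rewrite expr0 mul1r.
  - by move=> j; have := Fs j true; under eq_integral do rewrite expr1 mulN1r.
apply: (@le_trans _ _ (\int[PP nu]_om ((2 * c)%:E * (S_ om)%:E + (2 * c * n%:R * v)%:E))%E).
  apply: ge0_integral_mono => om.
    apply: le_trans; last by apply: ereal_sup_ubound; exists [tuple 0 | _ < d].
    exact: abse_ge0.
  apply: ge_ereal_sup => _ [x _ <-]; have [j jP] := cover x.
  have [_ wv] := gwi j.
  apply: (le_trans (kde_deviation_le om n0 h0 (mk x) (mg j) (mw j)
    (gC j) (fun e => (gwC j e).2) wv jP)).
  rewrite -EFinM -EFinD lee_fin -/F -/(S_ om) -/c -/v mulrDr.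
  by rewrite le_eqVlt; apply/orP; left; apply/eqP; ring.
have mS : measurable_fun setT S_.
  apply: (measurableT_comp (@measurable_max_abs R (N + N))).
  apply/measurable_fun_tnthP => j.
  rewrite (_ : _ \o _ = (fun om => \sum_(1 <= i < n.+1) F j (X i om))); last first.
    by apply/funext => om /=; rewrite tnth_markov_state.
  apply: measurable_sum => i; apply: (measurableT_comp (mF j)); exact: measurable_funPT.
have S0 om : 0 <= S_ om by exact: max_abs_ge0.
have c20 : 0 <= 2 * c by apply: mulr_ge0 => //; exact: ltW.
have cnv0 : 0 <= 2 * c * n%:R * v by apply: mulr_ge0 => //; exact: mulr_ge0.
rewrite ge0_integralD//; last 2 first.
- by move=> om _; rewrite mule_ge0 ?lee_fin.
- by apply: emeasurable_funM => //; exact/measurable_EFinP.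
rewrite ge0_integralZl//; last 2 first.
- exact/measurable_EFinP.
- by move=> om _; rewrite lee_fin.
rewrite integral_probability_cst.
apply: (le_trans (leeD2r _ (lee_wpmul2l _ maxS))); first by rewrite lee_fin.
rewrite -EFinM -EFinD lee_fin.
pose l := ln (n%:R / h).
have u0 : 0 <= ln (n%:R : R) by exact: ln_ge0.
have t0 : 0 <= - ln h by rewrite oppr_ge0 ln_le0.
have lE : l = ln n%:R - ln h by rewrite /l ln_div ?posrE.
have l0 : 0 <= l by rewrite lE addr_ge0.
have lnN : ln (2 * (N + N)%:R) + 2 <= (a + b + 2) * (1 + l).
  have : ln (2 * (N + N)%:R) <= ln (4 * (16 * n%:R ^+ 2 / h ^+ d) ^+ d).
    rewrite ler_ln ?posrE; last 2 first.
    - by rewrite mulr_gt0// ltr0n addn_gt0 N0.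
    - by rewrite mulr_gt0// exprn_gt0// divr_gt0// mulr_gt0// exprn_gt0.
    rewrite natrD (_ : 2 * (N%:R + N%:R) = 4 * N%:R); last by ring.
    by rewrite ler_pM2l.
  have -> : ln (4 * (16 * n%:R ^+ 2 / h ^+ d) ^+ d) =
      a + d%:R * (2 * ln n%:R - d%:R * ln h) :> R.
    rewrite lnM ?posrE ?exprn_gt0 ?divr_gt0 ?mulr_gt0 ?exprn_gt0//.
    rewrite lnXn ?divr_gt0 ?mulr_gt0 ?exprn_gt0//.
    rewrite ln_div ?posrE ?mulr_gt0 ?exprn_gt0//.
    rewrite lnM ?posrE ?exprn_gt0// !lnXn//.
    by rewrite -[RHS]/(_ + _ + _) -[X in _ + X = _]mulr_natl -[ln h *+ d]mulr_natl; ring.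
  move=> /le_trans h2; rewrite -lerBrDr; apply: h2; rewrite lE.
  rewrite -subr_ge0 (_ : _ - _ = (a + 2) * (ln n%:R - ln h) + b +
    d%:R * d%:R * ln n%:R + 2 * d%:R * - ln h); last by rewrite /b; ring.
  have a20 : 0 <= a + 2 by exact: addr_ge0.
  rewrite -lE; apply: addr_ge0; last by rewrite !mulr_ge0.
  apply: addr_ge0; last by rewrite !mulr_ge0.
  by apply: addr_ge0 => //; exact: mulr_ge0.
have cnv : 2 * c * n%:R * v = 2 * Cb * q.
  by rewrite /c /v; field; rewrite !gt_eqF.
rewrite cnv -/c -/q -/l.
have Mp : 0 < M%:R :> R by rewrite ltr0n.
pose T1 := M%:R * (1 + l).
pose T2 := n%:R * r.
pose T3 := n%:R * (m%:R * h ^+ d + s) / M%:R.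
have T10 : 0 <= T1 by rewrite mulr_ge0 ?addr_ge0// ltW.
have T20 : 0 <= T2 by rewrite mulr_ge0// ltW.
have T30 : 0 <= T3.
  by rewrite divr_ge0 ?(ltW Mp)// mulr_ge0 ?(ltW np)// addr_ge0// mulr_ge0// ltW.
pose A1 := 2 * B * M%:R * (ln (2 * (N + N)%:R) + 2).
pose A2 := 2 * B * n%:R * r.
pose A3 := C1 * n%:R * (m%:R * (2 * (Cb * h ^+ d)) + B * s) / M%:R.
have e1 : 2 * A1 <= D1 * T1.
  rewrite (_ : 2 * A1 = 4 * B * M%:R * (ln (2 * (N + N)%:R) + 2)); last by rewrite /A1; ring.
  rewrite (_ : D1 * T1 = 4 * B * M%:R * ((a + b + 2) * (1 + l))); last by rewrite /D1 /T1; ring.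
  by apply: ler_wpM2l lnN; apply: mulr_ge0; [exact: ltW|exact: ltW].
have e2 : 2 * A2 = D2 * T2 by rewrite /A2 /D2 /T2; ring.
have e3 : 2 * A3 <= D3 * T3.
  rewrite -subr_ge0 (_ : _ - _ = 2 * C1 * n%:R / M%:R *
    (B * (m%:R * h ^+ d) + 2 * Cb * s)); last by rewrite /A3 /D3 /T3; field; rewrite gt_eqF.
  apply: mulr_ge0; first by rewrite !mulr_ge0// invr_ge0 ltW.
  apply: addr_ge0; first by apply: mulr_ge0; [exact: ltW|rewrite mulr_ge0// ltW].
  by rewrite !mulr_ge0// ltW.
have e4 : 2 * (B * C1) = D4 by rewrite /D4; ring.
rewrite -/A1 -/A2 -/A3 -/T1 -/T2 -/T3.
have Cb0' := ltW Cb0; have D20' := ltW D20; have c0' := ltW c0.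
have D50 : 0 <= 2 * Cb by rewrite mulr_ge0.
have e2' : 2 * A2 <= D2 * T2 by rewrite e2.
have e4' : 2 * (B * C1) <= D4 by rewrite e4.
exact: (weighted_sum_le c0' q0 D10 D20' D30 D40 D50 T10 T20 T30 e1 e2' e3 e4').
Qed.

End expected_deviation.

(** * Balancing the truncation levels *)

Section rates.
Context (R : realType).

Lemma near_ln_le_powR (a c : R) : 0 < a -> \forall n \near \oo, c * ln n%:R <= n%:R `^ a.
Proof.
move=> a0; pose c' := Num.max 0 c.
have c'0 : 0 <= c' by rewrite le_max lexx.
have ca0 : 0 <= 2 * c' / a by rewrite !mulr_ge0// invr_ge0 ltW.
pose K := (2 * c' / a) `^ (2 / a).
near=> n.
have n1 : 1 <= n%:R :> R by near: n; exact: nbhs_infty_ger.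
have nK : K <= n%:R by near: n; exact: nbhs_infty_ger.
have n0 : 0 < n%:R :> R by rewrite (lt_le_trans _ n1).
have ln0 : 0 <= ln n%:R :> R by exact: ln_ge0.
set z := n%:R `^ (a / 2).
have z0 : 0 < z by rewrite powR_gt0.
have zK : 2 * c' / a <= z.
  have -> : 2 * c' / a = K `^ (a / 2).
    rewrite /K -powRrM (_ : 2 / a * (a / 2) = 1) ?powRr1//.
    by field; rewrite gt_eqF.
  by apply: ge0_ler_powR; rewrite ?nnegrE ?powR_ge0 ?divr_ge0 ?(ltW a0) ?(ltW n0).
have lnz : ln n%:R <= 2 / a * z.
  have : ln z <= z by have := @le_ln1Dx R (z - 1); rewrite [1 + _]addrC subrK; lra.
  rewrite ln_powR => h; rewrite -ler_pdivrMl ?divr_gt0// invf_div.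
  exact: h.
have -> : n%:R `^ a = z * z.
  by rewrite -powRD ?gt_eqF ?implybT// (_ : a / 2 + a / 2 = a)//; lra.
apply: (@le_trans _ _ (c' * (2 / a * z))).
  apply: (@le_trans _ _ (c' * ln n%:R)); last exact: ler_wpM2l.
  by rewrite ler_wpM2r// le_max lexx orbT.
rewrite mulrA ler_wpM2r ?(ltW z0)//; apply: le_trans zK.
by rewrite le_eqVlt; apply/orP; left; apply/eqP; ring.
Unshelve. all: by end_near. Qed.

(* [V] is the order of the second moment [m * H + s] of a block, and the
   truncation level [y] balances [y * l] with [n * V / y]. *)
Lemma rate_bound (n H l L y V M m r s k : R) :
  0 < n -> 0 < H -> 1 <= l -> 1 <= y -> 0 <= L <= k * l -> y ^+ 2 * l = n * V ->
  H ^+ 2 <= V -> y <= M <= 2 * y -> 0 <= m * H <= k * V -> 0 <= s <= k * V ->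
  n * r <= k * (y * l) ->
  (n * H)^-1 * (M * (1 + L) + n * r + n * (m * H + s) / M + 1) + Num.sqrt n^-1 <=
  (4 + 5 * k) * Num.sqrt (V * l / (n * H ^+ 2)).
Proof.
move=> n0 H0 l1 y1 /andP[L0 Ll] yV HV /andP[yM My] /andP[m0 mV] /andP[s0 sV] nr.
have l0 : 0 < l by lra.
have y0 : 0 < y by lra.
have k0 : 0 <= k by rewrite -(pmulr_lge0 _ l0); exact: le_trans Ll.
have yl1 : 1 <= y * l by rewrite mulr_ege1.
set z := y * l / (n * H).
have z0 : 0 < z by rewrite divr_gt0 ?mulr_gt0.
have z2 : z ^+ 2 = V * l / (n * H ^+ 2).
  have -> : z ^+ 2 = (y ^+ 2 * l) * l / (n ^+ 2 * H ^+ 2).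
    by rewrite /z; field; rewrite !gt_eqF.
  by rewrite yV; field; rewrite !gt_eqF.
have <- : z = Num.sqrt (V * l / (n * H ^+ 2)) by rewrite -z2 sqrtr_sqr gtr0_norm.
have M0 : 0 < M by exact: lt_le_trans yM.
have sq : Num.sqrt n^-1 <= z.
  rewrite -[leRHS]gtr0_norm// -sqrtr_sqr ler_wsqrtr// z2.
  rewrite ler_pdivlMr ?mulr_gt0 ?exprn_gt0// mulKf ?gt_eqF//.
  by rewrite (le_trans HV)// ler_peMr// (le_trans _ HV)// exprn_ge0// ltW.
have e1 : M * (1 + L) <= 2 * (1 + k) * (y * l).
  apply: (@le_trans _ _ ((2 * y) * (l + k * l))).
    by apply: ler_pM; rewrite ?(ltW M0)//; lra.
  by rewrite le_eqVlt; apply/orP; left; apply/eqP; ring.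
have e3 : n * (m * H + s) / M <= 2 * k * (y * l).
  rewrite ler_pdivrMr//.
  apply: (@le_trans _ _ (2 * k * (y ^+ 2 * l))).
    rewrite yV (_ : 2 * k * (n * V) = n * (k * V + k * V)); last by ring.
    by rewrite ler_pM2l// lerD.
  rewrite (_ : 2 * k * (y ^+ 2 * l) = 2 * k * (y * l) * y); last by ring.
  by apply: ler_wpM2l yM; rewrite !mulr_ge0 ?(ltW y0) ?(ltW l0).
apply: (@le_trans _ _ ((n * H)^-1 * ((3 + 5 * k) * (y * l)) + z)).
  apply: lerD sq; rewrite ler_pM2l ?invr_gt0 ?mulr_gt0//; lra.
by rewrite le_eqVlt; apply/orP; left; apply/eqP; rewrite /z; field; rewrite !gt_eqF.
Qed.

Lemma truncn_succ_bounds (y : R) : 1 <= y ->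
  y <= (Num.truncn y).+1%:R <= 2 * y.
Proof.
move=> y1; have /andP[yl yu] := truncn_itv (le_trans ler01 y1).
by rewrite ltW//= -natr1; lra.
Qed.

(** Markov's inequality in summed form: beyond [M] the weight [c] is dominated by a multiple of the
    weight [om], for which a bound is known. *)
Lemma weighted_tail_le (t : nat -> \bar R) (om c : nat -> R) (a k : R) (M : nat) :
  (forall i, 0 <= t i)%E -> (forall i, 0 <= om i) -> 0 <= a ->
  (forall i, (M <= i)%N -> c i <= a * om i) ->
  (forall j, \sum_(0 <= i < j) (om i)%:E * t i <= k%:E)%E ->
  (forall j, \sum_(M <= i < j) (c i)%:E * t i <= (a * k)%:E)%E.
Proof.
move=> t0 om0 a0 ca omk j.
apply: (@le_trans _ _ (\sum_(M <= i < j) (a%:E * ((om i)%:E * t i)))%E).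
  rewrite big_nat_cond [leRHS]big_nat_cond; apply: lee_sum => i /andP[/andP[Mi _] _].
  by rewrite muleA -EFinM; apply: lee_wpmul2r => //; rewrite lee_fin; exact: ca.
rewrite -ge0_sume_distrr; last by move=> i _; rewrite mule_ge0// lee_fin.
rewrite EFinM; apply: lee_wpmul2l; first by rewrite lee_fin.
have [jM|Mj] := leqP j M.
  rewrite big_geq//; apply: le_trans (omk 0%N); by rewrite big_geq.
apply: le_trans (omk j); rewrite [leRHS](big_cat_nat (n := M))// ?(ltnW Mj)//=.
by rewrite leeDr// sume_ge0// => i _; rewrite mule_ge0// lee_fin.
Qed.

End rates.

(** * Moments of the block length as weighted tail sums *)

Section moment_tails.
Context d (T : measurableType d) (R : realType) dO (Omega : measurableType dO).
Variables (Pr : probability Omega R) (Z : nat -> {mfun Omega >-> T}) (A : set T).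
Hypothesis mA : measurable A.

(** The first n weights are each at most n^(p - 1), so they sum to at most n^p. *)
Lemma power_moment_tail (p : R) : 1 < p ->
  (\int[Pr]_w (hitting_time Z A w `^ p) < +oo)%E ->
  exists2 k : R, 0 <= k & forall j, (\sum_(0 <= i < j)
    (i.+1%:R `^ (p - 1))%:E * Pr [set w | avoids Z A w i] <= k%:E)%E.
Proof.
move=> p1 fin; have I0 : (0 <= \int[Pr]_w (hitting_time Z A w `^ p))%E.
  by apply: integral_ge0 => w _; exact: poweR_ge0.
exists (fine (\int[Pr]_w (hitting_time Z A w `^ p))%E); first exact: fine_ge0.
move=> j; rewrite fineK ?ge0_fin_numE//.
apply: (sum_avoids_le Pr Z mA (Phi := fun x => (x `^ p)%E)).
- by move=> i; exact: powR_ge0.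
- move=> n; rewrite poweR_EFin lee_fin.
  have [->|n0] := posnP n; first by rewrite big_geq// powR_ge0.
  have -> : n%:R `^ p = \sum_(0 <= i < n) (n%:R : R) `^ (p - 1).
    rewrite big_const_nat iter_addr addr0 subn0 -[RHS]mulr_natr.
    rewrite -[X in _ * X](powRr1 (ler0n R n)) -powRD ?subrK//.
    by rewrite pnatr_eq0 -lt0n n0 implybT.
  apply: ler_sum_nat => i /andP[_ i_n].
  by apply: ge0_ler_powR; rewrite ?nnegrE ?ler_nat//; lra.
- by rewrite poweRyr// gt_eqF//; lra.
Qed.

(** The weights are the increments of the exponential, so their sum telescopes. *)
Lemma exponential_moment_tail (l : R) : 0 < l ->
  (\int[Pr]_w expeR (l%:E * hitting_time Z A w) < +oo)%E ->
  exists2 k : R, 0 <= k & forall j, (\sum_(0 <= i < j)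
    (expR (l * i.+1%:R) - expR (l * i%:R))%:E * Pr [set w | avoids Z A w i] <= k%:E)%E.
Proof.
move=> l0 fin; have I0 : (0 <= \int[Pr]_w expeR (l%:E * hitting_time Z A w))%E.
  by apply: integral_ge0 => w _; exact: expeR_ge0.
exists (fine (\int[Pr]_w expeR (l%:E * hitting_time Z A w))%E); first exact: fine_ge0.
move=> j; rewrite fineK ?ge0_fin_numE//.
apply: (sum_avoids_le Pr Z mA (Phi := fun x => expeR (l%:E * x)%E)).
- by move=> i; rewrite subr_ge0 ler_expR ler_pM2l// ler_nat.
- move=> n; rewrite -EFinM/= lee_fin telescope_sumr// mulr0 expR0.
  by rewrite lerBlDr lerDl.
- by rewrite gt0_muley ?lte_fin.
Qed.

End moment_tails.

Lemma powRD_gt0 (R : realType) (a r s : R) : 0 < a ->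
  a `^ (r + s) = a `^ r * a `^ s.
Proof. by move=> a0; rewrite powRD// (gt_eqF a0) implybT. Qed.

Lemma powR_le1 (R : realType) (a r : R) : 0 <= a <= 1 -> 0 <= r -> a `^ r <= 1.
Proof.
move=> /andP[a0 a1] r0; rewrite -[leRHS](congr1 (fun g => g r) (@powR1 R)).
by apply: ge0_ler_powR; rewrite ?nnegrE.
Qed.

Lemma powR_ge1 (R : realType) (a r : R) : 1 <= a -> 0 <= r -> 1 <= a `^ r.
Proof. by move=> a1 r0; rewrite -[leLHS](powRr0 a); exact: ler_powR. Qed.

(** * The two asymptotic rates *)

Section asymptotic_rates.
Context (R : realType) (d : nat) (t : nat -> \bar R) (h : nat -> R) (beta C : R).
Variable dev : nat -> \bar R.
Hypotheses (d_gt0 : (0 < d)%N) (t_ge0 : forall i, (0 <= t i)%E) (C_gt0 : 0 < C).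
Hypotheses (h_gt0 : forall n, (1 <= n)%N -> 0 < h n)
  (h_cvg0 : h n @[n --> \oo] --> (0 : R)) (beta_gt0 : 0 < beta)
  (h_ge : forall n, (1 <= n)%N -> n%:R `^ (- beta) <= h n).
Hypothesis dev_le : forall (n M m : nat) (r s : R),
  (0 < n)%N -> 0 < h n <= 1 -> (0 < M)%N -> 0 <= r -> 0 <= s ->
  (forall k, \sum_(M <= i < k) t i <= r%:E)%E ->
  (forall k, \sum_(m <= i < k) i.+1%:R%:E * t i <= s%:E)%E ->
  (dev n <= (C * ((n%:R * h n ^+ d)^-1 * (M%:R * (1 + ln (n%:R / h n)) + n%:R * r +
      n%:R * (m%:R * h n ^+ d + s) / M%:R + 1) + Num.sqrt n%:R^-1))%:E)%E.

Lemma near_bandwidth_le1 : \forall n \near \oo, h n <= 1.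
Proof. by apply: (cvgr_le _ h_cvg0). Qed.

Lemma bandwidth_pow_ge n q : (1 <= n)%N -> 0 <= q ->
  n%:R `^ (1 - beta * q) <= n%:R * h n `^ q.
Proof.
move=> n1 q0; have n0 : 0 < n%:R :> R by rewrite ltr0n.
rewrite powRD_gt0//.
rewrite powRr1 ?(ltW n0)// ler_pM2l// -mulNr powRrM.
by apply: ge0_ler_powR; rewrite ?nnegrE ?powR_ge0 ?(ltW (h_gt0 n1)) ?h_ge.
Qed.

Lemma ln_ratio_le n : (1 <= n)%N -> h n <= 1 ->
  ln n%:R <= ln (n%:R / h n) <= (1 + beta) * ln n%:R.
Proof.
move=> n1 h1; have n0 : 0 < n%:R :> R by rewrite ltr0n.
have hn0 := h_gt0 n1; rewrite ln_div ?posrE//.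
have l1 : ln (h n) <= 0 by rewrite ln_le0.
have : - beta * ln n%:R <= ln (h n).
  by rewrite -ln_powR ler_ln ?posrE ?powR_gt0// h_ge.
by move=> ?; apply/andP; split; lra.
Qed.

Lemma polynomial_rate (p k : R) : 2 < p -> 0 <= k -> beta * (p / (p - 1)) < d%:R^-1 ->
  (forall j, \sum_(0 <= i < j) (i.+1%:R `^ (p - 1))%:E * t i <= k%:E)%E ->
  exists C' : R, \forall n \near \oo, (dev n <=
    (C' * Num.sqrt (ln (n%:R * (h n)^-1) /
      (n%:R * h n `^ (d%:R * p / (p - 1)))))%:E)%E.
Proof.
move=> p2 k0 bp tk; exists (C * (4 + 5 * (k + 2))).
have d0 : 0 < d%:R :> R by rewrite ltr0n.
have p1 : 0 < p - 1 by lra.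
set q := d%:R * p / (p - 1).
have q0 : 0 <= q by rewrite divr_ge0 ?mulr_ge0//; lra.
have bq : 0 < 1 - beta * q.
  rewrite subr_gt0 (_ : beta * q = beta * (p / (p - 1)) * d%:R); last by rewrite /q; ring.
  by rewrite -ltr_pdivlMr// div1r.
near=> n.
have n1 : (1 <= n)%N by near: n; exact: nbhs_infty_ge.
have n0 : 0 < n%:R :> R by rewrite ltr0n.
have ne : expR 1 <= n%:R :> R by near: n; exact: nbhs_infty_ger.
have h1 : h n <= 1 by near: n; exact: near_bandwidth_le1.
have h0 := h_gt0 n1.
have lnle : (1 + beta) * ln n%:R <= n%:R `^ (1 - beta * q).
  by near: n; exact: near_ln_le_powR.
have /andP[ln1 ln2] := ln_ratio_le n1 h1.
set l := ln (n%:R * (h n)^-1) in ln1 ln2 *.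
have l1 : 1 <= l.
  by apply: le_trans ln1; rewrite -[leLHS]expRK ler_ln ?posrE ?expR_gt0.
have l0 : 0 < l by lra.
(* The level m = 1 / G equalizes the two parts of the second moment of a block: m h^d, where h^d =
   G^(p-1), and the tail, of order m^(2-p). Both have the order of [V] below, and V / h^(2d) =
   G^(-p) is the power of h in the rate. *)
pose G := h n `^ (d%:R / (p - 1)).
have G0 : 0 < G by rewrite powR_gt0.
have G1 : G <= 1.
  by apply: powR_le1; [rewrite (ltW h0)|rewrite divr_ge0 ?(ltW d0) ?(ltW p1)].
have GI : 1 <= G^-1 by rewrite invf_ge1.
have HE : h n ^+ d = G `^ (p - 1).
  by rewrite -powRrM divfK ?gt_eqF// powR_mulrn// ltW.
have GpE : h n `^ q = G `^ p by rewrite -powRrM /q mulrAC.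
pose V := G `^ (p - 2).
have V0 : 0 < V by rewrite powR_gt0.
have H2 : (h n ^+ d) ^+ 2 = V * G `^ p.
  rewrite HE expr2 -!powRD_gt0//; congr (_ `^ _); lra.
have VG2 : V * G ^+ 2 = G `^ p.
  rewrite -(powR_mulrn _ (ltW G0)) -powRD_gt0//; congr (_ `^ _).
  by rewrite subrK.
have HV : h n ^+ d = V * G.
  by rewrite HE -[X in _ * X](powRr1 (ltW G0)) -powRD_gt0//; congr (_ `^ _); lra.
have Gp1 : G `^ p <= 1.
  by apply: powR_le1; [rewrite (ltW G0)|lra].
(* The condition on [beta] makes n h^q at least a positive power of n, which beats the logarithm.
   This yields [Gy], so that the weight comparison [Vi] also holds beyond [M]. *)
have nG : l <= n%:R * G `^ p.
  apply: le_trans ln2 _; apply: le_trans lnle _.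
  by rewrite -GpE; exact: bandwidth_pow_ge.
pose y := Num.sqrt (n%:R * V / l).
have yy : y ^+ 2 * l = n%:R * V.
  by rewrite sqr_sqrtr ?divfK ?gt_eqF// divr_ge0 ?mulr_ge0 ?(ltW V0) ?(ltW l0).
have Gy : G^-1 <= y.
  rewrite -[leLHS]ger0_norm ?invr_ge0 ?(ltW G0)// -sqrtr_sqr ler_wsqrtr//.
  rewrite ler_pdivlMr// exprVn mulrC ler_pdivrMr ?exprn_gt0//.
  by rewrite -mulrA VG2.
have y1 : 1 <= y by exact: le_trans Gy.
have y0 : 0 < y by exact: lt_le_trans y1.
have /andP[yM My] := truncn_succ_bounds y1.
have /andP[Gm mG] := truncn_succ_bounds GI.
set M := (Num.truncn y).+1 in yM My.
set m := (Num.truncn G^-1).+1 in Gm mG.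
(* Dividing by i + 1 leaves 1 <= (G (i + 1))^(p - 2). The same comparison serves both tails. *)
have Vi i : G^-1 <= i.+1%:R -> i.+1%:R <= V * i.+1%:R `^ (p - 1).
  move=> Gi; have i0 : 0 <= i.+1%:R :> R by [].
  rewrite (_ : p - 1 = (p - 2) + 1); last by lra.
  rewrite powRD_gt0 ?ltr0n// powRr1// mulrA ler_peMl// /V.
  rewrite -powRM ?(ltW G0)//; apply: powR_ge1; last by lra.
  by rewrite mulrC -ler_pdivrMr// div1r.
pose s := V * k; pose r := y^-1 * V * k.
have s0 : 0 <= s by rewrite mulr_ge0// ltW.
have r0 : 0 <= r by rewrite !mulr_ge0// ?invr_ge0 ltW.
have tailr j : (\sum_(M <= i < j) t i <= r%:E)%E.
  rewrite (eq_bigr (fun i => 1%:E * t i)%E); last by move=> i _; rewrite mul1e.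
  apply: (weighted_tail_le (c := fun=> 1) (om := fun i => i.+1%:R `^ (p - 1))) => //.
    by apply: mulr_ge0; rewrite ?invr_ge0; exact: ltW.
  move=> i Mi; have yi : y <= i.+1%:R.
    by apply: le_trans yM _; rewrite ler_nat (leq_trans Mi).
  rewrite -mulrA ler_pdivlMl// mulr1; apply: (le_trans yi); apply: Vi.
  exact: le_trans Gy yi.
have tails j : (\sum_(m <= i < j) i.+1%:R%:E * t i <= s%:E)%E.
  apply: (weighted_tail_le (om := fun i => i.+1%:R `^ (p - 1))) => //; first exact: ltW.
  move=> i mi; apply: Vi; apply: le_trans Gm _.
  by rewrite ler_nat (leq_trans mi).
have h01 : 0 < h n <= 1 by rewrite h0.
apply: le_trans (dev_le n1 h01 (ltn0Sn _) r0 s0 tailr tails) _.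
rewrite lee_fin -[leRHS]mulrA ler_pM2l// -/l -/M.
have -> : l / (n%:R * h n `^ q) = V * l / (n%:R * (h n ^+ d) ^+ 2).
  by rewrite H2 GpE; field; rewrite !gt_eqF ?powR_gt0.
apply: (rate_bound (y := y)) => //.
- by rewrite exprn_gt0.
- by rewrite (ltW l0) ler_peMl ?(ltW l0)//; lra.
- by rewrite H2 ler_piMr// ltW.
- by rewrite yM.
- rewrite mulr_ge0 ?exprn_ge0 ?(ltW h0)//= HV.
  apply: (@le_trans _ _ (2 * G^-1 * (V * G))).
    by rewrite ler_wpM2r// mulr_ge0 ?(ltW V0) ?(ltW G0).
  rewrite (_ : 2 * G^-1 * (V * G) = 2 * V); last by field; rewrite gt_eqF.
  by rewrite ler_pM2r//; lra.
- by rewrite s0/= /s mulrC ler_pM2r//; lra.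
- rewrite /r (_ : n%:R * _ = (n%:R * V) * k / y); last by ring.
  rewrite -yy ler_pdivrMr// (_ : y ^+ 2 * l * k = k * (y * l) * y); last by ring.
  by rewrite !ler_pM2r ?mulr_gt0//; lra.
Unshelve. all: by end_near. Qed.

Lemma exponential_rate (lambda k : R) : 0 < lambda -> 0 <= k -> beta < d%:R^-1 ->
  (forall j, \sum_(0 <= i < j)
    (expR (lambda * i.+1%:R) - expR (lambda * i%:R))%:E * t i <= k%:E)%E ->
  exists C' : R, \forall n \near \oo, (dev n <=
    (C' * Num.sqrt (ln n%:R ^+ 2 / (n%:R * h n ^+ d)))%:E)%E.
Proof.
move=> la0 k0 bd tk.
have d0 : 0 < d%:R :> R by rewrite ltr0n.
(* Chosen so that b (i + 1) <= 1 + lambda i / 2. *)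
pose b := Num.min 1 (lambda / 2).
have b0 : 0 < b by rewrite lt_min ltr01 divr_gt0.
have b1 : b <= 1 by rewrite ge_min lexx.
have b2 : b <= lambda / 2 by rewrite ge_min lexx orbT.
have lb0 : 0 < lambda * b by rewrite mulr_gt0.
pose k' := (lambda * b)^-1 * k.
have k'0 : 0 <= k' by rewrite mulr_ge0// invr_ge0 ltW.
have la2 : 0 < 2 / lambda by rewrite divr_gt0.
pose kk := k' + (2 / lambda + 1) + (1 + beta).
have bq : 0 < (1 - beta * d%:R) / 2.
  by rewrite divr_gt0// subr_gt0 -ltr_pdivlMr// div1r.
exists (C * (4 + 5 * kk)); near=> n.
have n1 : (1 <= n)%N by near: n; exact: nbhs_infty_ge.
have n1R : 1 <= n%:R :> R by rewrite ler1n.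
have n0 : 0 < n%:R :> R by rewrite ltr0n.
have ne : expR 1 <= n%:R :> R by near: n; exact: nbhs_infty_ger.
have h1 : h n <= 1 by near: n; exact: near_bandwidth_le1.
have h0 := h_gt0 n1.
have lnle : 2 / lambda * ln n%:R <= n%:R `^ ((1 - beta * d%:R) / 2).
  by near: n; exact: near_ln_le_powR.
have /andP[ln1 ln2] := ln_ratio_le n1 h1.
set l := ln n%:R in ln1 ln2 lnle *.
have l1 : 1 <= l by rewrite -[leLHS]expRK ler_ln ?posrE ?expR_gt0.
have l0 : 0 < l by lra.
set H := h n ^+ d.
have H0 : 0 < H by rewrite exprn_gt0.
have H1 : H <= 1 by rewrite exprn_ile1// ltW.
have nH : n%:R `^ (1 - beta * d%:R) <= n%:R * H.
  by rewrite /H -powR_mulrn ?(ltW h0)//; exact: bandwidth_pow_ge.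
(* The second moment of a block is of order H l here, since [m] is of order l and the tails are O(1
   / n); the factor l then cancels in the balance y^2 l = n V. *)
pose y := Num.sqrt (n%:R * H).
have yy : y ^+ 2 = n%:R * H by rewrite sqr_sqrtr// mulr_ge0 ?(ltW n0) ?(ltW H0).
have yn : n%:R `^ ((1 - beta * d%:R) / 2) <= y.
  rewrite -[leLHS]ger0_norm ?powR_ge0// -sqrtr_sqr ler_wsqrtr//.
  rewrite expr2 -powRD_gt0//.
  by rewrite (_ : _ / 2 + _ / 2 = 1 - beta * d%:R)//; lra.
have y1 : 1 <= y.
  by apply: le_trans yn; apply: powR_ge1 => //; exact: ltW.
have y0 : 0 < y by exact: lt_le_trans y1.
have nH1 : 1 <= n%:R * H by rewrite -yy exprn_ege1.
have /andP[yM My] := truncn_succ_bounds y1.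
set M := (Num.truncn y).+1 in yM My.
have ll0 : 0 <= 2 / lambda * l by rewrite mulr_ge0 ?(ltW la2) ?(ltW l0).
have /andP[mlo mup] := truncn_itv ll0.
set m := (Num.truncn (2 / lambda * l)).+1.
pose a := (lambda * b)^-1 * n%:R^-1.
have a0 : 0 <= a by rewrite mulr_ge0 ?invr_ge0 ?(ltW lb0) ?(ltW n0).
(* The increment contains exp (lambda i), split into two square roots: one is at least n from this
   index on, the other dominates b (i + 1). *)
have om_ge (i : nat) : 2 / lambda * l <= i%:R ->
    i.+1%:R <= a * (expR (lambda * i.+1%:R) - expR (lambda * i%:R)).
  move=> li; rewrite /a -mulrA ler_pdivlMl// ler_pdivlMl//.
  have e1 : n%:R <= expR (lambda * i%:R / 2).
    rewrite -[leLHS]lnK ?posrE// ler_expR -/l.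
    by rewrite (_ : l = lambda * (2 / lambda * l) / 2);
      [rewrite ler_wpM2r// ler_pM2l|field; rewrite gt_eqF].
  have e2 : b * i.+1%:R <= expR (lambda * i%:R / 2).
    apply: le_trans (expR_ge1Dx _).
    rewrite -natr1 mulrDr mulr1 addrC; apply: lerD => //.
    by rewrite mulrAC ler_wpM2r.
  have e3 : lambda <= expR lambda - 1 by have := expR_ge1Dx lambda; lra.
  have -> : expR (lambda * i.+1%:R) - expR (lambda * i%:R) =
      expR (lambda * i%:R / 2) * (expR (lambda * i%:R / 2) * (expR lambda - 1)).
    rewrite mulrA -expRD -splitr mulrBr mulr1 -expRD; congr (expR _ - _).
    by rewrite -natr1 mulrDr mulr1.
  apply: ler_pM => //; first by rewrite !mulr_ge0// ?(ltW la0) ?(ltW b0).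
  rewrite [leLHS](_ : _ = b * i.+1%:R * lambda); last by ring.
  by apply: ler_pM => //; [apply: mulr_ge0 => //; exact: ltW|exact: ltW].
pose s := a * k.
have sE : s = k' / n%:R by rewrite /s /a /k'; ring.
have s0 : 0 <= s by rewrite mulr_ge0.
have om0 i : 0 <= expR (lambda * i.+1%:R) - expR (lambda * i%:R).
  by rewrite subr_ge0 ler_expR ler_pM2l// ler_nat.
have tailr j : (\sum_(M <= i < j) t i <= s%:E)%E.
  rewrite (eq_bigr (fun i => 1%:E * t i)%E); last by move=> i _; rewrite mul1e.
  apply: (weighted_tail_le (c := fun=> 1) (om :=
    fun i => expR (lambda * i.+1%:R) - expR (lambda * i%:R))) => //.
  move=> i Mi; apply: le_trans (om_ge i _); first by rewrite ler1n.
  apply: le_trans lnle _; apply: le_trans yn _; apply: le_trans yM _.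
  by rewrite ler_nat.
have tails j : (\sum_(m <= i < j) i.+1%:R%:E * t i <= s%:E)%E.
  apply: (weighted_tail_le (om :=
    fun i => expR (lambda * i.+1%:R) - expR (lambda * i%:R))) => //.
  move=> i mi; apply: om_ge; apply: le_trans (ltW mup) _.
  by rewrite ler_nat.
have h01 : 0 < h n <= 1 by rewrite h0.
apply: le_trans (dev_le n1 h01 (ltn0Sn _) s0 s0 tailr tails) _.
rewrite lee_fin -[leRHS]mulrA ler_pM2l// -/H -/M.
have -> : l ^+ 2 / (n%:R * H) = (H * l) * l / (n%:R * H ^+ 2).
  by field; rewrite !gt_eqF.
have nV : n%:R^-1 <= H * l.
  by rewrite -div1r ler_pdivrMr// mulrC mulrA mulr_ege1.
have la21 : 0 <= 2 / lambda + 1 by lra.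
have be0 : 0 <= 1 + beta by rewrite addr_ge0// ltW.
have kk1 : k' <= kk by rewrite /kk -addrA lerDl addr_ge0.
have kk2 : 2 / lambda + 1 <= kk by rewrite /kk addrAC lerDr addr_ge0.
have kk3 : 1 + beta <= kk by rewrite /kk lerDr addr_ge0.
apply: (rate_bound (y := y)) => //.
- rewrite (le_trans (ltW l0) ln1)/=; apply: (le_trans ln2).
  by apply: ler_wpM2r kk3; exact: ltW.
- by rewrite yy; ring.
- rewrite expr2 ler_pM2l// (le_trans H1)//.
- by rewrite yM.
- rewrite mulr_ge0 ?(ltW H0)//= [H * l]mulrC mulrA ler_pM2r//.
  apply: (@le_trans _ _ ((2 / lambda + 1) * l)); last first.
    by apply: ler_wpM2r kk2; exact: ltW.
  by rewrite /m -[leLHS]natr1 [leRHS]mulrDl mul1r; exact: lerD.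
- rewrite s0 sE/=; apply: ler_pM => //; by rewrite invr_ge0 ltW.
- rewrite sE mulrC divfK ?gt_eqF// -[leLHS]mulr1.
  by apply: ler_pM => //; rewrite mulr_ege1.
Unshelve. all: by end_near. Qed.

End asymptotic_rates.

(** * From the moment conditions to the rates *)

Lemma series_fin (R : realType) (t : nat -> \bar R) (a : R) :
  (forall i, 0 <= t i)%E -> (forall j, \sum_(0 <= i < j) t i <= a%:E)%E ->
  (\sum_(i <oo) t i < +oo)%E.
Proof.
move=> t0 ta; apply: (@le_lt_trans _ _ a%:E); last exact: ltry.
by apply: lime_le; [exact: is_cvg_nneseries|exact: nearW].
Qed.

Theorem theorem7 (R : realType) (d : nat) (d_gt0 : (0 < d)%N)
  (* the state space E = range emb, with its sigma-field *)
  (dE : measure_display) (E : measurableType dE)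
  (E_cg : countably_generated E)
  (emb : E -> Rd R d) (emb_inj : injective emb)
  (emb_meas : measurable_fun setT emb)
  (* the chain X, under every initial law, and the given initial measure nu *)
  (dO : measure_display) (Omega : measurableType dO)
  (P : R.-pker E ~> E) (X : nat -> {mfun Omega >-> E})
  (PP : probability E R -> probability Omega R)
  (X_chain : markov_family P PP X)
  (nu : probability E R)
  (psi : {sigma_finite_measure set E -> \bar R})
  (X_harris : positive_harris P PP X psi)
  (X_aperiodic : aperiodic P psi)
  (* the small set S, with m = 1 *)
  (S : set E) (delta : R) (Psi : probability E R)
  (S_small : small_set P 1 S delta Psi)
  (S_sup : (ereal_sup [set (\int[PP \d_x]_w hitting_time X S w)%E | x in S]
              < +oo)%E)
  (S_nu : (\int[PP nu]_w hitting_time X S w < +oo)%E)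
  (* the split chain Z started in its atom; E_A is expectation under PA *)
  (dA : measure_display) (OmegaA : measurableType dA)
  (PA : probability OmegaA R) (Z : nat -> {mfun OmegaA >-> (E * bool)%type})
  (Z_chain : split_chain_from_atom P S delta Psi PA Z)
  (* the stationary distribution mu and its density f *)
  (mu : probability E R) (mu_stat : stationary P mu)
  (f : Rd R d -> R) (f_meas : measurable_fun setT f)
  (f_ge0 : forall x, 0 <= f x)
  (f_bounded : exists M : R, forall x, f x <= M)
  (f_density : forall B : set (Rd R d), measurable B ->
     mu (emb @^-1` B) = (\int[lebesgue_Rd d]_(x in B) (f x)%:E)%E)
  (* the kernel and the bandwidths *)
  (K : Rd R d -> R) (K0 : R -> R) (U : R)
  (K_int : (\int[lebesgue_Rd d]_x (K x)%:E = 1)%E)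
  (K_le : forall x, K x <= U)
  (K0_profile : kernel_profile K0) (K_form : kernel_form K K0)
  (h : nat -> R) (h_gt0 : forall n, (1 <= n)%N -> 0 < h n)
  (h_cvg0 : h n @[n --> \oo] --> (0 : R))
  (beta : R) (beta_gt0 : 0 < beta)
  (h_ge : forall n, (1 <= n)%N -> n%:R `^ (- beta) <= h n) :
  let pihat (n : nat) (x : Rd R d) (w : Omega) : R :=
    kde K (h n) n (fun i => emb (X i w)) x in
  let sup_dev (n : nat) (w : Omega) : \bar R :=
    ereal_sup [set `|(pihat n x w)%:E - 'E_(PP mu)[pihat n x]|%E | x in setT] in
  let tauA := hitting_time Z (atom S) in
  (forall p : R, 2 < p ->
     (\int[PA]_w (tauA w `^ p) < +oo)%E ->
     0 < beta * (p / (p - 1)) < d%:R^-1 ->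
     exists C : R, \forall n \near \oo,
       (\int[PP nu]_w sup_dev n w <=
         (C * Num.sqrt (ln (n%:R * (h n)^-1) /
                        (n%:R * h n `^ (d%:R * p / (p - 1)))))%:E)%E)
  /\
  ((exists2 lambda : R, 0 < lambda &
      (\int[PA]_w expeR (lambda%:E * tauA w) < +oo)%E) ->
   0 < beta < d%:R^-1 ->
   exists C : R, \forall n \near \oo,
     (\int[PP nu]_w sup_dev n w <=
       (C * Num.sqrt (ln n%:R ^+ 2 / (n%:R * h n ^+ d)))%:E)%E).
Proof.
move=> pihat sup_dev tauA.
have mA : measurable (atom S) by apply: measurableX => //; case: S_small.
have t0 i : (0 <= block_tail S PA Z i)%E by exact: measure_ge0.
have bound fin := expected_deviation_le X_chain X_harris.1 S_small S_sup S_nu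
  Z_chain mu_stat fin d_gt0 emb_meas f_meas f_ge0 f_bounded f_density K0_profile K_form.
(* The deviation bound presupposes a finite mean block length; it follows from either moment because
   the weights stay above a positive constant. *)
have tail_fin (om : nat -> R) (a k : R) : (forall i, 0 <= om i) -> 0 <= a ->
    (forall i, 1 <= a * om i) ->
    (forall j, \sum_(0 <= i < j) (om i)%:E * block_tail S PA Z i <= k%:E)%E ->
    (\sum_(i <oo) block_tail S PA Z i < +oo)%E.
  move=> om0 a0 om1 omk; apply: (@series_fin _ _ (a * k)) => // j.
  rewrite (eq_bigr (fun i => 1%:E * block_tail S PA Z i)%E) => [|i _]; last by rewrite mul1e.
  exact: (weighted_tail_le (c := fun=> 1) t0 om0 a0).
split=> [p p2 mom /andP[_ bp]|[lambda la0 mom] /andP[_ bd]].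
  have p1 : 1 < p by lra.
  have [k k0 tk] := power_moment_tail mA p1 mom.
  have fin : (\sum_(i <oo) block_tail S PA Z i < +oo)%E.
    apply: (tail_fin _ 1 k _ _ _ tk) => // i.
    by rewrite mul1r; apply: powR_ge1; [rewrite ler1n|lra].
  have [C C0 devC] := bound fin.
  apply: (@polynomial_rate _ _ _ h beta C (fun n => \int[PP nu]_w sup_dev n w)%E
    d_gt0 t0 C0 h_gt0 h_cvg0 h_ge _ p k) => //.
  by move=> n M m r s *; exact: devC.
have [k k0 tk] := exponential_moment_tail mA la0 mom.
have fin : (\sum_(i <oo) block_tail S PA Z i < +oo)%E.
  apply: (tail_fin _ lambda^-1 k _ _ _ tk) => [i||i].
  - by rewrite subr_ge0 ler_expR ler_pM2l// ler_nat.
  - by rewrite invr_ge0 ltW.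
  rewrite ler_pdivlMl// mulr1 -[i.+1%:R]natr1 mulrDr mulr1 expRD -{2}[expR _]mulr1 -mulrBr.
  have : 1 <= expR (lambda * i%:R) by rewrite -[leLHS]expR0 ler_expR mulr_ge0// ltW.
  have : lambda <= expR lambda - 1 by have := expR_ge1Dx lambda; lra.
  by move=> e1 e2; rewrite -[leLHS]mul1r; apply: ler_pM => //; exact: ltW.
have [C C0 devC] := bound fin.
apply: (@exponential_rate _ _ _ h beta C (fun n => \int[PP nu]_w sup_dev n w)%E
  d_gt0 t0 C0 h_gt0 h_cvg0 beta_gt0 h_ge _ lambda k) => //.
by move=> n M m r s *; exact: devC.
Qed.
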